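(* Let $\mathbf A=(A;A_1,A_2;M)$ be a special double affine bundle and let $\mathbf D_3=(D_3,\sigma)$ be its core with its distinguished section. Then $$\begin{array}{ccc} A^{\#A_1}&\longrightarrow&D_3^{\ddagger}\\ \downarrow&&\downarrow\\ A_1&\longrightarrow&M\end{array}$$ is also a special double affine bundle, with core equal to $(A_2^\dagger,1_{A_2})$.
   Context: All manifolds and maps are smooth, bundles have finite rank, and the base $M$ is connected. A double vector bundle $(D;D_1,D_2;M)$ is a commuting diagram of four vector bundles $D\to D_1$, $D\to D_2$, $D_1\to M$, $D_2\to M$ such that the homotheties of $D\to D_1$ and of $D\to D_2$ commute. Its core is the vector bundle over $M$ of points of $D$ projecting to the zero sections of both $D_1$ and $D_2$. A double affine bundle $(A;A_1,A_2;M)$ is a commuting diagram of four affine bundles $\pi_1:A\to A_1$, $\pi_2:A\to A_2$, $\pi_1':A_2\to M$, $\pi_2':A_1\to M$ such that: (i) $(\pi_1,\pi_1')$ is a morphism of affine bundles from $\pi_2$ to $\pi_2'$, and $(\pi_2,\pi_2')$ from $\pi_1$ to $\pi_1'$; (ii) $(\pi_1,\pi_2):A\to A_1\times_MA_2$ is surjective; (iii) for each $\lambda\in\mathbb R$, $i=1,2$, the fibrewise affine combination map $\mathrm{aff}_i(-,-;\lambda):A\times_{\pi_i}A\to A$ (weights $\lambda,1-\lambda$) is a morphism of affine bundles (for $i=1$: from $A\times_{\pi_1}A\to A_2\times_{\pi_1'}A_2$ to $\pi_2$; for $i=2$ symmetrically). It has local adapted coordinates $(x;y^j,z^a;c^u)$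 ($(x,y)$ on $A_1$, $(x,z)$ on $A_2$) with transitions $y'^j=\alpha_0^j+\sum_i\alpha_i^jy^i$, $z'^a=\beta_0^a+\sum_b\beta_b^az^b$, $c'^u=\gamma_{00}^u+\sum_i\gamma_{i0}^uy^i+\sum_b\gamma_{0b}^uz^b+\sum_{i,b}\gamma_{ib}^uy^iz^b+\sum_w\sigma_w^uc^w$, coefficients depending on $x$. The vector hull $\widehat A$ of an affine space $A$ is the vector space spanned by symbols $x_a$, $a\in A$, modulo $x_{\lambda a+(1-\lambda)b}=\lambda x_a+(1-\lambda)x_b$; it contains $A$ and the model space $\mathcal V(A)$ as level sets $1$ and $0$ of the canonical linear function; fibrewise for bundles. The hull of a double affine bundle is the double vector bundle $\mathbf D=(D;D_1,D_2;M)$, $D_i=\widehat{A_i}$, obtained by taking vector hulls first with respect to one affine structure and then the other; its coordinates $(x;\widehat y^j,t,\widehat z^a,s;\widehat{\widehat c}^u)$ transform by $s'=s$, $t'=t$, $\widehat y'^j=\alpha_0^jt+\sum_i\alpha_i^j\widehat y^i$, $\widehat z'^a=\beta_0^as+\sum_b\beta_b^a\widehat z^b$, $\widehat{\widehat c}\,'^u=\gamma_{00}^ust+\sum_i\gamma_{i0}^u\widehat y^is+\sum_b\gamma_{0b}^u\widehat z^bt+\sum_{i,b}\gamma_{ib}^u\widehat y^i\widehat z^b+\sum_w\sigma_w^u\widehat{\widehat c}^w$; $A=\{s=t=1\}\subset D$. The core $D_3$ of $\mathbf A$ is the core of $\mathbf D$ (coordinates $(x;\widehat{\widehat c})$). A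 special double affine bundle is a double affine bundle with a distinguished nowhere vanishing section $\sigma$ of its core $D_3\to M$. For $a\in A_i$ over $m\in M$, the core fibre $(D_3)_m$ is canonically a subspace of the model space of the fibre $\pi_i^{-1}(a)$ (the translations in the $c$-directions); so $\sigma$ induces a nowhere vanishing section $\sigma_i$ of the model vector bundle $\mathcal V_i(A)\to A_i$, making $\pi_i:A\to A_i$ a special affine bundle (an affine bundle with a distinguished nowhere vanishing section of its model bundle). The affine dual of a special affine space $(A,v_A)$ is the affine space $A^\#$ of affine maps $f:A\to\mathbb R$ whose linear part satisfies $f^v(v_A)=1$; it is special, with distinguished element the constant function $1_A\in\mathcal V(A^\#)$. $A^{\#A_1}\to A_1$ is the fibrewise affine dual of the special affine bundle $(\pi_1:A\to A_1,\sigma_1)$. $D_3^\ddagger=\{\phi\in D_3^*:\phi(\sigma)=1\}$, an affine bundle over $M$. $A_2^\dagger\to M$ is the vector bundle with fibres $\mathrm{Aff}((A_2)_m,\mathbb R)$, with distinguished section the constant function $1_{A_2}$. The projection $A^{\#A_1}\to D_3^\ddagger$ sends an affine function $f$ on $\pi_1^{-1}(a)$ to the restriction of its linear part to $(D_3)_m$. For $f_1,f_2$ in the same fibre of this projection, lying over $a_1,a_1'\in A_1$, the combination with weights $\lambda,1-\lambda$ is the affine function $f$ on $\pi_1^{-1}(\lambda a_1+(1-\lambda)a_1')$ determined by $f(\mathrm{aff}_2(x,y;\lambda))=\lambda f_1(x)+(1-\lambda)f_2(y)$ for all $x\in\pi_1^{-1}(a_1)$, $y\in\pi_1^{-1}(a_1')$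 with $\pi_2(x)=\pi_2(y)$. *)

(* Defs.v *)
From HB Require Import structures.
From mathcomp Require Import all_boot all_order all_algebra.
From mathcomp Require Import all_classical all_reals all_analysis.

Set Implicit Arguments.
Unset Strict Implicit.
Unset Printing Implicit Defensive.

Import Order.TTheory GRing.Theory Num.Theory.
Import numFieldNormedType.Exports.
Local Open Scope classical_set_scope.
Local Open Scope ring_scope.

Fixpoint Ck (R : realType) (V W : normedModType R) (k : nat) (U : set V)
    (f : V -> W) : Prop :=
  (forall x, U x -> {for x, continuous f}) /\
  if k is k'.+1 then
    (forall x v, U x -> derivable f x v) /\ (forall v, Ck k' U ('D_v f))
  else True.

(* Only meant for open [U]; then all iterated directional derivatives exist
   and are continuous on [U]. *)
Definition smooth_on (R : realType) (V W : normedModType R) (U : set V)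
    (f : V -> W) : Prop :=
  forall k, Ck k U f.

(** A manifold is a bare type with an atlas; its topology ([mopen]) is the one
    the atlas induces.  The dimension is carried by the charts, hence is locally
    constant, and constant when the manifold is connected. *)

Record chart (R : realType) (X : Type) := Chart {
  cdim : nat;
  cdom : set X;
  cmap : X -> 'rV[R]_cdim }.

Record mfd (R : realType) := Mfd {
  mpt :> Type;
  atlas : set (chart R mpt) }.

Section Manifolds.
Variable R : realType.

Definition smooth_overlap (X : Type) (c d : chart R X) : Prop :=
  open (cmap c @` (cdom c `&` cdom d)) /\
  exists2 g : 'rV[R]_(cdim c) -> 'rV[R]_(cdim d),
    smooth_on (cmap c @` (cdom c `&` cdom d)) g &
    forall x, cdom c x -> cdom d x -> g (cmap c x) = cmap d x.

(* The charts of the maximal atlas. *)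
Definition mchart (X : mfd R) (c : chart R X) : Prop :=
  [/\ {in cdom c &, injective (cmap c)},
      open (cmap c @` cdom c) &
      forall d, atlas d -> smooth_overlap c d /\ smooth_overlap d c].

Definition mopen (X : mfd R) (W : set X) : Prop :=
  forall c : chart R X, atlas c -> open (cmap c @` (cdom c `&` W)).

Definition manifold (X : mfd R) : Prop :=
  [/\ forall c : chart R X, atlas c -> mchart c,
      forall x : X, exists2 c : chart R X, atlas c & cdom c x,
      forall x y : X, x <> y -> exists U V : set X,
        [/\ mopen U, mopen V, U x, V y & U `&` V = set0] &
      exists B : nat -> set X, (forall i, mopen (B i)) /\
        forall (U : set X) x, mopen U -> U x -> exists2 i, B i x & B i `<=` U].

Definition mconnected (X : mfd R) : Prop :=
  forall W : set X, mopen W -> mopen (~` W) -> W = set0 \/ W = setT.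

Definition smooth_map (X Y : mfd R) (f : X -> Y) : Prop :=
  forall (c : chart R X) (d : chart R Y), atlas c -> atlas d ->
    open (cmap c @` (cdom c `&` f @^-1` cdom d)) /\
    exists2 g : 'rV[R]_(cdim c) -> 'rV[R]_(cdim d),
      smooth_on (cmap c @` (cdom c `&` f @^-1` cdom d)) g &
      forall x, cdom c x -> cdom d (f x) -> g (cmap c x) = cmap d (f x).

Definition diffeo (X Y : mfd R) (f : X -> Y) : Prop :=
  smooth_map f /\
  exists g : Y -> X, [/\ smooth_map g, cancel f g & cancel g f].

Definition prod_mfd (X Y : mfd R) : mfd R :=
  Mfd [set e | exists (c : chart R X) (d : chart R Y), [/\ atlas c, atlas d &
    e = @Chart R (X * Y) (cdim c + cdim d) (cdom c `*` cdom d)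
          (fun xy => row_mx (cmap c xy.1) (cmap d xy.2))]].

(* The manifold structure of an embedded submanifold [S], by slice charts: the
   charts of [X] in which [S] is the vanishing locus of the last coordinates. *)
Definition sub_mfd (X : mfd R) (S : set X) : mfd R :=
  @Mfd R (set_type S) [set e | exists (k l : nat) (U : set X)
    (phi : X -> 'rV[R]_(k + l)),
    [/\ mchart (Chart U phi),
        forall x, U x -> (S x <-> rsubmx (phi x) = 0) &
        e = @Chart R (set_type S) k [set s | U (val s)]
              (fun s => lsubmx (phi (val s)))]].

(* [aff l e e'] is the combination of [e] and [e'] with weights [l] and [1 - l];
   it is meaningful only for [e] and [e'] in the same fibre. *)
Record abun := Abun {
  tot : mfd R;
  base : mfd R;
  bproj : tot -> base;
  aff : R -> tot -> tot -> tot }.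

(* [phi] gives fibrewise affine coordinates, and together with the chart [d] of
   the base a diffeomorphism from [bproj @^-1` cdom d] onto
   [(cmap d @` cdom d) * R ^ k]. *)
Definition affine_triv (E : abun) (d : chart R (base E)) (k : nat)
    (phi : tot E -> 'rV[R]_k) : Prop :=
  [/\ mchart d,
      @mchart (tot E) (Chart (@bproj E @^-1` cdom d)
                             (fun e => row_mx (cmap d (bproj e)) (phi e))),
      forall b v, cdom d b -> exists e, bproj e = b /\ phi e = v &
      forall l e e', cdom d (bproj e) -> bproj e' = bproj e ->
        bproj (aff l e e') = bproj e /\
        phi (aff l e e') = l *: phi e + (1 - l) *: phi e'].

Definition affine_bundle (E : abun) : Prop :=
  [/\ manifold (tot E), manifold (base E), smooth_map (@bproj E) &
      forall b : base E, exists d k (phi : tot E -> 'rV[R]_k),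
        cdom d b /\ affine_triv d phi].

Definition affine_morphism (E E' : abun) (F : tot E -> tot E')
    (F0 : base E -> base E') : Prop :=
  [/\ smooth_map F, smooth_map F0, forall e, bproj (F e) = F0 (bproj e) &
      forall l e e', bproj e = bproj e' -> F (aff l e e') = aff l (F e) (F e')].

Definition fibprod (E : abun) : mfd R :=
  sub_mfd (X := prod_mfd (tot E) (tot E))
    [set xy | bproj xy.1 = bproj xy.2].

(** The vector hull of the fibre over [b] consists of the formal linear
    combinations of points of this fibre, represented by lists of weighted
    points, modulo [hull_eq b]. *)

Inductive hull_eq (E : abun) (b : base E) :
    seq (R * tot E) -> seq (R * tot E) -> Prop :=
| hull_refl w : hull_eq b w w
| hull_sym w w' : hull_eq b w w' -> hull_eq b w' w
| hull_trans w w' w'' : hull_eq b w w' -> hull_eq b w' w'' -> hull_eq b w w''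
| hull_cat v v' w w' :
    hull_eq b v v' -> hull_eq b w w' -> hull_eq b (v ++ w) (v' ++ w')
| hull_catC v w : hull_eq b (v ++ w) (w ++ v)
| hull_zero e : hull_eq b [:: (0, e)] [::]
| hull_addr r s e : hull_eq b [:: (r, e); (s, e)] [:: (r + s, e)]
| hull_aff r l e e' : bproj e = b -> bproj e' = b ->
    hull_eq b [:: (r, aff l e e')] [:: (r * l, e); (r * (1 - l), e')].

Definition in_fiber (E : abun) (b : base E) (w : seq (R * tot E)) : bool :=
  all (fun re => `[< bproj re.2 = b >]) w.

Definition hull_class (E : abun) (b : base E) (w : seq (R * tot E)) :
    set (seq (R * tot E)) :=
  [set w' | in_fiber b w' /\ hull_eq b w w'].

Record hull (E : abun) := Hull {
  hproj : base E;
  hclass : set (seq (R * tot E));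
  hullP : exists2 w, in_fiber hproj w & hclass = hull_class hproj w }.

(* The class of [w], used only for [w] in the fibre over [b] (otherwise the
   points of [w] outside this fibre are dropped). *)
Definition hmk (E : abun) (b : base E) (w : seq (R * tot E)) : hull E :=
  Hull (ex_intro2 _ _ [seq re <- w | `[< bproj re.2 = b >]]
          (filter_all _ w) erefl).

Definition hrep (E : abun) (h : hull E) : seq (R * tot E) :=
  xget ([::] : {classic seq (R * tot E)}) (hclass h).

Definition hpt (E : abun) (e : tot E) : hull E := hmk (bproj e) [:: (1, e)].

Definition hzero (E : abun) (b : base E) : hull E := hmk b [::].

Definition hadd (E : abun) (h h' : hull E) : hull E :=
  hmk (hproj h) (hrep h ++ hrep h').

Definition hscale (E : abun) (r : R) (h : hull E) : hull E :=
  hmk (hproj h) [seq (r * re.1, re.2) | re <- hrep h].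

Definition hsub (E : abun) (h h' : hull E) : hull E := hadd h (hscale (-1) h').

(* The linear extension to the hull of a fibrewise affine function [f]; on the
   model space (where the extension of the constant function 1 vanishes) it is
   the linear part of [f]. *)
Definition hext (E : abun) (V : lmodType R) (f : tot E -> V) (h : hull E) : V :=
  \sum_(re <- hrep h) re.1 *: f re.2.

Definition hmap (E E' : abun) (F : tot E -> tot E') (F0 : base E -> base E')
    (h : hull E) : hull E' :=
  hmk (F0 (hproj h)) [seq (re.1, F re.2) | re <- hrep h].

Definition hull_mfd (E : abun) : mfd R :=
  @Mfd R (hull E) [set c | exists d k (phi : tot E -> 'rV[R]_k),
    affine_triv d phi /\
    c = @Chart R (hull E) (cdim d + (k + 1)) (@hproj E @^-1` cdom d)
          (fun h => row_mx (cmap d (hproj h))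
             (row_mx (hext phi h) (hext (fun=> const_mx 1) h)))].

(* A point is a pair of a base point [b] and an affine function on the fibre
   over [b], extended by 0 to the whole total space. *)
Definition dagger_pred (E : abun) : set (base E * (tot E -> R)) :=
  [set bf | (forall l e e', bproj e = bf.1 -> bproj e' = bf.1 ->
                bf.2 (aff l e e') = l * bf.2 e + (1 - l) * bf.2 e') /\
            (forall e, bproj e <> bf.1 -> bf.2 e = 0)].

Definition dagger_type (E : abun) : Type := set_type (@dagger_pred E).

Definition dpt (E : abun) (f : dagger_type E) : base E := (val f).1.

Definition dfun (E : abun) (f : dagger_type E) : tot E -> R := (val f).2.

(* The coordinates of [f = a0 + \sum_j a_j phi_j] are [a0] and the [a_j]. *)
Definition dagger (E : abun) : mfd R :=
  @Mfd R (dagger_type E) [set c | exists d k (phi : tot E -> 'rV[R]_k)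
    (a0 : dagger_type E -> R) (a : dagger_type E -> 'rV[R]_k),
    [/\ affine_triv d phi,
        forall f, cdom d (dpt f) -> forall e, bproj e = dpt f ->
          dfun f e = a0 f + \sum_j a f ord0 j * phi e ord0 j &
        c = @Chart R (dagger_type E) (cdim d + (1 + k)) (@dpt E @^-1` cdom d)
              (fun f => row_mx (cmap d (dpt f))
                 (row_mx (const_mx (a0 f)) (a f)))]].

(* The affine dual of the special affine bundle [(E, v)], where [v] is a section
   of the model bundle, i.e. of the level set 0 in the hull. *)
Definition sharp (E : abun) (v : base E -> hull E) : mfd R :=
  sub_mfd (X := dagger E)
    [set f | hext (dfun f : tot E -> R^o) (v (dpt f)) = 1].

Record dab := Dab {
  dA : mfd R; dA1 : mfd R; dA2 : mfd R; dM : mfd R;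
  pi1 : dA -> dA1;
  pi2 : dA -> dA2;
  pi1' : dA2 -> dM;
  pi2' : dA1 -> dM;
  aff1 : R -> dA -> dA -> dA;
  aff2 : R -> dA -> dA -> dA;
  aff1' : R -> dA2 -> dA2 -> dA2;
  aff2' : R -> dA1 -> dA1 -> dA1 }.

Definition swap (A : dab) : dab :=
  Dab (@pi2 A) (@pi1 A) (@pi2' A) (@pi1' A)
      (@aff2 A) (@aff1 A) (@aff2' A) (@aff1' A).

Definition bun1 (A : dab) : abun := Abun (@pi1 A) (@aff1 A).
Definition bun2 (A : dab) : abun := Abun (@pi2 A) (@aff2 A).
Definition bun1' (A : dab) : abun := Abun (@pi1' A) (@aff1' A).
Definition bun2' (A : dab) : abun := Abun (@pi2' A) (@aff2' A).

(* [aff1 l] is a morphism of affine bundles to [pi2] from the fibre product of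
   [pi1] with itself, which is an affine bundle over the fibre product of [pi1']
   with itself for the componentwise operation [aff2]. *)
Definition aff1_morphism (A : dab) (l : R) : Prop :=
  [/\ @smooth_map (fibprod (bun1 A)) (dA A)
        (fun xy => aff1 l (val xy).1 (val xy).2),
      @smooth_map (fibprod (bun1' A)) (dA2 A)
        (fun zz => aff1' l (val zz).1 (val zz).2),
      forall x y : dA A, pi1 x = pi1 y ->
        pi2 (aff1 l x y) = aff1' l (pi2 x) (pi2 y) &
      forall (m : R) (x y x' y' : dA A), pi1 x = pi1 y -> pi1 x' = pi1 y' ->
        pi2 x = pi2 x' -> pi2 y = pi2 y' ->
        aff1 l (aff2 m x x') (aff2 m y y') =
        aff2 m (aff1 l x y) (aff1 l x' y')].

Definition double_affine_bundle (A : dab) : Prop :=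
  [/\ [/\ affine_bundle (bun1 A), affine_bundle (bun2 A),
          affine_bundle (bun1' A) & affine_bundle (bun2' A)],
      forall x : dA A, pi2' (pi1 x) = pi1' (pi2 x),
      @affine_morphism (bun2 A) (bun2' A) (@pi1 A) (@pi1' A) /\
      @affine_morphism (bun1 A) (bun1' A) (@pi2 A) (@pi2' A),
      forall (a1 : dA1 A) (a2 : dA2 A), pi2' a1 = pi1' a2 ->
        exists x, pi1 x = a1 /\ pi2 x = a2 &
      forall l, aff1_morphism A l /\ aff1_morphism (swap A) l].

(* The affine combination of [u] and [v] in the fibres of
   [hull (bun1 A) -> hull (bun1' A)]: the operation induced by [aff2] on formal
   linear combinations of pairs [(x, y)] with [pi2 x = pi2 y]. *)
Definition haff (A : dab) (l : R) (u v : hull (bun1 A)) : hull (bun1 A) :=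
  xget (u : {classic hull (bun1 A)})
    [set z | exists w : seq (R * (dA A * dA A)),
      [/\ all (fun q => `[< [/\ pi1 q.2.1 = hproj u, pi1 q.2.2 = hproj v &
                                pi2 q.2.1 = pi2 q.2.2] >]) w,
          u = @hmk (bun1 A) (hproj u) [seq (q.1, q.2.1) | q <- w],
          v = @hmk (bun1 A) (hproj v) [seq (q.1, q.2.2) | q <- w] &
          z = @hmk (bun1 A) (aff2' l (hproj u) (hproj v))
                [seq (q.1, aff2 l q.2.1 q.2.2) | q <- w]]].

(* The hull of [pi1], as an affine bundle over the hull of [pi1']. *)
Definition hat (A : dab) : abun :=
  @Abun (hull_mfd (bun1 A)) (hull_mfd (bun1' A))
    (@hmap (bun1 A) (bun1' A) (@pi2 A) (@pi2' A)) (@haff A).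

(* The double vector hull [D]; [D2 = hull (bun1' A)] and [D1 = hull (bun2' A)].
   The projection to [D2] is [hproj]. *)
Definition dhull (A : dab) : mfd R := hull_mfd (hat A).

Definition dhull_proj1 (A : dab) (d : dhull A) : hull (bun2' A) :=
  @hmap (hat A) (bun2' A) (@hproj (bun1 A)) (@hproj (bun1' A)) d.

Definition core_pred (A : dab) : set (dhull A) :=
  [set d | exists m : dM A,
     @hproj (hat A) d = @hzero (bun1' A) m /\
     dhull_proj1 d = @hzero (bun2' A) m].

Definition core (A : dab) : mfd R := sub_mfd (@core_pred A).

Definition core_proj (A : dab) (c : core A) : dM A :=
  @hproj (bun1' A) (@hproj (hat A) (val c)).

Definition core_zero (A : dab) (m : dM A) : dhull A :=
  @hzero (hat A) (@hzero (bun1' A) m).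

(* The core as an affine bundle: [core_pred] is stable under affine
   combinations, so that the default value of [insubd] is not used. *)
Definition core_bun (A : dab) : abun :=
  @Abun (core A) (dM A) (@core_proj A)
    (fun l c c' => insubd c (@hadd (hat A) (@hscale (hat A) l (val c))
                                           (@hscale (hat A) (1 - l) (val c')))).

Definition special_dab (A : dab) (sigma : dM A -> core A) : Prop :=
  [/\ double_affine_bundle A, smooth_map sigma,
      forall m, core_proj (sigma m) = m &
      forall m, val (sigma m) <> core_zero m].

(* A vector [v] of the model space of the fibre of [pi1] over [a], projecting to
   zero in the hull of [pi1'], is a point of [D] over [(a, 0)], and as such the
   sum of the zero vector over [a] and of a vector of the core. *)
Definition core_of (A : dab) (v : hull (bun1 A)) : dhull A :=
  @hsub (hat A) (@hpt (hat A) v) (@hpt (hat A) (@hzero (bun1 A) (hproj v))).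

(* The canonical inclusion of the core fibre in the model space of the fibre of
   [pi1] over [a]. *)
Definition core_incl (A : dab) (a : dA1 A) (c : core A) : hull (bun1 A) :=
  xget (@hzero (bun1 A) a : {classic hull (bun1 A)})
    [set v : hull (bun1 A) | [/\ @hproj (bun1 A) v = a,
                 @bproj (hat A) v = @hzero (bun1' A) (pi2' a) &
                 core_of v = val c]].

(* The core vector [y - x], for [x] and [y] with the same projections. *)
Definition core_diff (A : dab) (x y : dA A) : dhull A :=
  core_of (@hsub (bun1 A) (@hpt (bun1 A) y) (@hpt (bun1 A) x)).

Section Dual.
Variables (A : dab) (sigma : dM A -> core A).

Definition sigma1 (a : dA1 A) : hull (bun1 A) := core_incl a (sigma (pi2' a)).

Definition Asharp : mfd R := sharp (E := bun1 A) sigma1.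

Definition sh_pt (f : Asharp) : dA1 A := dpt (val f).

Definition sh_fun (f : Asharp) : dA A -> R := dfun (val f).

Definition core_linear (m : dM A) (f : core A -> R) : Prop :=
  forall (r : R) (c c' c'' : core A),
    core_proj c = m -> core_proj c' = m -> core_proj c'' = m ->
    val c'' = @hadd (hat A) (@hscale (hat A) r (val c)) (val c') ->
    f c'' = r * f c + f c'.

Definition core_ddagger : mfd R :=
  sub_mfd (X := dagger (core_bun A))
    [set phi : dagger_type (core_bun A) |
      core_linear (dpt phi) (dfun phi) /\ dfun phi (sigma (dpt phi)) = 1].

Definition dd_pt (phi : core_ddagger) : dM A := dpt (val phi).

Definition dd_fun (phi : core_ddagger) : core A -> R := dfun (val phi).

(* The projection to [core_ddagger] and the affine structures of the dual,
   specified by their values; outside the fibres, the affine combinations are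
   irrelevant. *)
Record dual_structure := DualStructure {
  sh_res : Asharp -> core_ddagger;
  sh_aff1 : R -> Asharp -> Asharp -> Asharp;
  sh_aff2 : R -> Asharp -> Asharp -> Asharp;
  dd_aff : R -> core_ddagger -> core_ddagger -> core_ddagger;
  sh_res_pt : forall f, dd_pt (sh_res f) = pi2' (sh_pt f);
  sh_resE : forall f c, core_proj c = pi2' (sh_pt f) ->
    dd_fun (sh_res f) c =
    hext (sh_fun f : tot (bun1 A) -> R^o) (core_incl (sh_pt f) c);
  sh_aff1_pt : forall l f g, sh_pt f = sh_pt g ->
    sh_pt (sh_aff1 l f g) = sh_pt f;
  sh_aff1E : forall l f g x, sh_pt f = sh_pt g ->
    sh_fun (sh_aff1 l f g) x = l * sh_fun f x + (1 - l) * sh_fun g x;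
  sh_aff2_pt : forall l f g, sh_res f = sh_res g ->
    sh_pt (sh_aff2 l f g) = aff2' l (sh_pt f) (sh_pt g);
  sh_aff2E : forall l f g x y, sh_res f = sh_res g ->
    pi1 x = sh_pt f -> pi1 y = sh_pt g -> pi2 x = pi2 y ->
    sh_fun (sh_aff2 l f g) (aff2 l x y) =
    l * sh_fun f x + (1 - l) * sh_fun g y;
  dd_aff_pt : forall l p q, dd_pt p = dd_pt q -> dd_pt (dd_aff l p q) = dd_pt p;
  dd_affE : forall l p q c, dd_pt p = dd_pt q ->
    dd_fun (dd_aff l p q) c = l * dd_fun p c + (1 - l) * dd_fun q c }.

Definition dual_dab (s : dual_structure) : dab :=
  @Dab Asharp (dA1 A) core_ddagger (dM A)
    sh_pt (sh_res s) dd_pt (@pi2' A)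
    (sh_aff1 s) (sh_aff2 s) (dd_aff s) (@aff2' A).

(* [Phi] identifies the vector bundle of fibrewise affine functions on [A2] with
   the core of the dual, the function 1 corresponding to [sigma'].  The
   identification is the canonical one: [Phi h] is the translation by
   [h \o pi2]. *)
Definition core_dual_iso (s : dual_structure)
    (sigma' : dM (dual_dab s) -> core (dual_dab s))
    (Phi : dagger (bun1' A) -> core (dual_dab s)) : Prop :=
  [/\ diffeo Phi,
      forall h : dagger (bun1' A), core_proj (Phi h) = @dpt (bun1' A) h,
      forall (r : R) (h h' h'' : dagger (bun1' A)),
        dpt h = dpt h'' -> dpt h' = dpt h'' ->
        (forall z, dfun h'' z = r * dfun h z + dfun h' z) ->
        val (Phi h'') =
        @hadd (hat (dual_dab s)) (@hscale (hat (dual_dab s)) r (val (Phi h)))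
                                 (val (Phi h')),
      forall h : dagger (bun1' A),
        (forall z : dA2 A, pi1' z = @dpt (bun1' A) h -> dfun h z = 1) ->
        Phi h = sigma' (@dpt (bun1' A) h) &
      forall (h : dagger (bun1' A)) (f g : Asharp),
        sh_pt g = sh_pt f -> pi2' (sh_pt f) = dpt h ->
        (forall x : dA A, pi1 x = sh_pt f ->
           sh_fun g x = sh_fun f x + dfun h (pi2 x)) ->
        val (Phi h) = @core_diff (dual_dab s) f g].

End Dual.

End Manifolds.

(* Main.v *)
(** Around every point of the base there are coordinates (x; y, z, c) in which
    all affine operations of the double affine bundle are affine in (z, c), resp.
    in (y, c).  To build them, take sections over the reference points of an
    affine frame of A1 and translate x in A by combinations of their differences
    (for the second affine structure) until its first projection is the origin
    of the frame; c is then the fibre coordinate of the translate.  The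
    interchange law makes c affine for the first structure, once both affine
    structures are known to agree on the double fibres.  At weight 1/2 they agree
    by interchange, so their difference h(t) at weight t satisfies
    h(t/2) = h(t)/2; being differentiable at 0, h is linear, and h(1) = 0.

    In coordinates adapted to sigma (the first core vector), a function in the
    affine dual is a0 + <alpha, z> + c_1 + <gamma, c'>, with (x, y, gamma, a0,
    alpha) as coordinates.  The affine structures of the dual are affine in
    (gamma, a0, alpha) for fixed (x, y), and in (y, a0, alpha) for fixed
    (x, gamma); so these are adapted coordinates of the dual, its core has
    coordinates (a0, alpha), and those are the coefficients of an affine function
    of z. *)

Require Import Defs.
From mathcomp Require Import all_boot all_order all_algebra.
From mathcomp Require Import all_classical all_reals all_analysis.
From mathcomp Require Import ring.

Set Implicit Arguments.
Unset Strict Implicit.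
Unset Printing Implicit Defensive.

Import Order.TTheory GRing.Theory Num.Theory.
Import numFieldNormedType.Exports.
Local Open Scope classical_set_scope.
Local Open Scope ring_scope.

(** * Smooth germs and the chain rule *)

(** Interchange is the only link between the two given affine structures: no core, no vector
    structure on the double fibres and no coordinates come with the data. Hulls, the inclusion of
    the core and the affine duals are quotients or chosen values, in which nothing can be computed
    before coordinates are known. The predicate [adapted] is therefore the pivot: it makes every
    choice determinate, gives back all axioms of a double affine bundle over a manifold, and is
    proved for [A] and for its dual, so that one computation of the core serves both. The dual has
    the same shape because f = <(a0, alpha), (1, z)> + <(1, gamma), c> is a sum of two pairings.
    Over a fixed point of [A1] only coefficients move; for fixed gamma and equal z each pairing has
    just one moving factor. Smoothness is treated at a point: germs compose without bookkeeping of
    domains, whereas the definitions ask for one function on the whole image of an overlap.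
    Hausdorff and countability axioms are postponed likewise: they pass from the base of a bundle to
    its total space. *)

Section DerivativeAlongLine.
Context {R : realType} {V W : normedModType R}.

Lemma is_derive_line (g : V -> W) (q w : V) (t : R) :
  derivable g (t *: w + q) w ->
  is_derive t 1 (fun s => g (s *: w + q)) ('D_w g (t *: w + q)).
Proof.
move=> dg.
have E : (fun h : R => h^-1 *:
      (((fun s => g (s *: w + q)) \o shift t) (h *: 1) - g (t *: w + q))) =
    (fun h => h^-1 *: ((g \o shift (t *: w + q)) (h *: w) - g (t *: w + q))).
  apply/funext => h /=; congr (_ *: (g _ - _)).
  by rewrite [h%:A]mulr1 scalerDl addrA.
by split; rewrite /derivable /derive /= E.
Qed.

Lemma deriveZdir (g : V -> W) (x v : V) (c : R) :
  derivable g x v -> 'D_(c *: v) g x = c *: 'D_v g x.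
Proof.
have [->|c0] := eqVneq c 0; first by rewrite !scale0r derive0.
move=> /cvg_ex[l gl]; have -> : 'D_v g x = l by apply: cvg_lim.
apply: cvg_lim => //.
have -> : (fun h : R => h^-1 *: ((g \o shift x) (h *: (c *: v)) - g x)) =
    (fun h => c *: ((fun k => k^-1 *: ((g \o shift x) (k *: v) - g x)) (h * c))).
  apply/funext => h /=.
  have [->|h0] := eqVneq h 0; first by rewrite mul0r invr0 !scale0r scaler0.
  by rewrite !scalerA invfM mulrCA mulfV// mulr1.
apply: cvgZ; first exact: cvg_cst.
apply: (cvg_comp _ _ _ gl).
move=> A [e /= e0 Ae]; exists (e / `|c|); first by rewrite /= divr_gt0 ?normr_gt0.
move=> h /=; rewrite sub0r normrN => he h0; apply: Ae => /=.
  by rewrite sub0r normrN normrM -ltr_pdivlMr ?normr_gt0.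
by rewrite mulf_neq0.
Qed.

End DerivativeAlongLine.

Section Slopes.
Context {R : realType} {n : nat}.
Implicit Types (g : 'rV[R]_n -> R) (p h : 'rV[R]_n).

Local Notation e_ j := (delta_mx ord0 j : 'rV[R]_n).

(** Corners of the axis-parallel path from 0 to [h]: consecutive ones differ in one coordinate, so
    that the mean value theorem applies to each edge. *)
Definition trunc_row h (k : nat) : 'rV[R]_n :=
  \row_i (if (i < k)%N then h ord0 i else 0).

Lemma trunc_row0 h : trunc_row h 0 = 0.
Proof. by apply/rowP => i; rewrite !mxE. Qed.

Lemma trunc_rowS h (j : 'I_n) :
  trunc_row h j.+1 = h ord0 j *: e_ j + trunc_row h j.
Proof.
apply/rowP => i; rewrite !mxE eqxx /= ltnS leq_eqVlt (val_eqE i j).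
by have [->|_] := eqVneq i j; rewrite /= ?ltnn ?mulr1 ?mulr0 ?addr0 ?add0r.
Qed.

Lemma trunc_row_all h : trunc_row h n = h.
Proof. by apply/rowP => i; rewrite !mxE ltn_ord. Qed.

(* A function with continuous partial derivatives satisfies
   g (p + h) - g p = \sum_j h_j q_j(h) with q_j(h) -> the j-th partial
   derivative of g at p, by the mean value theorem in each coordinate. *)
Lemma partial_slopes (U : set 'rV[R]_n) g p :
  open U -> U p ->
  (forall x v, U x -> derivable g x v) ->
  (forall v x, U x -> {for x, continuous ('D_v g)}) ->
  exists q : 'I_n -> 'rV[R]_n -> R,
    (forall j, q j h @[h --> nbhs (0 : 'rV[R]_n)] --> 'D_(e_ j) g p) /\
    \forall h \near (0 : 'rV[R]_n),
      g (h + p) - g p = \sum_j h ord0 j * q j h.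
Proof.
move=> oU Up dg cg.
have [e /= e0 eU] : nbhs_ball p U by apply/nbhs_ballP; exact: open_nbhs_nbhs.
(* The slope [q] is the partial derivative at a mean value point [xi] of the j-th edge. The entries
   of [xi] are bounded by those of [h], which forces [xi] to 0 together with [h]. *)
have step (jh : 'I_n * 'rV[R]_n) : exists q : R, ball (0 : 'rV[R]_n) e jh.2 ->
    g (trunc_row jh.2 jh.1.+1 + p) - g (trunc_row jh.2 jh.1 + p) =
      jh.2 ord0 jh.1 * q /\
    exists2 xi, q = 'D_(e_ jh.1) g (xi + p) &
      forall i, `|xi ord0 i| <= `|jh.2 ord0 i|.
  case: jh => j h /=.
  have [hb|nhb] := pselect (ball (0 : 'rV[R]_n) e h); last by exists 0 => /nhb.
  pose c (t : R) := t *: (h ord0 j *: e_ j) + trunc_row h j.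
  have cb (t : R) : 0 <= t <= 1 -> forall i, `|c t ord0 i| <= `|h ord0 i|.
    case/andP=> t0 t1 i; rewrite !mxE eqxx /=.
    have [->|ij] := eqVneq i j.
      rewrite ltnn addr0 mulr1 normrM ger0_norm//.
      by rewrite ler_piMl.
    by rewrite mulr0 mulr0 add0r; case: ifP; rewrite ?normr0.
  have cU (t : R) : 0 <= t <= 1 -> U (c t + p).
    move=> /cb ct; apply: eU; split => // i k; rewrite (ord1 i).
    case: hb => _ /(_ ord0 k); rewrite mxE -!ball_normE /= sub0r normrN => hk.
    rewrite [in (_ + p) _ _]mxE opprD addrCA subrr addr0 normrN.
    exact: le_lt_trans (ct k) hk.
  pose w := h ord0 j *: e_ j.
  have dphi (t : R) : 0 <= t <= 1 -> is_derive t 1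
      (fun s => g (s *: w + (trunc_row h j + p))) ('D_w g (c t + p)).
    move=> t01; rewrite /c -addrA; apply: is_derive_line.
    by apply: dg; rewrite addrA; exact: cU.
  have [||t t01] := @MVT_segment R (fun s => g (s *: w + (trunc_row h j + p)))
      (fun t => 'D_w g (c t + p)) 0 1 ler01.
  - by move=> t; rewrite in_itv /= => /andP[t0 t1]; apply: dphi; rewrite !ltW.
  - apply: derivable_within_continuous => t; rewrite in_itv /= => t01.
    by have [] := dphi t t01.
  rewrite scale1r scale0r add0r subr0 mulr1 => Eg.
  rewrite in_itv /= in t01.
  exists ('D_(e_ j) g (c t + p)) => _; split; last first.
    by exists (c t) => //; exact: cb.
  rewrite trunc_rowS -addrA Eg deriveZdir //.
  by apply: dg; exact: cU.
have [Q HQ] := choice step.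
exists (fun j h => Q (j, h)); split.
  move=> j; apply/cvgrPdist_lt => eps eps0.
  have /cvgrPdist_lt /(_ _ eps0) /nbhs_ballP[d /= d0 db] := cg (e_ j) p Up.
  (* The radius [d] controls the variation of the partial derivative at [p]; [e] keeps [h] in the
     ball where the slopes are mean values. *)
  have m0 : 0 < Num.min d e by rewrite lt_min d0 e0.
  apply/nbhs_ballP; exists (Num.min d e) => // h hb.
  have hbe : ball (0 : 'rV[R]_n) e h.
    by rewrite -ball_normE in hb *; apply: lt_le_trans hb _; rewrite ge_min lexx orbT.
  have [_ [xi -> xih]] := HQ (j, h) hbe.
  apply: db; rewrite -ball_normE /= opprD addrCA subrr addr0 normrN.
  move: hb; rewrite -ball_normE /= sub0r normrN => hb.
  apply: le_lt_trans (lt_le_trans hb _); last by rewrite ge_min lexx.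
  (* The norm of a row is the maximum of its entries, so the entrywise bound on [xi] bounds its
     norm. *)
  rewrite [leLHS]/Num.Def.normr/= [leRHS]/Num.Def.normr/=.
  rewrite !mx_normrE; apply: bigmax_le => [|[i k] _ /=].
    by elim/big_ind: _ => // a b a0 b0; rewrite le_max a0.
  rewrite (ord1 i); apply: le_trans (xih k) _.
  exact: (le_bigmax _ (fun ik : 'I_1 * 'I_n => `|h ik.1 ik.2|) (ord0, k)).
apply/nbhs_ballP; exists e => // h hb.
transitivity (\sum_(j < n) (g (trunc_row h j.+1 + p) - g (trunc_row h j + p))).
  rewrite -(big_mkord xpredT
    (fun k => g (trunc_row h k.+1 + p) - g (trunc_row h k + p))).
  by rewrite telescope_sumr// trunc_row_all trunc_row0 add0r.
apply: eq_bigr => j _.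
by have [] := HQ (j, h) hb.
Qed.

(** Along x + t v the increment of [f] tends to 0, so the slopes of [g] tend to its partial
    derivatives, while the increment divided by t tends to the derivative of [f]. Only directional
    derivatives occur, as in [Ck]. *)
Lemma is_derive_comp (V : normedModType R) (U : set 'rV[R]_n) g
    (f : V -> 'rV[R]_n) (x v : V) :
  open U -> U (f x) ->
  (forall y w, U y -> derivable g y w) ->
  (forall w y, U y -> {for y, continuous ('D_w g)}) ->
  derivable f x v ->
  is_derive x v (g \o f) (\sum_j ('D_v f x) ord0 j * 'D_(e_ j) g (f x)).
Proof.
move=> oU Ufx dg cg df.
have [q [qc qE]] := partial_slopes oU Ufx dg cg.
pose h (t : R) := f (t *: v + x) - f x.
have hc : h t @[t --> 0^'] --> (0 : 'rV[R]_n).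
  have /derivable1P/derivable1_diffP/differentiable_continuous := df.
  move=> /continuous_withinNx; rewrite scale0r add0r => fc.
  by rewrite -(subrr (f x)); apply: cvgB => //; exact: cvg_cst.
have hd j : t^-1 * h t ord0 j @[t --> 0^'] --> ('D_v f x) ord0 j.
  have := cvg_comp _ _ df (@coord_continuous _ _ _ ord0 j _).
  rewrite /derive; apply: cvg_trans.
  by apply: near_eq_cvg; near=> t; rewrite /= !mxE.
have L : t^-1 *: ((g \o f \o shift x) (t *: v) - (g \o f) x) @[t --> 0^'] -->
    \sum_j ('D_v f x) ord0 j * 'D_(e_ j) g (f x).
  have : \sum_j (t^-1 * h t ord0 j) * q j (h t) @[t --> 0^'] -->
      \sum_j ('D_v f x) ord0 j * 'D_(e_ j) g (f x).
    apply: cvg_big => [|j _]; first exact: add_continuous.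
    apply: cvgM; first exact: hd.
    exact: (cvg_comp _ _ hc (qc j)).
  apply: cvg_trans; apply: near_eq_cvg.
  have qh : \forall t \near 0^', g (h t + f x) - g (f x) = \sum_j h t ord0 j * q j (h t).
    exact: (hc _ qE).
  near=> t.
  have Et : g (h t + f x) - g (f x) = \sum_j h t ord0 j * q j (h t) by near: t.
  rewrite /= -[f (t *: v + x)](subrK (f x)) -/(h t) Et /GRing.scale /= mulr_sumr.
  by apply: eq_bigr => j _; rewrite mulrA.
split; first by apply/cvg_ex; eexists; exact: L.
exact: cvg_lim L.
Unshelve. all: by end_near. Qed.

End Slopes.

Section SmoothGerms.
Context {R : realType}.
Implicit Types V W : normedModType R.

Lemma Ck_continuous V W k (U : set V) (f : V -> W) x :
  Ck k U f -> U x -> {for x, continuous f}.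
Proof. by case: k => [|k] [cf _]; exact: cf. Qed.

Lemma CkW V W k (U : set V) (f : V -> W) : Ck k.+1 U f -> Ck k U f.
Proof.
elim: k f => [|k IH] f [cf [df Df]]; first by split.
by split => //; split => // v; exact: IH.
Qed.

Lemma Ck_sub V W k (U U' : set V) (f : V -> W) :
  U' `<=` U -> Ck k U f -> Ck k U' f.
Proof.
move=> sU; elim: k f => [|k IH] f [cf Hf]; first by split=> // x /sU; exact: cf.
split=> [x /sU|]; first exact: cf.
case: Hf => df Df; split=> [x v /sU|v]; first exact: df.
exact: IH (Df v).
Qed.

Lemma nbhs_open (T : topologicalType) (x : T) (A : set T) :
  nbhs x A -> exists U, [/\ open U, U x & U `<=` A].
Proof. by rewrite nbhsE => -[U [oU Ux] UA]; exists U. Qed.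

Lemma nbhsI_open (T : topologicalType) (x : T) (A U : set T) :
  nbhs x A -> open U -> U x ->
  exists U', [/\ open U', U' x, U' `<=` A & U' `<=` U].
Proof.
move=> nA oU Ux.
have /nbhs_open[U' [? ? sU']] : nbhs x (A `&` U).
  by apply: filterI nA _; exact: open_nbhs_nbhs.
by exists U'; split=> // y /sU'[].
Qed.

Lemma open_near_eq V W (U : set V) (f g : V -> W) x :
  open U -> {in U, f =1 g} -> U x -> {near x, f =1 g}.
Proof.
move=> oU fg Ux; apply: filterS (open_nbhs_nbhs (conj oU Ux)) => y Uy.
by apply: fg; exact: mem_set.
Qed.

Lemma near_eq_continuous V W (f g : V -> W) x :
  {near x, f =1 g} -> {for x, continuous f} -> {for x, continuous g}.
Proof.
move=> fg cf; rewrite /prop_for /continuous_at -(nbhs_singleton fg).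
by apply: cvg_trans cf; exact: near_eq_cvg.
Qed.

Lemma Ck_ext V W k (U : set V) (f g : V -> W) :
  open U -> {in U, f =1 g} -> Ck k U f -> Ck k U g.
Proof.
move=> oU; elim: k f g => [|k IH] f g fg [cf Hf].
  split=> // x Ux.
  exact: near_eq_continuous (open_near_eq oU fg Ux) (cf x Ux).
split=> [x Ux|].
  exact: near_eq_continuous (open_near_eq oU fg Ux) (cf x Ux).
case: Hf => df Df; split=> [x v Ux|v].
  exact: near_eq_derivable (open_near_eq oU fg Ux) (df x v Ux).
apply: IH (Df v) => x /set_mem Ux.
by apply: near_eq_derive; exact: open_near_eq fg Ux.
Qed.

Lemma Ck_local V W k (U : set V) (f : V -> W) :
  (forall x, U x -> exists U', [/\ open U', U' x & Ck k U' f]) -> Ck k U f.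
Proof.
elim: k f => [|k IH] f H.
  split=> // x Ux; have [U' [_ U'x fU']] := H x Ux.
  exact: Ck_continuous fU' U'x.
split=> [x Ux|].
  have [U' [_ U'x fU']] := H x Ux; exact: Ck_continuous fU' U'x.
split=> [x v Ux|v].
  by have [U' [_ U'x [_ [df _]]]] := H x Ux; exact: df.
apply: IH => x Ux; have [U' [oU' U'x [_ [_ Df]]]] := H x Ux.
by exists U'; split=> //; exact: Df.
Qed.

Lemma Ck_cst V W k (U : set V) (a : W) : Ck k U (fun=> a).
Proof.
elim: k a => [|k IH] a; first by split=> // x _; exact: cst_continuous.
split=> [x _|]; first exact: cst_continuous.
split=> [x v _|v]; first exact: derivable_cst.
have -> : 'D_v (fun=> a) = (fun=> 0) :> (V -> W).
  by apply/funext => x; rewrite derive_cst.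
exact: IH.
Qed.

Lemma CkD V W k (U : set V) (f g : V -> W) :
  open U -> Ck k U f -> Ck k U g -> Ck k U (fun x => f x + g x).
Proof.
move=> oU; elim: k f g => [|k IH] f g fk gk.
  split=> // x Ux; apply: continuousD; [exact: Ck_continuous fk Ux|
    exact: Ck_continuous gk Ux].
split=> [x Ux|].
  by apply: continuousD; [exact: Ck_continuous fk Ux|
    exact: Ck_continuous gk Ux].
case: fk gk => [_ [df Df]] [_ [dg Dg]]; split=> [x v Ux|v].
  by apply: derivableD; [exact: df|exact: dg].
apply: Ck_ext oU _ (IH _ _ (Df v) (Dg v)) => x /set_mem Ux.
by rewrite -deriveD//; [exact: df|exact: dg].
Qed.

Lemma Ck_sum V W k (U : set V) n (f : 'I_n -> V -> W) :
  open U -> (forall i, Ck k U (f i)) -> Ck k U (fun x => \sum_i f i x).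
Proof.
move=> oU; elim: n f => [|n IH] f fk.
  by apply: Ck_ext oU _ (Ck_cst k U 0) => x _; rewrite big_ord0.
apply: Ck_ext oU _ (CkD oU (IH (fun i => f (widen_ord (leqnSn n) i)) _) (fk ord_max)).
  by move=> x _; rewrite big_ord_recr.
by move=> i; exact: fk.
Qed.

Lemma CkM V k (U : set V) (f g : V -> R) :
  open U -> Ck k U f -> Ck k U g -> Ck k U (fun x => f x * g x).
Proof.
move=> oU; elim: k f g => [|k IH] f g fk gk.
  split=> // x Ux; apply: continuousM; [exact: Ck_continuous fk Ux|
    exact: Ck_continuous gk Ux].
split=> [x Ux|].
  by apply: continuousM; [exact: Ck_continuous fk Ux|
    exact: Ck_continuous gk Ux].
have [_ [df Df]] := fk; have [_ [dg Dg]] := gk; split=> [x v Ux|v].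
  by apply: derivableM; [exact: df|exact: dg].
apply: Ck_ext oU _ (CkD oU (IH _ _ (CkW fk) (Dg v)) (IH _ _ (CkW gk) (Df v))).
by move=> x /set_mem Ux; rewrite deriveM//; [exact: df|exact: dg].
Qed.

(** The derivative of 1/f is -(1/f)^2 f', and 1/f has the lower order by induction. *)
Lemma CkV V k (U : set V) (f : V -> R) :
  open U -> (forall x, U x -> f x != 0) ->
  Ck k U f -> Ck k U (fun x => (f x)^-1).
Proof.
move=> oU f0; elim: k => [|k IH] fk.
  split=> // x Ux; apply: continuousV; [exact: f0|exact: Ck_continuous fk Ux].
split=> [x Ux|].
  by apply: continuousV; [exact: f0|exact: Ck_continuous fk Ux].
have [_ [df Df]] := fk; split=> [x v Ux|v].
  by apply: derivableV; [exact: f0|exact: df].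
have Hk := IH (CkW fk).
apply: Ck_ext oU _ (CkM oU (CkM oU (@Ck_cst _ R k U (-1)) (CkM oU Hk Hk)) (Df v)).
move=> x /set_mem Ux; rewrite deriveV ?f0//; last exact: df.
by rewrite mulN1r /GRing.scale /= expr2 invfM.
Qed.

Lemma continuous_mx V m n (f : V -> 'M[R]_(m, n)) x :
  (forall i j, {for x, continuous (fun y => f y i j)}) ->
  {for x, continuous f}.
Proof.
move=> cf A [P PM PA]; apply: filterS (filterS _ _); first exact: PA.
  by move=> y; exact: id.
apply: filter_forall => i; apply: filter_forall => j.
exact: cf (PM i j).
Qed.

Lemma Ck_mxP V m n k (U : set V) (f : V -> 'M[R]_(m, n)) :
  open U -> Ck k U f <-> forall i j, Ck k U (fun x => f x i j).
Proof.
move=> oU; elim: k f => [|k IH] f; split.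
- move=> [cf _] i j; split=> // x Ux.
  apply: (@continuous_comp _ _ _ f (fun M : 'M[R]_(m, n) => M i j : R));
    [exact: cf|exact: coord_continuous].
- move=> H; split=> // x Ux; apply: continuous_mx => i j.
  exact: Ck_continuous (H i j) Ux.
- move=> [cf [df Df]] i j; split=> [x Ux|].
    by apply: (@continuous_comp _ _ _ f (fun M : 'M[R]_(m, n) => M i j : R));
    [exact: cf|exact: coord_continuous].
  split=> [x v Ux|v].
    by have /derivable_mxP := df x v Ux; exact.
  have /IH/(_ i j) := Df v; apply: Ck_ext => // x /set_mem Ux.
  by rewrite derive_mx ?mxE//; exact: df.
- move=> H; split=> [x Ux|].
    by apply: continuous_mx => i j; exact: Ck_continuous (H i j) Ux.
  have df x v : U x -> derivable f x v.
    by move=> Ux; apply/derivable_mxP => i j; have [_ [+ _]] := H i j; exact.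
  split=> // v; apply/IH => i j.
  have [_ [_ /(_ v)]] := H i j; apply: Ck_ext => // x /set_mem Ux.
  by rewrite derive_mx ?mxE//; exact: df.
Qed.

Lemma Ck_coord m n k (U : set 'M[R]_(m, n)) i j :
  Ck k U (fun M => M i j : R).
Proof.
have d x v : is_derive x v (fun M : 'M[R]_(m, n) => M i j : R) (v i j).
  suff E : (fun h : R => h^-1 *: (((fun M : 'M[R]_(m, n) => M i j : R) \o shift x)
      (h *: v) - x i j)) @ 0^' --> v i j.
    by split; [apply/cvg_ex; eexists; exact: E|exact: cvg_lim E].
  have : (fun=> v i j) @ (0:R)^' --> v i j by exact: cvg_cst.
  apply: cvg_trans; apply: near_eq_cvg; near=> h.
  rewrite /= !mxE addrK /GRing.scale /= mulrA mulVf ?mul1r//.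
  by near: h; exact: nbhs_dnbhs_neq.
case: k => [|k]; first by split=> // x _; exact: coord_continuous.
split=> [x _|]; first exact: coord_continuous.
split=> [x v _|v]; first by have [] := d x v.
have -> : 'D_v (fun M : 'M[R]_(m, n) => M i j : R) = (fun=> v i j).
  by apply/funext => x; have [] := d x v.
exact: Ck_cst.
Unshelve. all: by end_near. Qed.

(** The derivative of the composite is a sum of products of a derivative of [f] with a partial
    derivative of [g] composed with [f]. The latter is a composite of lower order with another outer
    function, so the induction runs over all [g]. *)
Lemma Ck_compR V n k (U : set V) (U' : set 'rV[R]_n) (g : 'rV[R]_n -> R)
    (f : V -> 'rV[R]_n) :
  open U -> open U' -> (forall x, U x -> U' (f x)) ->
  Ck k U' g -> Ck k U f -> Ck k U (fun x => g (f x)).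
Proof.
move=> oU oU' fU; elim: k g => [|k IH] g gk fk.
  split=> // x Ux; apply: continuous_comp; first exact: Ck_continuous fk Ux.
  exact: Ck_continuous gk (fU _ Ux).
have [_ [dg Dg]] := gk; have [_ [df Df]] := fk.
have D x v : U x -> is_derive x v (g \o f)
    (\sum_j ('D_v f x) ord0 j * 'D_(delta_mx ord0 j) g (f x)).
  move=> Ux; apply: is_derive_comp oU' (fU _ Ux) dg _ (df x v Ux) => w y U'y.
  exact: Ck_continuous (Dg w) U'y.
split=> [x Ux|].
  apply: (@continuous_comp _ _ _ f g); first exact: Ck_continuous fk Ux.
  exact: Ck_continuous gk (fU _ Ux).
split=> [x v Ux|v]; first by have [] := D x v Ux.
apply: (@Ck_ext _ _ _ U (fun x => \sum_j ('D_v f x) ord0 j *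
  'D_(delta_mx ord0 j) g (f x))) => //.
  by move=> x /set_mem Ux; have [_ <-] := D x v Ux.
apply: Ck_sum => // j; apply: CkM => //.
  by have /Ck_mxP := Df v; exact.
by apply: IH (Dg _) (CkW fk).
Qed.

Lemma Ck_comp V n m1 m2 k (U : set V) (U' : set 'rV[R]_n)
    (g : 'rV[R]_n -> 'M[R]_(m1, m2)) (f : V -> 'rV[R]_n) :
  open U -> open U' -> (forall x, U x -> U' (f x)) ->
  Ck k U' g -> Ck k U f -> Ck k U (fun x => g (f x)).
Proof.
move=> oU oU' fU gk fk; apply/Ck_mxP => // i j.
apply: (Ck_compR (g := fun y => g y i j) oU oU') => //.
by move: i j; apply/Ck_mxP.
Qed.

(* "Smooth at"; [msat] and [smap] are the analogues on manifolds. *)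
Definition sat V W (f : V -> W) (x : V) : Prop :=
  exists U : set V, [/\ open U, U x & smooth_on U f].

Lemma smooth_onP V W (U : set V) (f : V -> W) :
  open U -> smooth_on U f <-> forall x, U x -> sat f x.
Proof.
move=> oU; split=> [fU x Ux|H k]; first by exists U.
apply: Ck_local => x Ux; have [U' [oU' U'x fU']] := H x Ux.
by exists U'.
Qed.

Lemma sat_nbhs V W (f : V -> W) x : sat f x -> \forall y \near x, sat f y.
Proof.
move=> [U [oU Ux fU]]; apply: filterS (open_nbhs_nbhs (conj oU Ux)) => y Uy.
by exists U.
Qed.

Lemma sat_continuous V W (f : V -> W) x : sat f x -> {for x, continuous f}.
Proof. by move=> [U [_ Ux /(_ 0)]] /Ck_continuous; exact. Qed.

Lemma sat_ext V W (f g : V -> W) x :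
  {near x, f =1 g} -> sat f x -> sat g x.
Proof.
move=> fg [U [oU Ux fU]].
have [U' [oU' U'x sA sU']] := nbhsI_open fg oU Ux; exists U'; split=> // k.
apply: (@Ck_ext _ _ _ _ f) => //; first by move=> y /set_mem /sA.
exact: Ck_sub (fU k).
Qed.

Lemma sat_near V W (f : V -> W) x (A : set W) :
  sat f x -> nbhs (f x) A -> \forall y \near x, A (f y).
Proof. by move=> /sat_continuous cf nA; exact: cf. Qed.

Lemma sat_eq V W (f g : V -> W) x : f =1 g -> sat f x -> sat g x.
Proof. by move=> /funext ->. Qed.

Lemma sat_op2 V W1 W2 W (f : V -> W1) (g : V -> W2) (h : V -> W) x :
  (forall k (U : set V), open U -> U `<=` sat f `&` sat g ->
    Ck k U f -> Ck k U g -> Ck k U h) ->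
  sat f x -> sat g x -> sat h x.
Proof.
move=> H [U [oU Ux fU]] [U' [oU' U'x gU']]; exists (U `&` U').
split; [exact: openI|by []|move=> k].
apply: H; first exact: openI.
- by move=> y [Uy U'y]; split; [exists U|exists U'].
- by apply: Ck_sub (fU k) => y [].
- by apply: Ck_sub (gU' k) => y [].
Qed.

Lemma sat_cst V W (a : W) (x : V) : sat (fun=> a) x.
Proof. by exists setT; split; [exact: openT|by []|move=> k; exact: Ck_cst]. Qed.

Lemma satD V W (f g : V -> W) x :
  sat f x -> sat g x -> sat (fun y => f y + g y) x.
Proof. by apply: sat_op2 => k U oU _ ? ?; exact: CkD. Qed.

Lemma satM V (f g : V -> R) x :
  sat f x -> sat g x -> sat (fun y => f y * g y) x.
Proof. by apply: sat_op2 => k U oU _ ? ?; exact: CkM. Qed.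

Lemma satV V (f : V -> R) x :
  f x != 0 -> sat f x -> sat (fun y => (f y)^-1) x.
Proof.
move=> fx0 fx; have [U [oU Ux fU]] := fx.
have : \forall y \near x, f y != 0.
  have : nbhs (f x) [set r | r != 0].
    by apply: open_nbhs_nbhs; split=> //; exact: open_neq.
  by move=> /(sat_continuous fx).
move=> /nbhsI_open/(_ oU Ux)[U' [oU' U'x sA sU']]; exists U'; split=> // k.
apply: CkV => //; exact: Ck_sub (fU k).
Qed.

Lemma sat_comp V n m1 m2 (g : 'rV[R]_n -> 'M[R]_(m1, m2))
    (f : V -> 'rV[R]_n) x :
  sat g (f x) -> sat f x -> sat (fun y => g (f y)) x.
Proof.
move=> [U' [oU' U'x gU']] fx; have [U [oU Ux fU]] := fx.
have nU' := sat_continuous fx (open_nbhs_nbhs (conj oU' U'x)).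
have [U'' [oU'' U''x sA sU'']] := nbhsI_open nU' oU Ux.
exists U''; split=> // k.
by apply: (Ck_comp oU'' oU' _ (gU' k)) => //; exact: Ck_sub (fU k).
Qed.

Lemma sat_mx V m n (f : V -> 'M[R]_(m, n)) x :
  (forall i j, sat (fun y => f y i j) x) -> sat f x.
Proof.
(* Each entry is smooth on a neighbourhood of its own; the entries being finitely many, all of them
   are smooth at every point of a common one. *)
move=> H; pose U := [set y | forall i j, sat (fun z => f z i j) y].
have : nbhs x U.
  by apply: filter_forall => i; apply: filter_forall => j; exact: sat_nbhs.
move=> /nbhs_open[U' [oU' U'x sU']]; exists U'; split=> // k.
apply/Ck_mxP => // i j; suff /(_ k) : smooth_on U' (fun y => f y i j) by [].
by apply/smooth_onP => // y /sU'.
Qed.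

Lemma sat_entry V m n (f : V -> 'M[R]_(m, n)) x i j :
  sat f x -> sat (fun y => f y i j) x.
Proof. by move=> [U [oU Ux fU]]; exists U; split=> // k; move: i j; exact/Ck_mxP. Qed.

Lemma sat_id n (x : 'rV[R]_n) : sat (fun y => y) x.
Proof.
exists setT; split; [exact: openT|by []|move=> k].
by apply/Ck_mxP => [|i j]; [exact: openT|exact: Ck_coord].
Qed.

Lemma sat_sum V W I (r : seq I) (f : I -> V -> W) x :
  (forall i, sat (f i) x) -> sat (fun y => \sum_(i <- r) f i y) x.
Proof.
move=> H; elim: r => [|i r IH].
  by apply: (sat_eq _ (sat_cst 0 x)) => y; rewrite big_nil.
by apply: (sat_eq _ (satD (H i) IH)) => y; rewrite big_cons.
Qed.

Lemma sat_prod V I (r : seq I) (f : I -> V -> R) x :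
  (forall i, sat (f i) x) -> sat (fun y => \prod_(i <- r) f i y) x.
Proof.
move=> H; elim: r => [|i r IH].
  by apply: (sat_eq _ (@sat_cst _ R 1 x)) => y; rewrite big_nil.
by apply: (sat_eq _ (satM (H i) IH)) => y; rewrite big_cons.
Qed.

Lemma sat_row_mx V n m (f : V -> 'rV[R]_n) (g : V -> 'rV[R]_m) x :
  sat f x -> sat g x -> sat (fun y => row_mx (f y) (g y)) x.
Proof.
move=> fx gx; apply: sat_mx => i j; case: (splitP j) => k jk.
  have -> : j = lshift m k by apply: val_inj.
  by apply: (sat_eq _ (sat_entry i k fx)) => y; rewrite row_mxEl.
have -> : j = rshift n k by apply: val_inj.
by apply: (sat_eq _ (sat_entry i k gx)) => y; rewrite row_mxEr.
Qed.

Lemma sat_lsubmx V n m (f : V -> 'rV[R]_(n + m)) x :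
  sat f x -> sat (fun y => lsubmx (f y)) x.
Proof.
move=> fx; apply: sat_mx => i j.
by apply: (sat_eq _ (sat_entry i (lshift m j) fx)) => y; rewrite mxE.
Qed.

Lemma sat_rsubmx V n m (f : V -> 'rV[R]_(n + m)) x :
  sat f x -> sat (fun y => rsubmx (f y)) x.
Proof.
move=> fx; apply: sat_mx => i j.
by apply: (sat_eq _ (sat_entry i (rshift n j) fx)) => y; rewrite mxE.
Qed.

Lemma sat_row V n (f : 'I_n -> V -> R) x :
  (forall i, sat (f i) x) -> sat (fun y => \row_i f i y) x.
Proof.
move=> H; apply: sat_mx => i j.
by apply: (sat_eq _ (H j)) => y; rewrite mxE.
Qed.

Lemma sat_const_mx V m n (f : V -> R) x :
  sat f x -> sat (fun y => const_mx (f y) : 'M[R]_(m, n)) x.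
Proof.
move=> H; apply: sat_mx => i j.
by apply: sat_eq _ H => y; rewrite mxE.
Qed.

Lemma sat_scale V m n (l : V -> R) (f : V -> 'M[R]_(m, n)) x :
  sat l x -> sat f x -> sat (fun y => l y *: f y) x.
Proof.
move=> lx fx; apply: sat_mx => i j.
by apply: (sat_eq _ (satM lx (sat_entry i j fx))) => y; rewrite mxE.
Qed.

Lemma satN V m n (f : V -> 'M[R]_(m, n)) x :
  sat f x -> sat (fun y => - f y) x.
Proof.
by move=> fx; apply: (sat_eq _ (sat_scale (@sat_cst _ R (-1) x) fx)) => y; rewrite scaleN1r.
Qed.

Lemma satB V m n (f g : V -> 'M[R]_(m, n)) x :
  sat f x -> sat g x -> sat (fun y => f y - g y) x.
Proof. by move=> fx gx; apply: satD => //; exact: satN. Qed.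

Lemma sat_mulmx V m n p (f : V -> 'M[R]_(m, n)) (g : V -> 'M[R]_(n, p)) x :
  sat f x -> sat g x -> sat (fun y => f y *m g y) x.
Proof.
move=> fx gx; apply: sat_mx => i j.
apply: (@sat_eq _ _ (fun y => \sum_k f y i k * g y k j)).
  by move=> y; rewrite mxE.
by apply: sat_sum => k; apply: satM; exact: sat_entry.
Qed.

Lemma sat_det V n (f : V -> 'M[R]_n) x :
  sat f x -> sat (fun y => \det (f y)) x.
Proof.
move=> fx; rewrite /determinant.
apply: sat_sum => i; apply: satM; first exact: sat_cst.
by apply: sat_prod => j; exact: sat_entry.
Qed.

(** Cramer's formula, valid near a point where the determinant does not vanish; at singular matrices
    [invmx] is given by another formula. *)
Lemma sat_invmx V n (f : V -> 'M[R]_n) x :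
  f x \in unitmx -> sat f x -> sat (fun y => invmx (f y)) x.
Proof.
move=> ux fx.
have dx : sat (fun y => \det (f y)) x by exact: sat_det.
have d0 : \det (f x) != 0 by rewrite -unitfE -unitmxE.
apply: (@sat_ext _ _ (fun y => (\det (f y))^-1 *: \adj (f y))).
  have nd : \forall y \near x, \det (f y) != 0.
    have : nbhs (\det (f x)) [set r | r != 0].
      by apply: open_nbhs_nbhs; split=> //; exact: open_neq.
    by move=> /(sat_continuous dx).
  by apply: filterS nd => y dy; rewrite /invmx unitmxE unitfE dy.
apply: sat_scale; first exact: satV.
apply: sat_mx => i j.
apply: (@sat_eq _ _ (fun y =>
  (-1) ^+ (j + i) * \det (row' j (col' i (f y))))).
  by move=> y; rewrite mxE.
apply: satM; first exact: sat_cst.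
apply: sat_det; apply: sat_mx => k l.
by apply: (sat_eq _ (sat_entry (lift j k) (lift i l) fx)) => y; rewrite !mxE.
Qed.

End SmoothGerms.

(** * Charts and smoothness at a point *)

Section Charts.
Context {R : realType}.
Implicit Types X Y Z : mfd R.

(* A manifold without the Hausdorff and second countability axioms. *)
Definition premfd X : Prop :=
  (forall c : chart R X, atlas c -> mchart c) /\
  (forall x : X, exists2 c : chart R X, atlas c & cdom c x).

(* The inverse of the chart [c]; outside of the image of [c] its value is the
   irrelevant point [x0]. *)
Definition cinv X (c : chart R X) (x0 : X) (u : 'rV[R]_(cdim c)) : X :=
  xget (x0 : {classic X}) [set y | cdom c y /\ cmap c y = u].
Arguments cinv {X} c x0 u.

(** Some chart of the maximal atlas is asked for, which is easy to supply; on a [premfd] every chart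
    at [x] then gives the same notion ([mnearP]). The same holds for [msat] and [smap]. *)
Definition mnear X (x : X) (W : set X) : Prop :=
  exists c : chart R X,
    [/\ mchart c, cdom c x & nbhs (cmap c x) (cmap c @` (cdom c `&` W))].

Definition msat X m (f : X -> 'rV[R]_m) (x : X) : Prop :=
  exists c : chart R X,
    [/\ mchart c, cdom c x & sat (fun u => f (cinv c x u)) (cmap c x)].

Definition smap X Y (f : X -> Y) (x : X) : Prop :=
  exists d : chart R Y,
    [/\ mchart d, cdom d (f x), mnear x (f @^-1` cdom d) &
        msat (fun y => cmap d (f y)) x].

Definition cinj X (c : chart R X) := {in cdom c &, injective (cmap c)}.

Lemma cinjE X (c : chart R X) x y :
  cinj c -> cdom c x -> cdom c y -> cmap c x = cmap c y -> x = y.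
Proof. by move=> ic /mem_set cx /mem_set cy; exact: ic. Qed.

Lemma mchart_inj X (c : chart R X) : mchart c -> cinj c.
Proof. by case. Qed.

Lemma cinvK X (c : chart R X) x0 y :
  cinj c -> cdom c y -> cinv c x0 (cmap c y) = y.
Proof.
move=> ic cy; rewrite /cinv; case: xgetP => [z _ [cz Ez]|/(_ y)]; last by case.
exact: cinjE ic cz cy Ez.
Qed.

(** Passage from germs to the global form used in the definitions: injectivity of [c] makes the
    coordinate expression of [F] a single-valued function on the whole image, and its smoothness is
    a local question. *)
Lemma smooth_lift X (c : chart R X) (S : set X) m (F : X -> 'rV[R]_m) :
  cinj c -> S `<=` cdom c ->
  (forall x, S x -> nbhs (cmap c x) (cmap c @` S) /\
     sat (fun u => F (cinv c x u)) (cmap c x)) ->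
  open (cmap c @` S) /\
  exists2 g : 'rV[R]_(cdim c) -> 'rV[R]_m,
    smooth_on (cmap c @` S) g & forall x, S x -> g (cmap c x) = F x.
Proof.
move=> ic Sc H.
have oS : open (cmap c @` S).
  by rewrite openE => _ [x Sx <-]; exact: (H x Sx).1.
split=> //.
pose g u := xget (0 : 'rV[R]_m) [set v | exists2 x, S x & cmap c x = u /\ v = F x].
have gE x : S x -> g (cmap c x) = F x.
  move=> Sx; rewrite /g; case: xgetP => [v _ [y Sy [Eyx ->]]|/(_ (F x))].
    by rewrite (cinjE ic (Sc _ Sy) (Sc _ Sx) Eyx).
  by case; exists x.
exists g => //; apply/smooth_onP => // _ [x Sx <-].
apply: sat_ext (H x Sx).2; apply: filterS (H x Sx).1 => _ [y Sy <-].
by rewrite gE// cinvK//; exact: Sc.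
Qed.

(** Charts of the maximal atlas are by definition compatible with the atlas, not with one another;
    the transition is composed through an atlas chart around [x]. *)
Lemma mchart_transition X (c e : chart R X) x : premfd X ->
  mchart c -> mchart e -> cdom c x -> cdom e x ->
  exists g : 'rV[R]_(cdim e) -> 'rV[R]_(cdim c), sat g (cmap e x) /\
    \forall u \near cmap e x,
      exists y, [/\ cdom c y, cdom e y, cmap e y = u & cmap c y = g u].
Proof.
move=> [am cov].
have overlap (c' e' : chart R X) : smooth_overlap e' c' ->
    cdom c' x -> cdom e' x ->
    exists g : 'rV[R]_(cdim e') -> 'rV[R]_(cdim c'), sat g (cmap e' x) /\
      \forall u \near cmap e' x,
        exists y, [/\ cdom c' y, cdom e' y, cmap e' y = u & cmap c' y = g u].
  move=> [oi [g /(smooth_onP _ oi) gs gE]] cx ex.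
  have ix : (cmap e' @` (cdom e' `&` cdom c')) (cmap e' x) by exists x.
  exists g; split; first exact: gs.
  apply: filterS (open_nbhs_nbhs (conj oi ix)) => _ [y [ey cy] <-].
  by exists y; rewrite gE.
move=> mc me cx ex; have [a aa ax] := cov x.
have [_ _ /(_ a aa)[_ oac]] := mc; have [_ _ /(_ a aa)[oea _]] := me.
have [g1 [sg1 ng1]] := overlap c a oac cx ax.
have [g2 [sg2 ng2]] := overlap a e oea ax ex.
have g2x : cmap a x = g2 (cmap e x).
  have [y [ay ey E <-]] := nbhs_singleton ng2.
  by rewrite (cinjE (mchart_inj me) ey ex E).
exists (g1 \o g2); split; first by apply: sat_comp => //; rewrite -g2x.
have ng12 : \forall u \near cmap e x, exists y,
    [/\ cdom c y, cdom a y, cmap a y = g2 u & cmap c y = g1 (g2 u)].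
  by move: ng1; rewrite g2x => /(sat_continuous sg2).
near=> u.
have [y [ay ey Eu Ey]] : exists y,
  [/\ cdom a y, cdom e y, cmap e y = u & cmap a y = g2 u] by near: u.
have [z [cz az Ez Ez']] : exists y,
  [/\ cdom c y, cdom a y, cmap a y = g2 u & cmap c y = g1 (g2 u)] by near: u.
have zy : z = y by apply: (cinjE (mchart_inj (am _ aa))) => //; rewrite Ey.
by exists y; split=> //; rewrite -zy.
Unshelve. all: by end_near. Qed.

Section PreManifold.
Context {X : mfd R} (hX : premfd X).

Lemma atlas_mchart (c : chart R X) : atlas c -> mchart c.
Proof. exact: hX.1. Qed.

Lemma premfd_cover (x : X) : exists2 c : chart R X, mchart c & cdom c x.
Proof. by have [c ac cx] := hX.2 x; exists c => //; exact: atlas_mchart. Qed.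

Lemma mnear_chart x W (e : chart R X) : mnear x W -> mchart e -> cdom e x ->
  nbhs (cmap e x) (cmap e @` (cdom e `&` W)).
Proof.
move=> [c [mc cx nW]] me ex.
have [g [sg ng]] := mchart_transition hX mc me cx ex.
have gx : cmap c x = g (cmap e x).
  have [y [cy ey E <-]] := nbhs_singleton ng.
  by rewrite (cinjE (mchart_inj me) ey ex E).
have {}nW : \forall u \near cmap e x, (cmap c @` (cdom c `&` W)) (g u).
  by rewrite gx in nW; exact: (sat_continuous sg nW).
near=> u.
have [y [cy ey Ey Ey']] : exists y,
  [/\ cdom c y, cdom e y, cmap e y = u & cmap c y = g u] by near: u.
have [z [cz Wz] Ez] : (cmap c @` (cdom c `&` W)) (g u) by near: u.
exists y => //; split => //.
by rewrite (cinjE (mchart_inj mc) cy cz) // Ez.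
Unshelve. all: by end_near. Qed.

Lemma msat_chart m (f : X -> 'rV[R]_m) x (e : chart R X) :
  msat f x -> mchart e -> cdom e x -> sat (fun u => f (cinv e x u)) (cmap e x).
Proof.
move=> [c [mc cx fc]] me ex.
have [g [sg ng]] := mchart_transition hX mc me cx ex.
have gx : cmap c x = g (cmap e x).
  have [y [cy ey E <-]] := nbhs_singleton ng.
  by rewrite (cinjE (mchart_inj me) ey ex E).
have fg : sat (fun u => f (cinv c x (g u))) (cmap e x).
  by apply: (sat_comp (g := fun v => f (cinv c x v)) _ sg); rewrite -gx.
apply: sat_ext fg; apply: filterS ng => u [y [cy ey <- <-]].
by rewrite !cinvK//; exact: mchart_inj.
Qed.

Lemma msatP m (f : X -> 'rV[R]_m) x (c : chart R X) : mchart c -> cdom c x ->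
  msat f x <-> sat (fun u => f (cinv c x u)) (cmap c x).
Proof. by move=> mc cx; split=> [fx|fx]; [exact: msat_chart|exists c]. Qed.

Lemma mnearP x W (c : chart R X) : mchart c -> cdom c x ->
  mnear x W <-> nbhs (cmap c x) (cmap c @` (cdom c `&` W)).
Proof. by move=> mc cx; split=> [fx|fx]; [exact: mnear_chart|exists c]. Qed.

Lemma mchart_open (c : chart R X) x : mchart c -> cdom c x ->
  nbhs (cmap c x) (cmap c @` cdom c).
Proof.
by move=> [_ oc _] cx; apply: open_nbhs_nbhs; split=> //; exists x.
Qed.

Global Instance mnear_filter (x : X) : ProperFilter (mnear x).
Proof.
have [c mc cx] := premfd_cover x.
have E W : mnear x W <-> nbhs (cmap c x) (cmap c @` (cdom c `&` W)).
  exact: mnearP.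
apply: Build_ProperFilter_ex => [W /E /nbhs_singleton[y [_ Wy] _]|]; first by exists y.
split=> [|P Q /E nP /E nQ|P Q PQ /E nP]; apply/E.
- by rewrite setIT; exact: mchart_open.
- near=> u.
  have [y [cy Py] Ey] : (cmap c @` (cdom c `&` P)) u by near: u.
  have [z [cz Qz] Ez] : (cmap c @` (cdom c `&` Q)) u by near: u.
  exists y => //; split=> //; split=> //.
  by rewrite (cinjE (mchart_inj mc) cy cz) // Ez.
- by apply: filterS nP => _ [y [cy Py] <-]; exists y => //; split=> //; exact: PQ.
Unshelve. all: by end_near. Qed.

Lemma mnear_self x (W : set X) : mnear x W -> W x.
Proof.
move=> [c [mc cx /nbhs_singleton[y [cy Wy] E]]].
by rewrite -(cinjE (mchart_inj mc) cy cx E).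
Qed.

Lemma mnear_mnear x (W : set X) : mnear x W -> mnear x (fun y => mnear y W).
Proof.
move=> [c [mc cx /nbhs_interior nW]]; apply/(mnearP _ mc cx).
apply: filterS nW => u nu; have [y [cy Wy] E] := nbhs_singleton nu.
by exists y => //; split=> //; apply/(mnearP _ mc cy); rewrite E.
Qed.

Lemma mnear_cdom (c : chart R X) x : mchart c -> cdom c x -> mnear x (cdom c).
Proof. by move=> mc cx; apply/(mnearP _ mc cx); rewrite setIid; exact: mchart_open. Qed.

Lemma cinvx (c : chart R X) x : mchart c -> cdom c x -> cinv c x (cmap c x) = x.
Proof. by move=> mc cx; rewrite cinvK//; exact: mchart_inj. Qed.

Lemma msat_continuous m (f : X -> 'rV[R]_m) x (A : set 'rV[R]_m) :
  msat f x -> nbhs (f x) A -> mnear x (f @^-1` A).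
Proof.
move=> fx; have [c mc cx] := premfd_cover x; rewrite -{1}(cinvx mc cx).
move=> /(sat_continuous (msat_chart fx mc cx)) nA.
apply/(mnearP _ mc cx); near=> u.
have [y cy Ey] : (cmap c @` cdom c) u by near: u; exact: mchart_open.
exists y => //; split=> //=; rewrite -(cinvK x (mchart_inj mc) cy) Ey.
by near: u.
Unshelve. all: by end_near. Qed.

Lemma msat_ext m (f g : X -> 'rV[R]_m) x :
  mnear x [set y | f y = g y] -> msat f x -> msat g x.
Proof.
have [c mc cx] := premfd_cover x.
move=> /(mnearP _ mc cx) fg /(msatP _ mc cx) fx; apply/(msatP _ mc cx).
apply: sat_ext fx; apply: filterS fg => _ [y [cy fgy] <-].
by rewrite !cinvK//; exact: mchart_inj.
Qed.

Lemma msat_eq m (f g : X -> 'rV[R]_m) x : f =1 g -> msat f x -> msat g x.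
Proof. by move=> /funext ->. Qed.

(** Here [k] stands for a chart inverse: closure properties of [sat] under arbitrary composites
    carry over to functions on the manifold. *)
Lemma msat_lift2 m1 m2 m (f : X -> 'rV[R]_m1) (g : X -> 'rV[R]_m2)
    (h : X -> 'rV[R]_m) x :
  (forall n (k : 'rV[R]_n -> X) u,
    sat (fun v => f (k v)) u -> sat (fun v => g (k v)) u ->
    sat (fun v => h (k v)) u) ->
  msat f x -> msat g x -> msat h x.
Proof.
have [c mc cx] := premfd_cover x.
by move=> H /(msatP _ mc cx) fx /(msatP _ mc cx) gx; apply/(msatP _ mc cx)/H.
Qed.

Lemma msat_lift1 m1 m (f : X -> 'rV[R]_m1) (h : X -> 'rV[R]_m) x :
  (forall n (k : 'rV[R]_n -> X) u,
    sat (fun v => f (k v)) u -> sat (fun v => h (k v)) u) ->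
  msat f x -> msat h x.
Proof. by move=> H fx; apply: (msat_lift2 _ fx fx) => n k u + _; exact: H. Qed.

Lemma msat_cst m (a : 'rV[R]_m) (x : X) : msat (fun=> a) x.
Proof.
have [c mc cx] := premfd_cover x; apply/(msatP _ mc cx); exact: sat_cst.
Qed.

Lemma msat_comp n m (g : 'rV[R]_n -> 'rV[R]_m) (f : X -> 'rV[R]_n) x :
  sat g (f x) -> msat f x -> msat (fun y => g (f y)) x.
Proof.
have [c mc cx] := premfd_cover x.
move=> gx /(msatP _ mc cx) fx; apply/(msatP _ mc cx).
by apply: sat_comp fx; rewrite cinvx.
Qed.

Lemma msat_row_mx n m (f : X -> 'rV[R]_n) (g : X -> 'rV[R]_m) x :
  msat f x -> msat g x -> msat (fun y => row_mx (f y) (g y)) x.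
Proof. by apply: msat_lift2 => ? ? ?; exact: sat_row_mx. Qed.

Lemma msatD n (f g : X -> 'rV[R]_n) x :
  msat f x -> msat g x -> msat (fun y => f y + g y) x.
Proof. by apply: msat_lift2 => ? ? ?; exact: satD. Qed.

Lemma msat_lsubmx n m (f : X -> 'rV[R]_(n + m)) x :
  msat f x -> msat (fun y => lsubmx (f y)) x.
Proof. by apply: msat_lift1 => ? ? ?; exact: sat_lsubmx. Qed.

Lemma msat_rsubmx n m (f : X -> 'rV[R]_(n + m)) x :
  msat f x -> msat (fun y => rsubmx (f y)) x.
Proof. by apply: msat_lift1 => ? ? ?; exact: sat_rsubmx. Qed.

Lemma msat_cmap (c : chart R X) x : mchart c -> cdom c x -> msat (cmap c) x.
Proof.
move=> mc cx; apply/(msatP _ mc cx); apply: sat_ext (sat_id _).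
apply: filterS (mchart_open mc cx) => _ [y cy <-].
by rewrite cinvK//; exact: mchart_inj.
Qed.

End PreManifold.

Section SmoothMaps.

Lemma smap_chart X Y (f : X -> Y) x (e : chart R Y) :
  premfd X -> premfd Y -> smap f x -> mchart e -> cdom e (f x) ->
  mnear x (f @^-1` cdom e) /\ msat (fun y => cmap e (f y)) x.
Proof.
move=> hX hY [d [md dfx nd fd]] me efx.
have [g [sg ng]] := mchart_transition hY me md efx dfx.
have FX := mnear_filter hX x.
have nE : mnear x [set y | cdom e (f y) /\ cmap e (f y) = g (cmap d (f y))].
  apply: filterS2 nd (msat_continuous hX fd ng) => y /= dy [z [ez dz E <-]].
  by rewrite -(cinjE (mchart_inj md) dz dy E).
split; first by apply: filterS nE => y [].
apply: (msat_ext hX (f := fun y => g (cmap d (f y)))).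
  by apply: filterS nE => y [].
exact: msat_comp.
Qed.

Lemma smap_mnear X Y (f : X -> Y) x (A : set Y) :
  premfd X -> premfd Y -> smap f x -> mnear (f x) A -> mnear x (f @^-1` A).
Proof.
move=> hX hY [d [md dfx nd fd]] /(mnearP hY _ md dfx) nA.
have FX := mnear_filter hX x.
apply: filterS2 nd (msat_continuous hX fd nA) => y /= dy [z [dz Az] E].
by rewrite -(cinjE (mchart_inj md) dz dy E).
Qed.

Lemma smap_msat X Y m (g : Y -> 'rV[R]_m) (f : X -> Y) x :
  premfd X -> premfd Y -> smap f x -> msat g (f x) -> msat (fun y => g (f y)) x.
Proof.
move=> hX hY [d [md dfx nd fd]] /(msatP hY _ md dfx) gd.
apply: (msat_ext hX (f := fun y => g (cinv d (f x) (cmap d (f y))))).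
  have FX := mnear_filter hX x.
  by apply: filterS nd => y /= dy; rewrite cinvK//; exact: mchart_inj.
exact: (msat_comp hX (g := fun u => g (cinv d (f x) u))).
Qed.

Lemma smap_comp X Y Z (g : Y -> Z) (f : X -> Y) x :
  premfd X -> premfd Y -> smap f x -> smap g (f x) -> smap (fun y => g (f y)) x.
Proof.
move=> hX hY fx [d [md dgfx nd gd]]; exists d; split=> //.
  exact: (smap_mnear hX hY fx nd).
exact: (smap_msat hX hY fx gd).
Qed.

Lemma smap_ext X Y (f g : X -> Y) x : premfd X ->
  mnear x [set y | f y = g y] -> smap f x -> smap g x.
Proof.
move=> hX fg [d [md dfx nd fd]]; have FX := mnear_filter hX x.
exists d; split=> //; first by rewrite -(mnear_self fg).
  by apply: filterS2 fg nd => y /= ->.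
by apply: (msat_ext hX) fd; apply: filterS fg => y /= ->.
Qed.

Lemma smap_id X (x : X) : premfd X -> smap (fun y => y) x.
Proof.
move=> hX; have [c mc cx] := premfd_cover hX x.
by exists c; split=> //; [exact: mnear_cdom|exact: msat_cmap].
Qed.

Lemma smap_cst X Y (x : X) (y : Y) : premfd X -> premfd Y ->
  smap (fun=> y) x.
Proof.
move=> hX hY; have [c mc cy] := premfd_cover hY y; exists c; split=> //.
  have FX := mnear_filter hX x.
  by apply: filterS filterT => z _ /=.
exact: msat_cst.
Qed.

Lemma smooth_mapP X Y (f : X -> Y) : premfd X -> premfd Y ->
  smooth_map f <-> forall x, smap f x.
Proof.
move=> hX hY; split=> [fS x|fS c d ac ad].
  have [c ac cx] := hX.2 x; have [d ad dfx] := hY.2 (f x).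
  have mc := atlas_mchart hX ac; have md := atlas_mchart hY ad.
  have [oS [g /(smooth_onP _ oS) gS gE]] := fS c d ac ad.
  have Sx : (cmap c @` (cdom c `&` f @^-1` cdom d)) (cmap c x) by exists x.
  have nS := open_nbhs_nbhs (conj oS Sx).
  exists d; split=> //; first by exists c.
  exists c; split=> //; apply: sat_ext (gS _ Sx).
  apply: filterS nS => _ [y [cy dy] <-].
  by rewrite gE// cinvK//; exact: mchart_inj.
have mc := atlas_mchart hX ac; have md := atlas_mchart hY ad.
have [||oS [g gS gE]] := @smooth_lift X c (cdom c `&` f @^-1` cdom d) _
  (fun x => cmap d (f x)) (mchart_inj mc).
- by move=> x [].
- move=> x [cx dfx]; have [nd fd] := smap_chart hX hY (fS x) md dfx.
  by split; [exact: (mnear_chart hX nd)|exact: (msat_chart hX fd)].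
split=> //; exists g => // x cx dfx; exact: gE.
Qed.

End SmoothMaps.

(** Coordinate space as a manifold, so that [smap] also covers parametrisations. *)
Definition euc n : mfd R :=
  @Mfd R 'rV[R]_n [set @Chart R 'rV[R]_n n setT id].

Lemma euc_mchart n (c : chart R (euc n)) : atlas c -> mchart c.
Proof.
move=> ->; split=> /=; first by move=> x y.
  by rewrite image_id; exact: openT.
move=> _ ->; rewrite /smooth_overlap /= setIT image_id; split.
  split; first exact: openT.
  by exists id => //; apply/smooth_onP => [|x _]; [exact: openT|exact: sat_id].
split; first exact: openT.
by exists id => //; apply/smooth_onP => [|x _]; [exact: openT|exact: sat_id].
Qed.

Lemma premfd_euc n : premfd (euc n).
Proof.
split; first exact: euc_mchart.
by move=> x; exists (@Chart R (euc n) n setT id).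
Qed.

Lemma euc_cinv n (x u : euc n) : cinv (@Chart R (euc n) n setT id) x u = u.
Proof.
by rewrite -[u in LHS]/(cmap (@Chart R (euc n) n setT id) u) cinvK.
Qed.

Lemma msat_euc n m (f : euc n -> 'rV[R]_m) (x : euc n) :
  msat f x <-> sat (f : 'rV[R]_n -> _) x.
Proof.
have mc : mchart (@Chart R (euc n) n setT id) by exact: euc_mchart.
rewrite (msatP (@premfd_euc n) f mc)//=.
suff -> : (fun u => f (cinv (@Chart R (euc n) n setT id) x u)) = f by [].
by apply/funext => u; rewrite euc_cinv.
Qed.

Lemma mnear_euc n (x : euc n) W : mnear x W <-> nbhs (x : 'rV[R]_n) W.
Proof.
have mc : mchart (@Chart R (euc n) n setT id) by exact: euc_mchart.
by rewrite (mnearP (@premfd_euc n) W mc)//= setTI image_id.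
Qed.

Lemma smap_cinv X (c : chart R X) x x0 : premfd X -> mchart c -> cdom c x ->
  smap (X := euc (cdim c)) (cinv c x0) (cmap c x).
Proof.
move=> hX mc cx; have ic := mchart_inj mc.
exists c; split=> //; first by rewrite cinvK.
  apply/mnear_euc; apply: filterS (mchart_open mc cx) => _ [y cy <-].
  by rewrite /= cinvK.
apply/msat_euc; apply: sat_ext (sat_id _).
by apply: filterS (mchart_open mc cx) => _ [y cy <-]; rewrite cinvK.
Qed.

(** The given local inverse [I] stands in for the inverse function theorem: preimages under [I] show
    that images of neighbourhoods are neighbourhoods, and [I] followed by an atlas chart is the
    transition. *)
Lemma mchartI X (c : chart R X) : premfd X -> cinj c ->
  (forall x, cdom c x -> [/\ mnear x (cdom c), msat (cmap c) x &
    exists I : euc (cdim c) -> X, smap I (cmap c x) /\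
      \forall u \near cmap c x, cdom c (I u) /\ cmap c (I u) = u]) ->
  mchart c.
Proof.
move=> hX ic H.
have oc W x : cdom c x -> mnear x W -> nbhs (cmap c x) (cmap c @` (cdom c `&` W)).
  move=> cx nW; have [_ _ [I [sI nI]]] := H x cx.
  have [cIx EIx] := nbhs_singleton nI.
  have {cIx EIx} Ix : I (cmap c x) = x by exact: cinjE EIx.
  rewrite -{1}Ix in nW.
  have /mnear_euc nIW := smap_mnear (@premfd_euc _) hX sI nW.
  near=> u; have [cIu <-] : cdom c (I u) /\ cmap c (I u) = u by near: u.
  by exists (I u) => //; split=> //; near: u.
split=> //.
  rewrite openE => _ [x cx <-]; rewrite -[cdom c]setIid; apply: oc => //.
  by have [] := H x cx.
move=> d ad; have md := atlas_mchart hX ad; split.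
  have [||oS [g gS gE]] := @smooth_lift X c (cdom c `&` cdom d) _ (cmap d) ic.
  - by move=> x [].
  - move=> x [cx dx]; split; first by apply: oc => //; exact: mnear_cdom.
    have [_ _ [I [sI nI]]] := H x cx.
    have [cIx EIx] := nbhs_singleton nI.
    have {cIx EIx} Ix : I (cmap c x) = x by exact: cinjE EIx.
    have dI : cdom d (I (cmap c x)) by rewrite Ix.
    have [_ /msat_euc sdI] := smap_chart (@premfd_euc _) hX sI md dI.
    apply: sat_ext sdI; apply: filterS nI => u [cIu E].
    by rewrite -{2}E cinvK.
  by split=> //; exists g => // x cx dx; exact: gE.
have [||oS [g gS gE]] := @smooth_lift X d (cdom d `&` cdom c) _ (cmap c)
  (mchart_inj md).
- by move=> x [].
- move=> x [dx cx]; have [nc sc _] := H x cx.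
  by split; [exact: (mnear_chart hX nc)|exact: (msat_chart hX sc)].
by split=> //; exists g => // x dx cx; exact: gE.
Unshelve. all: by end_near. Qed.

Lemma premfdI X :
  (forall c : chart R X, atlas c -> cinj c) ->
  (forall x : X, exists2 c : chart R X, atlas c & cdom c x) ->
  (forall c d : chart R X, atlas c -> atlas d -> forall x, cdom c x -> cdom d x ->
    nbhs (cmap c x) (cmap c @` (cdom c `&` cdom d)) /\
    sat (fun u => cmap d (cinv c x u)) (cmap c x)) ->
  premfd X.
Proof.
move=> ic cov H; split=> // c ac.
have ov (c' d : chart R X) : atlas c' -> atlas d -> smooth_overlap c' d.
  move=> ac' ad.
  have [||oS [g gS gE]] := @smooth_lift X c' (cdom c' `&` cdom d) _ (cmap d)
    (ic _ ac').
  - by move=> x [].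
  - by move=> x [cx dx]; exact: H.
  by split=> //; exists g => // x cx dx; exact: gE.
split=> //; first exact: ic.
  by have [] := ov c c ac ac; rewrite setIid.
by move=> d ad; split; exact: ov.
Qed.

End Charts.
Arguments cinv {R X} c x0 u.

Section Constructions.
Context {R : realType}.
Implicit Types X Y Z B : mfd R.

Lemma smap_euc X n (f : X -> euc n) x : premfd X ->
  msat (f : X -> 'rV[R]_n) x -> smap f x.
Proof.
move=> hX fx; exists (@Chart R (euc n) n setT id); split=> //=.
  exact: euc_mchart.
by have FX := mnear_filter hX x; exact: filterT.
Qed.

Lemma smap_cinv_comp (X : mfd R) Z (c : chart R X) b b0 (f : Z -> 'rV[R]_(cdim c)) z :
  premfd X -> premfd Z -> mchart c -> cdom c b -> msat f z -> f z = cmap c b ->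
  smap (fun y => cinv c b0 (f y)) z.
Proof.
move=> hX hZ mc cb sf fz.
apply: (@smap_comp R Z (euc (cdim c)) X (cinv c b0) f z hZ (premfd_euc _)).
  exact: smap_euc.
by rewrite fz; exact: smap_cinv.
Qed.

(** That [r] undoes [r'] on a whole neighbourhood, and not just at one point, turns [r'] followed by
    the inverse of [c] into the local inverse that [mchartI] asks for. *)
Lemma mchart_post_local (X : mfd R) (c e : chart R X)
    (r : 'rV[R]_(cdim c) -> 'rV[R]_(cdim e))
    (r' : 'rV[R]_(cdim e) -> 'rV[R]_(cdim c)) :
  premfd X -> mchart c -> (forall x, cdom e x <-> cdom c x) ->
  (forall x, cdom c x -> [/\ cmap e x = r (cmap c x), sat r (cmap c x),
     sat r' (cmap e x), r' (cmap e x) = cmap c x &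
     \forall u \near cmap e x, r (r' u) = u]) -> mchart e.
Proof.
move=> hX mc ec H.
apply: mchartI => // [x x' /set_mem /ec cx /set_mem /ec cx' E|x /ec cx].
  have [_ _ _ Ex _] := H x cx; have [_ _ _ Ex' _] := H x' cx'.
  by apply: (cinjE (mchart_inj mc) cx cx'); rewrite -Ex -Ex' E.
have FX := mnear_filter hX x; have nc := mnear_cdom hX mc cx.
have [Ee sr sr' Er nr] := H x cx.
split; first by apply: filterS nc => x' /ec.
  apply: (msat_ext hX (f := fun x' => r (cmap c x'))).
    by apply: filterS nc => x' /H[].
  by apply: (msat_comp hX sr); exact: msat_cmap.
exists (fun u => cinv c x (r' u)); split.
  apply: (smap_cinv_comp (Z := euc _) x hX (premfd_euc _) mc cx) => //.
  exact/msat_euc.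
have := sat_near sr' (A := cmap c @` cdom c).
rewrite Er => /(_ (mchart_open mc cx)); apply: filterS2 nr => u rr [x' cx' E].
rewrite -E cinvK//; last exact: mchart_inj.
have [Ee' _ _ _ _] := H x' cx'.
by split; [exact/ec|rewrite Ee' E].
Qed.

Lemma mchart_post X (c e : chart R X)
    (r : 'rV[R]_(cdim c) -> 'rV[R]_(cdim e))
    (r' : 'rV[R]_(cdim e) -> 'rV[R]_(cdim c)) :
  premfd X -> mchart c -> (forall x, cdom e x <-> cdom c x) ->
  (forall x, cdom c x -> cmap e x = r (cmap c x)) ->
  (forall u, sat r u) -> (forall u, sat r' u) ->
  cancel r r' -> cancel r' r -> mchart e.
Proof.
move=> hX mc ec Ee sr sr' rK r'K.
apply: (mchart_post_local (r := r) (r' := r') hX mc ec) => x cx.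
by split; rewrite ?Ee//; apply: filterE => u; rewrite r'K.
Qed.

Definition fchart X B (p : X -> B) (d : chart R B) N (psi : X -> 'rV[R]_N) :
    chart R X :=
  Chart (p @^-1` cdom d) (fun x => row_mx (cmap d (p x)) (psi x)).

Definition fiber_coord X B (p : X -> B) (d : chart R B) N (psi : X -> 'rV[R]_N) :=
  (forall x y, cdom d (p x) -> p x = p y -> psi x = psi y -> x = y) /\
  (forall b v, cdom d b -> exists x, p x = b /\ psi x = v).

Lemma fchart_inj X B (p : X -> B) (d : chart R B) N (psi : X -> 'rV[R]_N) :
  cinj d -> fiber_coord p d psi -> cinj (fchart p d psi).
Proof.
move=> id [ipsi _] x y /set_mem /= dx /set_mem /= dy /eq_row_mx[/= Ed Ep].
exact: ipsi (cinjE id dx dy Ed) Ep.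
Qed.

(** Common construction of the manifolds of hulls and of affine duals. The base chart [e] of the
    transition is free because hull vectors transform covariantly and affine functions
    contravariantly, which favours the chart of the old or of the new trivialisation. *)
Lemma premfd_fiber X B (p : X -> B)
    (Q : forall (d : chart R B) N, (X -> 'rV[R]_N) -> Prop) :
  premfd B ->
  (forall c : chart R X, atlas c <->
    exists d N (psi : X -> 'rV[R]_N), Q d N psi /\ c = fchart p d psi) ->
  (forall d N (psi : X -> 'rV[R]_N), Q d N psi ->
     mchart d /\ fiber_coord p d psi) ->
  (forall b, exists d N (psi : X -> 'rV[R]_N), Q d N psi /\ cdom d b) ->
  (forall d N (psi : X -> 'rV[R]_N) d' N' (psi' : X -> 'rV[R]_N') x,
     Q d N psi -> Q d' N' psi' -> cdom d (p x) -> cdom d' (p x) ->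
     exists (e : chart R B) (G : 'rV[R]_(cdim e + N) -> 'rV[R]_N'),
     [/\ mchart e, cdom e (p x), sat G (row_mx (cmap e (p x)) (psi x)) &
       mnear (p x) [set b | forall y, p y = b ->
         psi' y = G (row_mx (cmap e b) (psi y))]]) ->
  premfd X.
Proof.
move=> hB atX QP Qcov Qtr; apply: premfdI.
- move=> c /atX[d [N [psi [q ->]]]]; have [md fp] := QP _ _ _ q.
  exact: fchart_inj (mchart_inj md) fp.
- move=> x; have [d [N [psi [q dx]]]] := Qcov (p x).
  by exists (fchart p d psi) => //; apply/atX; exists d, N, psi.
move=> c c' /atX[d [N [psi [q ->]]]] /atX[d' [N' [psi' [q' ->]]]] x /= dx dx'.
have [md fp] := QP _ _ _ q; have [md' fp'] := QP _ _ _ q'.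
have ifc := fchart_inj (mchart_inj md) fp.
set u0 := row_mx _ (psi x).
have near_lsub A : nbhs (cmap d (p x)) A -> \forall u \near u0, A (lsubmx u).
  rewrite -{1}(row_mxKl (cmap d (p x)) (psi x)).
  exact: (sat_near (sat_lsubmx (sat_id u0))).
have FB := mnear_filter hB (p x).
have nd : mnear (p x) (cdom d) by exact: mnear_cdom.
have nd' : mnear (p x) (cdom d') by exact: mnear_cdom.
split.
  have := near_lsub _ (mnear_chart hB nd' md dx).
  apply: filterS => u [b [db db'] Eb].
  have [y [Ey Py]] := fp.2 b (rsubmx u) db.
  exists y; first by rewrite /= Ey.
  by rewrite Ey Eb Py hsubmxK.
have [e [G [me ex sG nG]]] := Qtr _ _ _ _ _ _ _ q q' dx dx'.
pose bb (u : 'rV[R]_(cdim d + N)) := cinv d (p x) (lsubmx u).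
pose H u := row_mx (cmap d' (bb u)) (G (row_mx (cmap e (bb u)) (rsubmx u))).
have bb0 : bb u0 = p x by rewrite /bb row_mxKl cinvx.
have sbb m (f : B -> 'rV[R]_m) : msat f (p x) -> sat (fun u => f (bb u)) u0.
  move=> fx; apply: (sat_comp (g := fun v => f (cinv d (p x) v))).
    by rewrite row_mxKl; exact: msat_chart.
  exact: sat_lsubmx (sat_id _).
have sH : sat H u0.
  apply: sat_row_mx; first by apply: sbb; exact: msat_cmap.
  apply: sat_comp; first by rewrite bb0 row_mxKr.
  apply: sat_row_mx; first by apply: sbb; exact: msat_cmap.
  exact: sat_rsubmx (sat_id _).
apply: sat_ext sH.
have := near_lsub _ (mnear_chart hB nG md dx).
apply: filterS => u [b [db nb] Eb].
have [y [Ey Py]] := fp.2 b (rsubmx u) db.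
have Eu : u = cmap (fchart p d psi) y by rewrite /= Ey Py Eb hsubmxK.
have Ebb : bb u = b by rewrite /bb -Eb cinvK//; exact: mchart_inj.
rewrite /H Ebb -Py -nb// -[X in cmap d' (p (cinv _ _ X))]/u.
by rewrite [in RHS]Eu cinvK ?Ey//= Ey.
Qed.

(** * Submanifolds and products *)

Section Submanifold.
Context {X : mfd R} (hX : premfd X) (S : set X).

Definition slice_chart k l (U : set X) (phi : X -> 'rV[R]_(k + l)) : Prop :=
  mchart (Chart U phi) /\ forall x, U x -> (S x <-> rsubmx (phi x) = 0).

Definition sub_chart k l (U : set X) (phi : X -> 'rV[R]_(k + l)) :
    chart R (sub_mfd S) :=
  @Chart R (set_type S) k [set s | U (val s)] (fun s => lsubmx (phi (val s))).

Lemma sub_atlasP (c : chart R (sub_mfd S)) : atlas c <->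
  exists k l U (phi : X -> 'rV[R]_(k + l)),
    slice_chart U phi /\ c = sub_chart U phi.
Proof.
split=> [[k [l [U [phi [m1 m2 ->]]]]]|[k [l [U [phi [[m1 m2] ->]]]]]].
  by exists k, l, U, phi.
by exists k, l, U, phi.
Qed.

Lemma sub_mfdP (s : sub_mfd S) : S (val s).
Proof. by move: s => [x Sx] /=; exact: set_mem. Qed.

Section Slice.
Context {k l : nat} {U : set X} {phi : X -> 'rV[R]_(k + l)}.
Hypothesis sl : slice_chart U phi.

Lemma slice_eq (s : sub_mfd S) : U (val s) ->
  phi (val s) = row_mx (lsubmx (phi (val s))) 0.
Proof.
move=> Us; rewrite -[LHS]hsubmxK; congr row_mx.
by apply/(sl.2 _ Us); exact: sub_mfdP.
Qed.

Lemma sub_chart_inj : cinj (sub_chart U phi).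
Proof.
move=> s s' /set_mem /= Us /set_mem /= Us' E; apply: val_inj.
apply: (cinjE (mchart_inj sl.1)) => //=.
by rewrite (slice_eq Us) (slice_eq Us') E.
Qed.

Lemma near_slice (s : sub_mfd S) A : U (val s) -> nbhs (phi (val s)) A ->
  \forall u \near lsubmx (phi (val s)), A (row_mx u 0).
Proof.
move=> Us; rewrite {1}(slice_eq Us).
have c0 : sat (fun u : 'rV[R]_k => row_mx u (0 : 'rV[R]_l)) (lsubmx (phi (val s))).
  by apply: sat_row_mx; [exact: sat_id|exact: sat_cst].
exact: (sat_near c0).
Qed.

Lemma sub_nbhs (s : sub_mfd S) (W : set X) : U (val s) -> mnear (val s) W ->
  nbhs (lsubmx (phi (val s)))
    (cmap (sub_chart U phi) @` (cdom (sub_chart U phi) `&` [set t | W (val t)])).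
Proof.
move=> Us nW; have := near_slice Us (mnear_chart hX nW sl.1 Us).
apply: filterS => u [y [/= Uy Wy] Ey].
have Sy : S y by apply/(sl.2 _ Uy); rewrite Ey row_mxKr.
exists (exist _ y (mem_set Sy)) => //=.
by rewrite Ey row_mxKl.
Qed.

Lemma sub_sat (s : sub_mfd S) m (F : X -> 'rV[R]_m) : U (val s) ->
  msat F (val s) ->
  sat (fun u => F (val (cinv (sub_chart U phi) s u))) (lsubmx (phi (val s))).
Proof.
move=> Us /(msatP hX _ sl.1 Us) /= sF.
have c0 : sat (fun u : 'rV[R]_k => row_mx u (0 : 'rV[R]_l)) (lsubmx (phi (val s))).
  by apply: sat_row_mx; [exact: sat_id|exact: sat_cst].
apply: sat_ext (sat_comp (g := fun v => F (cinv (Chart U phi) (val s) v)) _ c0);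
  last by rewrite -(slice_eq Us).
have := near_slice Us (mchart_open sl.1 Us).
apply: filterS => u [/= y Uy Ey].
have Sy : S y by apply/(sl.2 _ Uy); rewrite Ey row_mxKr.
rewrite -Ey (cinvK (c := Chart U phi) _ (mchart_inj sl.1) Uy).
have -> : u = cmap (sub_chart U phi) (exist _ y (mem_set Sy)).
  by rewrite /= Ey row_mxKl.
by rewrite cinvK//; exact: sub_chart_inj.
Qed.

End Slice.

(** In a slice chart a local extension [F] to the ambient manifold restricts to a smooth expression
    of [f]. This reaches fibre products, on which affine combinations extend to neighbouring pairs
    in different fibres. *)
Lemma smooth_map_sub Y (f : sub_mfd S -> Y) : premfd Y ->
  (forall s : sub_mfd S, exists (d : chart R Y) (F : X -> 'rV[R]_(cdim d)),
    [/\ mchart d, msat F (val s) & mnear (val s) [set x | forall t : sub_mfd S,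
       val t = x -> cdom d (f t) /\ cmap d (f t) = F x]]) ->
  smooth_map f.
Proof.
move=> hY H c e /sub_atlasP[k [l [U [phi [sl ->]]]]] ae.
have me := atlas_mchart hY ae.
have [||oS [g gS gE]] := @smooth_lift _ (sub_mfd S) (sub_chart U phi)
  (cdom (sub_chart U phi) `&` f @^-1` cdom e) _ (fun s => cmap e (f s))
  (sub_chart_inj sl).
- by move=> x [].
- move=> s [/= Us efs]; have [d [F [md sF nF]]] := H s.
  have FX := mnear_filter hX (val s).
  have [dfs EF] := mnear_self nF s erefl.
  have [g [sg ng]] := mchart_transition hY me md efs dfs.
  rewrite EF in sg ng.
  have nE : mnear (val s) [set x | forall t : sub_mfd S, val t = x ->
      cdom e (f t) /\ cmap e (f t) = g (F x)].
    apply: filterS2 nF (msat_continuous hX sF ng) => x /= Hx [z [ez dz Ez Ez']] t tx.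
    have [dft Eft] := Hx t tx.
    have -> : f t = z by apply: (cinjE (mchart_inj md)) => //; rewrite Eft.
    by split.
  have nb := sub_nbhs sl Us nE; split.
    apply: filterS nb => _ [t [/= Ut /(_ t erefl)[et _]] <-].
    by exists t.
  have := sub_sat sl Us (msat_comp hX sg sF).
  apply: sat_ext; apply: filterS nb => _ [t [/= Ut /(_ t erefl)[et Et]] <-].
  by rewrite -[lsubmx _]/(cmap (sub_chart U phi) t) cinvK//; exact: sub_chart_inj.
by split=> //; exists g => // x cx dx; exact: gE.
Qed.

Hypothesis cov : forall x, S x ->
  exists k l U (phi : X -> 'rV[R]_(k + l)), slice_chart U phi /\ U x.

Lemma premfd_sub : premfd (sub_mfd S).
Proof.
apply: premfdI.
- by move=> c /sub_atlasP[k [l [U [phi [sl ->]]]]]; exact: sub_chart_inj.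
- move=> s; have [k [l [U [phi [sl Us]]]]] := cov (sub_mfdP s).
  by exists (sub_chart U phi) => //; apply/sub_atlasP; exists k, l, U, phi.
move=> c d /sub_atlasP[k [l [U [phi [sl ->]]]]].
move=> /sub_atlasP[k' [l' [U' [phi' [sl' ->]]]]] s /= Us Us'.
split.
  exact: (sub_nbhs sl Us (mnear_cdom hX sl'.1 Us')).
apply: (sub_sat sl (F := fun x => lsubmx (phi' x)) Us).
apply: msat_lsubmx => //; exact: (msat_cmap hX sl'.1 Us').
Qed.

Lemma mchart_sub k l U (phi : X -> 'rV[R]_(k + l)) :
  slice_chart U phi -> mchart (sub_chart U phi).
Proof.
move=> sl; apply: (atlas_mchart premfd_sub).
by apply/sub_atlasP; exists k, l, U, phi.
Qed.

End Submanifold.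

Lemma premfd_prod X Y : premfd X -> premfd Y -> premfd (prod_mfd X Y).
Proof.
move=> hX hY; apply: premfdI.
- move=> c [a [b [aa ab ->]]] [x y] [x' y'] /set_mem /= [ax bx].
  move=> /set_mem /= [ax' bx'] /eq_row_mx[Ea Eb].
  rewrite (cinjE (mchart_inj (atlas_mchart hX aa)) ax ax' Ea).
  by rewrite (cinjE (mchart_inj (atlas_mchart hY ab)) bx bx' Eb).
- move=> [x y]; have [a aa ax] := hX.2 x; have [b ab bx] := hY.2 y.
  by eexists; [exists a, b; split=> //|].
move=> c d [a [b [aa ab ->]]] [a' [b' [aa' ab' ->]]] [x y] /= [ax bx] [ax' bx'].
have [ma mb] := (atlas_mchart hX aa, atlas_mchart hY ab).
have [ma' mb'] := (atlas_mchart hX aa', atlas_mchart hY ab').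
set u0 := row_mx _ _.
have cl : sat lsubmx u0 := sat_lsubmx (sat_id u0).
have cr : sat rsubmx u0 := sat_rsubmx (sat_id u0).
have nl A : nbhs (cmap a x) A -> \forall u \near u0, A (lsubmx u).
  by rewrite -{1}(row_mxKl (cmap a x) (cmap b y)) => /(sat_near cl).
have nr A : nbhs (cmap b y) A -> \forall u \near u0, A (rsubmx u).
  by rewrite -{1}(row_mxKr (cmap a x) (cmap b y)) => /(sat_near cr).
have n1 := nl _ (mnear_chart hX (mnear_cdom hX ma' ax') ma ax).
have n2 := nr _ (mnear_chart hY (mnear_cdom hY mb' bx') mb bx).
split.
  near=> u.
  have [x1 [ax1 ax1'] E1] : (cmap a @` (cdom a `&` cdom a')) (lsubmx u) by near: u.
  have [y1 [by1 by1'] E2] : (cmap b @` (cdom b `&` cdom b')) (rsubmx u) by near: u.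
  by exists (x1, y1) => //=; rewrite E1 E2 hsubmxK.
apply: (@sat_ext _ _ _ (fun u => row_mx (cmap a' (cinv a x (lsubmx u)))
  (cmap b' (cinv b y (rsubmx u))))).
  near=> u.
  have [x1 [ax1 ax1'] E1] : (cmap a @` (cdom a `&` cdom a')) (lsubmx u) by near: u.
  have [y1 [by1 by1'] E2] : (cmap b @` (cdom b `&` cdom b')) (rsubmx u) by near: u.
  rewrite -E1 -E2 !cinvK; try exact: mchart_inj; try by [].
  set cc := Chart _ _.
  have -> : u = cmap cc (x1, y1) by rewrite /= E1 E2 hsubmxK.
  rewrite cinvK// => -[x2 y2] [x3 y3] /set_mem /= [a2 b2] /set_mem /= [a3 b3].
  move=> /eq_row_mx[Ea Eb].
  rewrite (cinjE (mchart_inj ma) a2 a3 Ea).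
  by rewrite (cinjE (mchart_inj mb) b2 b3 Eb).
apply: sat_row_mx.
  apply: (sat_comp (g := fun v => cmap a' (cinv a x v))) => //.
  by rewrite row_mxKl; apply: msat_chart => //; exact: msat_cmap.
apply: (sat_comp (g := fun v => cmap b' (cinv b y v))) => //.
by rewrite row_mxKr; apply: msat_chart => //; exact: msat_cmap.
Unshelve. all: by end_near. Qed.

Lemma smap_fst X Y (z : prod_mfd X Y) : premfd X -> premfd Y ->
  smap (fun z : prod_mfd X Y => z.1) z.
Proof.
move=> hX hY; have [a aa ax] := hX.2 z.1; have [b ab bx] := hY.2 z.2.
have hP := premfd_prod hX hY.
pose c : chart R (prod_mfd X Y) := @Chart R (X * Y) (cdim a + cdim b)
  (cdom a `*` cdom b) (fun xy => row_mx (cmap a xy.1) (cmap b xy.2)).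
have mc : mchart c by apply: (atlas_mchart hP); exists a, b.
have cz : cdom c z by [].
have FP := mnear_filter hP z; have nc := mnear_cdom hP mc cz.
exists a; split=> //; first exact: atlas_mchart aa.
  by apply: filterS nc => -[x y] [].
apply: (msat_eq _ (msat_lsubmx hP (msat_cmap hP mc cz))) => y.
by rewrite /= row_mxKl.
Qed.

Lemma smap_snd X Y (z : prod_mfd X Y) : premfd X -> premfd Y ->
  smap (fun z : prod_mfd X Y => z.2) z.
Proof.
move=> hX hY; have [a aa ax] := hX.2 z.1; have [b ab bx] := hY.2 z.2.
have hP := premfd_prod hX hY.
pose c : chart R (prod_mfd X Y) := @Chart R (X * Y) (cdim a + cdim b)
  (cdom a `*` cdom b) (fun xy => row_mx (cmap a xy.1) (cmap b xy.2)).
have mc : mchart c by apply: (atlas_mchart hP); exists a, b.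
have cz : cdom c z by [].
have FP := mnear_filter hP z; have nc := mnear_cdom hP mc cz.
exists b; split=> //; first exact: atlas_mchart ab.
  by apply: filterS nc => -[x y] [].
apply: (msat_eq _ (msat_rsubmx hP (msat_cmap hP mc cz))) => y.
by rewrite /= row_mxKr.
Qed.

End Constructions.

(** * Affine bundles *)

Section Topology.
Context {R : realType}.
Implicit Types X Y B : mfd R.

Lemma manifold_premfd X : manifold X -> premfd X.
Proof. by case. Qed.

Lemma mopenP X (W : set X) : premfd X -> mopen W <-> forall x, W x -> mnear x W.
Proof.
move=> hX; split=> [oW x Wx|H c ac].
  have [c ac cx] := hX.2 x; have mc := atlas_mchart hX ac.
  apply/(mnearP hX _ mc cx); apply: open_nbhs_nbhs; split; first exact: oW.
  by exists x.
rewrite openE => _ [x [cx Wx] <-].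
exact: (mnear_chart hX (H x Wx) (atlas_mchart hX ac) cx).
Qed.

Lemma mopen_cdom X (c : chart R X) : premfd X -> mchart c -> mopen (cdom c).
Proof. by move=> hX mc; apply/mopenP => // x cx; exact: mnear_cdom. Qed.

Lemma mopen_preim X Y (f : X -> Y) (W : set Y) : premfd X -> premfd Y ->
  (forall x, smap f x) -> mopen W -> mopen (f @^-1` W).
Proof.
move=> hX hY sf /(mopenP _ hY) oW; apply/mopenP => // x Wfx.
exact: (smap_mnear hX hY (sf x) (oW _ Wfx)).
Qed.

Lemma mopen_chart_preim X (c : chart R X) (W : set X) (A : set 'rV[R]_(cdim c)) :
  premfd X -> mchart c -> mopen W -> open A ->
  mopen (W `&` cdom c `&` cmap c @^-1` A).
Proof.
move=> hX mc /(mopenP _ hX) oW oA; apply/mopenP => // x [[Wx cx] Ax].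
have FX := mnear_filter hX x.
apply: filterI; first by apply: filterI; [exact: oW|exact: mnear_cdom].
by apply: (msat_continuous hX (msat_cmap hX mc cx)); exact: open_nbhs_nbhs.
Qed.

Lemma rat_row_dense n (u : 'rV[R]_n) (e : R) : 0 < e ->
  exists q : 'rV[rat]_n, ball (map_mx (@ratr R) q) e u.
Proof.
move=> e0.
have H (i : 'I_n) : exists q : rat, ball (ratr q : R) e (u ord0 i).
  have /rat_in_itvoo[q] : u ord0 i - e < u ord0 i + e.
    by rewrite ltrBlDr -addrA ltrDl addr_gt0.
  rewrite in_itv /= => /andP[q1 q2]; exists q.
  by rewrite -ball_normE /= ltr_distl q1 q2.
have [f Hf] := choice H.
exists (\row_i f i); split=> // i j.
by rewrite (ord1 i) !mxE; exact: Hf.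
Qed.

(** Balls with rational centre and radius 1/(k+1), pulled back by the chart and cut down to [W];
    [pickle] enumerates them. *)
Lemma chart_countable_basis X (c : chart R X) (W : set X) :
  premfd X -> mchart c -> mopen W -> W `<=` cdom c ->
  exists F : nat -> set X, (forall i, mopen (F i)) /\
    forall (U : set X) x, mopen U -> U x -> W x -> exists2 i, F i x & F i `<=` U.
Proof.
move=> hX mc oW Wc.
pose T := ('rV[rat]_(cdim c) * nat)%type.
pose A (t : T) := ball (map_mx (@ratr R) t.1) (t.2.+1%:R^-1).
pose F (i : nat) : set X := if @unpickle T i is Some t
  then W `&` cdom c `&` cmap c @^-1` A t else set0.
exists F; split=> [i|U x oU Ux Wx].
  rewrite /F; case: unpickle => [t|]; last by apply/mopenP.
  apply: mopen_chart_preim => //.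
  by apply: ball_open; rewrite invr_gt0.
have cx := Wc _ Wx.
have /nbhs_ballP[e /= e0 eU] := mnear_chart hX
  ((mopenP _ hX).1 oU _ Ux) mc cx.
(* Below e/2, a ball of this radius around a rational point close to x contains x and stays within
   distance e of it. *)
have [k ke] : exists k : nat, k.+1%:R^-1 < e / 2.
  have e20 : 0 < e / 2 by rewrite divr_gt0.
  by have [k _ /(_ k (leqnn k))] := near_infty_natSinv_lt (PosNum e20); exists k.
have k0 : 0 < k.+1%:R^-1 :> R by rewrite invr_gt0.
have [q qx] := rat_row_dense (cmap c x) k0.
exists (pickle ((q, k) : T)); rewrite /F pickleK //.
move=> y [[Wy cy] /= qy].
have [z [cz Uz] Ez] : (cmap c @` (cdom c `&` U)) (cmap c y).
  apply: eU; rewrite [e]splitr.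
  apply: (@ball_triangle _ _ (map_mx (@ratr R) q)).
    by apply: ball_sym; apply: le_ball qx; exact: ltW.
  by apply: le_ball qy; exact: ltW.
by rewrite -(cinjE (mchart_inj mc) cz cy Ez).
Qed.

(** Points of different fibres are separated in the base, points of one fibre in a common chart. The
    countable basis comes from those basic open sets of the base whose preimage lies in a single
    chart. *)
Lemma fiber_bundle_manifold X B (p : X -> B) :
  premfd X -> manifold B -> (forall x, smap p x) ->
  (forall b, exists (d : chart R B) (c : chart R X),
    [/\ mchart d, cdom d b, mchart c & cdom c = p @^-1` cdom d]) ->
  manifold X.
Proof.
move=> hX mB sp H; have hB := manifold_premfd mB.
have [_ _ hausB [V [oV bV]]] := mB.
split; [exact: hX.1|exact: hX.2| |].
  move=> x y xy; have [pxy|pxy] := pselect (p x = p y); last first.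
    have [U1 [U2 [oU1 oU2 U1x U2y U12]]] := hausB _ _ pxy.
    exists (p @^-1` U1), (p @^-1` U2); split=> //; try exact: mopen_preim.
    by rewrite -preimage_setI U12 preimage_set0.
  have [d [c [md dx mc Ec]]] := H (p x).
  have cx : cdom c x by rewrite Ec.
  have cy : cdom c y by rewrite Ec /= -pxy.
  have neq : cmap c x != cmap c y.
    by apply/eqP => /(cinjE (mchart_inj mc) cx cy).
  have := @norm_hausdorff R 'rV[R]_(cdim c); rewrite open_hausdorff.
  move=> /(_ _ _ neq)[[A1 A2] /= [/set_mem xA1 /set_mem yA2] [oA1 oA2 A12]].
  have oT : mopen (setT : set X).
    by apply/mopenP => // z _; have FX := mnear_filter hX z; exact: filterT.
  exists (setT `&` cdom c `&` cmap c @^-1` A1), (setT `&` cdom c `&` cmap c @^-1` A2).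
  split=> //; try exact: mopen_chart_preim.
  apply/seteqP; split=> // z [[_ z1] [_ z2]].
  have : (A1 `&` A2) (cmap c z) by split.
  by rewrite (eqP A12).
(* The family depends on [i] alone: one chart containing the preimage is chosen, if there is any,
   and its family serves all other such charts. *)
have K i : exists F : nat -> set X, (forall j, mopen (F j)) /\
    forall (c : chart R X), mchart c -> p @^-1` V i `<=` cdom c ->
    forall (U : set X) x, mopen U -> U x -> V i (p x) ->
    exists2 j, F j x & F j `<=` U.
  have [[c mc Vc]|nc] := pselect (exists2 c : chart R X, mchart c &
      p @^-1` V i `<=` cdom c).
    have [F [oF bF]] := chart_countable_basis hX mc
      (mopen_preim hX hB sp (oV i)) Vc.
    by exists F; split=> // _ _ _ U x; exact: bF.
  exists (fun=> set0); split=> [_|c mc Vc]; first by apply/mopenP.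
  by case: nc; exists c.
have [F HF] := choice K.
exists (fun n => if @unpickle (nat * nat)%type n is Some ij
  then F ij.1 ij.2 else set0); split.
  move=> n; case: unpickle => [[i j]|]; first exact: (HF i).1.
  by apply/mopenP.
move=> U x oU Ux; have [d [c [md dx mc Ec]]] := H (p x).
have [i Vix Vid] := bV _ _ (mopen_cdom hB md) dx.
have [|j Fx FU] := (HF i).2 c mc _ U x oU Ux Vix.
  by move=> y /= /Vid; rewrite Ec.
by exists (pickle ((i, j) : (nat * nat)%type)); rewrite pickleK.
Qed.

End Topology.

(** * Local trivialisations and smooth affine combinations *)

Section AffineBundles.
Context {R : realType}.
Implicit Types (E : abun R) (Z : mfd R).

(* An affine bundle whose total space and base need not be Hausdorff or second
   countable. *)
Definition pre_affine E : Prop :=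
  [/\ premfd (tot E), premfd (base E) &
      forall b : base E, exists d k (phi : tot E -> 'rV[R]_k),
        cdom d b /\ affine_triv d phi].

Lemma affine_bundle_pre E : affine_bundle E -> pre_affine E.
Proof. by case=> /manifold_premfd ? /manifold_premfd ? _ ?. Qed.

Lemma triv_fiber E (d : chart R (base E)) k (phi : tot E -> 'rV[R]_k) :
  affine_triv d phi -> fiber_coord (@bproj R E) d phi.
Proof.
move=> [md mt st _]; split=> // x y dx Exy Ep.
apply: (cinjE (mchart_inj mt)) => //=; first by rewrite -Exy.
by rewrite Exy Ep.
Qed.

Section Triv.
Context {E : abun R} (hE : pre_affine E).
Let hT : premfd (tot E). Proof. by case: hE. Qed.
Let hB : premfd (base E). Proof. by case: hE. Qed.

Lemma bproj_smap (e : tot E) : smap (@bproj R E) e.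
Proof.
have [_ _ /(_ (bproj e))[d [k [phi [de [md mt _ _]]]]]] := hE.
have FX := mnear_filter hT e.
have nc := mnear_cdom hT mt de.
exists d; split=> //.
apply: (msat_eq _ (msat_lsubmx hT (msat_cmap hT mt de))) => y.
by rewrite /= row_mxKl.
Qed.

Lemma pre_affine_smooth_bproj : smooth_map (@bproj R E).
Proof. by apply/smooth_mapP => // e; exact: bproj_smap. Qed.

Lemma pre_affine_bundle : manifold (base E) -> affine_bundle E.
Proof.
move=> mB; have [_ _ tE] := hE; split=> //; last exact: pre_affine_smooth_bproj.
apply: (fiber_bundle_manifold hT mB bproj_smap) => b.
have [d [k [phi [db [md mt _ _]]]]] := tE b.
by exists d; eexists; split; [exact: md|exact: db|exact: mt|].
Qed.

Context {d : chart R (base E)} {k : nat} {phi : tot E -> 'rV[R]_k}.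
Hypothesis tphi : affine_triv d phi.

Lemma triv_msat e : cdom d (bproj e) -> msat phi e.
Proof.
have [md mt _ _] := tphi => de.
apply: (msat_eq _ (msat_rsubmx hT (msat_cmap hT mt de))) => y.
by rewrite /= row_mxKr.
Qed.

(* The point over [b] with fibre coordinate [v]. *)
Definition tpt (e0 : tot E) (b : base E) (v : 'rV[R]_k) : tot E :=
  cinv (fchart (@bproj R E) d phi) e0 (row_mx (cmap d b) v).

Lemma tptP e0 b v : cdom d b ->
  bproj (tpt e0 b v) = b /\ phi (tpt e0 b v) = v.
Proof.
have [md mt st _] := tphi => db; have [e [Eb Ev]] := st b v db.
rewrite /tpt -Ev -Eb -[row_mx _ _]/(cmap (fchart (@bproj R E) d phi) e).
by rewrite cinvK//; [exact: mchart_inj mt|rewrite /= Eb].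
Qed.

Lemma smap_tpt Z e0 (b : Z -> base E) (v : Z -> 'rV[R]_k) z : premfd Z ->
  cdom d (b z) -> smap b z -> msat v z -> smap (fun y => tpt e0 (b y) (v y)) z.
Proof.
move=> hZ db sb sv; have [md mt _ _] := tphi.
have [Eb Ev] := tptP e0 (v z) db.
have FZ := mnear_filter hZ z.
have nb := smap_mnear hZ hB sb (mnear_cdom hB md db).
exists (fchart (@bproj R E) d phi); split=> //=; first by rewrite Eb.
  by apply: filterS nb => y /= dy; have [-> _] := tptP e0 (v y) dy.
apply: (msat_ext hZ (f := fun y => row_mx (cmap d (b y)) (v y))).
  by apply: filterS nb => y /= dy; have [-> ->] := tptP e0 (v y) dy.
apply: msat_row_mx => //; apply: (smap_msat hZ hB sb).
exact: msat_cmap.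
Qed.

Lemma triv_smap Z (f : Z -> tot E) z : premfd Z -> cdom d (bproj (f z)) ->
  smap (fun y => bproj (f y)) z -> msat (fun y => phi (f y)) z -> smap f z.
Proof.
move=> hZ dz sb sv; have [md mt _ _] := tphi.
have FZ := mnear_filter hZ z.
have nb := smap_mnear hZ hB sb (mnear_cdom hB md dz).
exists (fchart (@bproj R E) d phi); split=> //=.
apply: msat_row_mx => //; apply: (smap_msat hZ hB sb).
exact: msat_cmap.
Qed.

Lemma triv_eq e e' : cdom d (bproj e) -> bproj e = bproj e' ->
  phi e = phi e' -> e = e'.
Proof. exact: (triv_fiber tphi).1. Qed.

End Triv.
Arguments tpt {E} d {k} phi e0 b v.

(** The new base chart may carry other coordinates than the old one on its smaller domain. This lets
    trivialisations of [A1] and [A2] share one chart of [M]. *)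
Lemma triv_restrict E (d d' : chart R (base E)) k (phi : tot E -> 'rV[R]_k) :
  pre_affine E -> affine_triv d phi -> mchart d' -> cdom d' `<=` cdom d ->
  affine_triv d' phi.
Proof.
move=> hE tphi md' dd'; have [md mt st at_] := tphi; have [hT hB _] := hE.
split=> //.
- apply: mchartI => // [x y /set_mem /= dx /set_mem /= dy|e /= de].
    move=> /eq_row_mx[E1 E2]; apply: (triv_eq tphi) => //; first exact: dd'.
    exact: cinjE (mchart_inj md') dx dy E1.
  have FT := mnear_filter hT e.
  have nb := smap_mnear hT hB (bproj_smap hE e) (mnear_cdom hB md' de).
  split=> //.
    apply: msat_row_mx => //; last exact: (triv_msat hE tphi (dd' _ de)).
    by apply: (smap_msat hT hB (bproj_smap hE e)); exact: msat_cmap.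
  exists (fun u => tpt d phi e (cinv d' (bproj e) (lsubmx u)) (rsubmx u)).
  have hU := premfd_euc (R := R) (cdim d' + k).
  have sl (u : 'rV[R]_(cdim d' + k)) : sat lsubmx u.
    exact: sat_lsubmx (sat_id _).
  split.
    apply: (smap_tpt hE tphi e hU).
    - rewrite row_mxKl cinvx//; exact: dd'.
    - apply: (@smap_comp R (euc (cdim d' + k)) (euc (cdim d')) _ (cinv d' (bproj e))
        lsubmx _ hU (premfd_euc _)).
      + by apply: smap_euc => //; apply/msat_euc.
      + by rewrite row_mxKl; exact: smap_cinv.
    - by apply/msat_euc; exact: sat_rsubmx (sat_id _).
  have : \forall u \near row_mx (cmap d' (bproj e)) (phi e),
      (cmap d' @` cdom d') (lsubmx u).
    by apply: (sat_near (sl _)); rewrite row_mxKl; exact: mchart_open.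
  apply: filterS => u [b d'b Eb].
  rewrite -Eb cinvK//; last exact: mchart_inj.
  have [-> ->] := tptP tphi e (rsubmx u) (dd' _ d'b).
  by rewrite Eb hsubmxK.
- by move=> b v /dd'; exact: st.
- by move=> l e e' /dd'; exact: at_.
Qed.

(** The weight varies with the point: this yields smoothness in the weight for [aff_agree], and in
    the translation vector for [smap_shift]. *)
Lemma smap_aff E Z (l : Z -> R) (f g : Z -> tot E) z :
  pre_affine E -> premfd Z -> msat (fun y => const_mx (l y) : 'rV[R]_1) z ->
  smap f z -> smap g z -> mnear z [set y | bproj (f y) = bproj (g y)] ->
  smap (fun y => aff (l y) (f y) (g y)) z.
Proof.
move=> hE hZ sl sf sg nfg; have [hT hB tE] := hE.
have [d [k [phi [db tphi]]]] := tE (bproj (f z)).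
have [md mt st at_] := tphi.
have FZ := mnear_filter hZ z.
have sbf : smap (fun y => bproj (f y)) z by apply: smap_comp => //; exact: bproj_smap.
have nd := smap_mnear hZ hB sbf (mnear_cdom hB md db).
have fgz := mnear_self nfg.
have nE : mnear z [set y | bproj (aff (l y) (f y) (g y)) = bproj (f y) /\
    phi (aff (l y) (f y) (g y)) = l y *: phi (f y) + (1 - l y) *: phi (g y)].
  by apply: filterS2 nd nfg => y /= dy fgy; apply: at_.
apply: (triv_smap hE tphi) => //.
- by rewrite (mnear_self nE).1.
- apply: (smap_ext hZ _ sbf); apply: filterS nE => y /= [-> _]; exact: erefl.
- apply: (msat_ext hZ (f := fun y =>
    (const_mx (l y) : 'rV[R]_1) ord0 ord0 *: phi (f y) +
    (1 - (const_mx (l y) : 'rV[R]_1) ord0 ord0) *: phi (g y))).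
    by apply: filterS nE => y /= [_ ->]; rewrite mxE.
  have sphif : msat (fun y => phi (f y)) z.
    by apply: (smap_msat hZ hT sf); exact: (triv_msat hE tphi).
  have sphig : msat (fun y => phi (g y)) z.
    by apply: (smap_msat hZ hT sg); apply: (triv_msat hE tphi); rewrite -fgz.
  apply: msatD => //.
    apply: (msat_lift2 hZ _ sl sphif) => n h u sl' sf'.
    by apply: sat_scale => //; exact: sat_entry.
  apply: (msat_lift2 hZ _ sl sphig) => n h u sl' sg'.
  apply: sat_scale => //; apply: (@satD _ _ R); first exact: sat_cst.
  have := satM (@sat_cst _ _ R (-1) u) (sat_entry ord0 ord0 sl').
  by apply: sat_eq => y; rewrite mulN1r.
Qed.

Lemma smooth_aff_fibprod E (l : R) : pre_affine E ->
  smooth_map (fun xy : fibprod E => aff l (val xy).1 (val xy).2).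
Proof.
move=> hE; have [hT hB tE] := hE.
have hP := premfd_prod hT hT.
apply: (smooth_map_sub hP) => // s.
have [d [k [phi [db tphi]]]] := tE (bproj (val s).1).
have [md mt st at_] := tphi.
have sE : bproj (val s).1 = bproj (val s).2 := sub_mfdP s.
have s1 := @smap_fst _ _ _ (val s) hT hT.
have s2 := @smap_snd _ _ _ (val s) hT hT.
have sb : smap (fun z : prod_mfd (tot E) (tot E) => bproj z.1) (val s).
  by apply: (smap_comp hP hT s1); exact: bproj_smap.
have FP := mnear_filter hP (val s).
exists (fchart (@bproj R E) d phi), (fun z => row_mx (cmap d (bproj z.1))
  (l *: phi z.1 + (1 - l) *: phi z.2)).
split=> //.
- apply: msat_row_mx => //.
    by apply: (smap_msat hP hB sb); exact: msat_cmap.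
  have p1 : msat (fun z : prod_mfd (tot E) (tot E) => phi z.1) (val s).
    by apply: (smap_msat hP hT s1); exact: (triv_msat hE tphi).
  have p2 : msat (fun z : prod_mfd (tot E) (tot E) => phi z.2) (val s).
    by apply: (smap_msat hP hT s2); apply: (triv_msat hE tphi); rewrite -sE.
  apply: (msat_lift2 hP _ p1 p2) => n h u f1 f2.
  by apply: satD; apply: sat_scale => //; exact: sat_cst.
- have := smap_mnear hP hB sb (mnear_cdom hB md db).
  apply: filterS => z /= dz t tz.
  have tE' : bproj (val t).1 = bproj (val t).2 := sub_mfdP (t : fibprod E).
  rewrite -tz in dz *.
  by have [-> ->] := at_ l _ _ dz (esym tE').
Qed.

End AffineBundles.
Arguments tpt {R E} d {k} phi e0 b v.

(** * Vector hulls and affine duals *)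

Section HullAlgebra.
Context {R : realType}.
Implicit Types (E : abun R) (V : lmodType R).

Definition aff_on E V (b : base E) (f : tot E -> V) : Prop :=
  forall l e e', bproj e = b -> bproj e' = b ->
    f (aff l e e') = l *: f e + (1 - l) *: f e'.

(** The fibrewise content of [affine_triv]: the fibre is an affine space with global coordinates
    [phi]. The algebra of hulls is done at this level. *)
Definition aff_chart E (b : base E) k (phi : tot E -> 'rV[R]_k) : Prop :=
  [/\ forall l e e', bproj e = b -> bproj e' = b -> bproj (aff l e e') = b,
      aff_on b phi,
      forall e e', bproj e = b -> bproj e' = b -> phi e = phi e' -> e = e' &
      forall v, exists e, bproj e = b /\ phi e = v].

Lemma triv_aff_chart E (d : chart R (base E)) k (phi : tot E -> 'rV[R]_k) b :
  affine_triv d phi -> cdom d b -> aff_chart b phi.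
Proof.
move=> tphi db; have [md mt st at_] := tphi; split.
- move=> l e e' Ee Ee'; have [|->//] := at_ l e e' _ (etrans Ee' (esym Ee)).
  by rewrite Ee.
- by move=> l e e' Ee Ee'; have [|//] := at_ l e e' _ (etrans Ee' (esym Ee));
    rewrite ?Ee.
- by move=> e e' Ee Ee'; apply: (triv_eq tphi); rewrite ?Ee ?Ee'.
- by move=> v; exact: st.
Qed.

Lemma aff_on_cst E V b (a : V) : aff_on (E := E) b (fun=> a).
Proof. by move=> l e e' _ _; rewrite -scalerDl addrC subrK scale1r. Qed.

Definition wsum E V (f : tot E -> V) (w : seq (R * tot E)) : V :=
  \sum_(re <- w) re.1 *: f re.2.

Definition weight E (w : seq (R * tot E)) : R := \sum_(re <- w) re.1.

Lemma wsum_cat E V (f : tot E -> V) w w' : wsum f (w ++ w') = wsum f w + wsum f w'.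
Proof. by rewrite /wsum big_cat. Qed.

Lemma wsum1 E V (f : tot E -> V) r e : wsum f [:: (r, e)] = r *: f e.
Proof. by rewrite /wsum big_seq1. Qed.

Lemma wsum2 E V (f : tot E -> V) r e r' e' :
  wsum f [:: (r, e); (r', e')] = r *: f e + r' *: f e'.
Proof. by rewrite /wsum big_cons big_seq1. Qed.

Lemma weight_cat E (w w' : seq (R * tot E)) :
  weight (w ++ w') = weight w + weight w'.
Proof. by rewrite /weight big_cat. Qed.

Lemma wsum_cst E V (a : V) (w : seq (R * tot E)) :
  wsum (fun=> a) w = weight w *: a.
Proof. by rewrite /wsum /weight scaler_suml. Qed.

Lemma hull_eq_wsum E V b (f : tot E -> V) w w' :
  aff_on b f -> hull_eq b w w' -> wsum f w = wsum f w'.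
Proof.
move=> af; elim=> //=.
- by move=> ? ? ? _ -> _ ->.
- by move=> ? ? ? ? _ E1 _ E2; rewrite !wsum_cat E1 E2.
- by move=> ? ?; rewrite !wsum_cat addrC.
- by move=> e; rewrite wsum1 scale0r /wsum big_nil.
- by move=> r s e; rewrite wsum1 wsum2 scalerDl.
- by move=> r l e e' Ee Ee'; rewrite wsum1 wsum2 af// scalerDr !scalerA.
Qed.

Section Fiber.
Context {E : abun R} {b : base E} {k : nat} {phi : tot E -> 'rV[R]_k}.
Hypothesis cphi : aff_chart b phi.
Local Notation "w ~~> w'" := (hull_eq b w w') (at level 70).

(** With [e0] as origin, [e1] is the affine combination r e + (1 - r) e0; the multiple of the origin
    is moved to the other side. *)
Lemma hull_eq_zero_pt e1 e0 r : bproj e1 = b -> bproj e0 = b -> phi e0 = 0 ->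
  forall e, bproj e = b -> phi e1 = r *: phi e ->
  [:: (r, e)] ~~> [:: (1, e1); (r - 1, e0)].
Proof.
have [cl af ip _] := cphi.
move=> Ee1 Ee0 p0 e Ee Ep.
have -> : e1 = aff r e e0.
  by apply: ip => //; [exact: cl|rewrite af// p0 scaler0 addr0].
apply: hull_sym.
apply: hull_trans (hull_cat (hull_aff 1 r Ee Ee0) (hull_refl b [:: (r - 1, e0)])) _.
rewrite !mul1r.
apply: hull_trans (hull_cat (hull_refl b [:: (r, e)]) (hull_addr b (1 - r) (r - 1) e0)) _.
rewrite addrA subrK subrr.
exact: (hull_cat (hull_refl b [:: (r, e)]) (hull_zero b e0)).
Qed.

(** The pairs (u, v) and (w, e0) have the same midpoint, and twice a midpoint is the sum of the end
    points. *)
Lemma hull_eq_sum_pt u v w e0 : bproj u = b -> bproj v = b -> bproj w = b ->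
  bproj e0 = b -> phi e0 = 0 -> phi w = phi u + phi v ->
  [:: (1, u); (1, v)] ~~> [:: (1, w); (1, e0)].
Proof.
have [cl af ip _] := cphi.
move=> Eu Ev Ew Ee0 p0 Ep.
have h2 : 2 * 2^-1 = 1 :> R by rewrite divff.
have h2' : 2 * (1 - 2^-1) = 1 :> R by rewrite mulrBr mulr1 h2 -[X in X - _]/(1+1) addrK.
have := hull_aff 2 2^-1 Ew Ee0; have := hull_aff 2 2^-1 Eu Ev.
rewrite h2 h2'.
have -> : aff 2^-1 u v = aff 2^-1 w e0.
  apply: ip; [exact: cl|exact: cl|rewrite !af// p0 Ep scaler0 addr0 scalerDr].
  by congr (_ + _ *: _); apply: (mulfI (x := 2)) => //; rewrite h2 h2'.
by move=> H1 H2; apply: hull_trans (hull_sym H1) H2.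
Qed.

(** By induction each term is brought to weight 1 and two such points are merged into one, the
    surplus weight going to the origin [e0]. Thus a hull vector is known from one point coordinate
    and its weight. *)
Lemma hull_normal_form w e1 e0 : in_fiber b w -> bproj e1 = b -> bproj e0 = b ->
  phi e0 = 0 -> phi e1 = wsum phi w ->
  w ~~> [:: (1, e1); (weight w - 1, e0)].
Proof.
have [cl af ip sp] := cphi; move=> + + Ee0 p0.
elim: w e1 => [|[r e] w IH] e1 /=.
  move=> _ Ee1; rewrite /weight /wsum !big_nil => E1.
  have -> : e1 = e0 by apply: ip => //; rewrite E1.
  apply: hull_sym; apply: hull_trans (hull_addr b 1 (0 - 1) e0) _.
  by rewrite sub0r subrr; exact: hull_zero.
move=> /andP[/asboolP Ee fw] Ee1.
rewrite -cat1s wsum_cat wsum1 weight_cat [weight [:: _]]big_seq1 /= => E1.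
have [v [Ev pv]] := sp (wsum phi w); have [u [Eu pu]] := sp (r *: phi e).
have H1 := hull_eq_zero_pt Eu Ee0 p0 Ee pu.
have H2 := IH v fw Ev pv.
apply: hull_trans (hull_cat H1 H2) _.
have H3 : [:: (1, u); (1, v)] ~~> [:: (1, e1); (1, e0)].
  by apply: hull_eq_sum_pt => //; rewrite E1 pu pv.
apply: (@hull_trans _ _ _ _
  ([:: (1, u); (1, v)] ++ [:: (r - 1, e0); (weight w - 1, e0)])).
  apply: (hull_cat (hull_refl b [:: (1, u)])
    (hull_cat (hull_catC b [:: (r - 1, e0)] [:: (1, v)])
      (hull_refl b [:: (weight w - 1, e0)]))).
apply: hull_trans (hull_cat H3 (hull_addr b (r - 1) (weight w - 1) e0)) _.
have -> : r + weight w - 1 = 1 + (r - 1 + (weight w - 1)).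
  by ring.
exact: (hull_cat (hull_refl b [:: (1, e1)]) (hull_addr b 1 _ e0)).
Qed.

Lemma hull_eq_coord w w' : in_fiber b w -> in_fiber b w' ->
  wsum phi w = wsum phi w' -> weight w = weight w' -> w ~~> w'.
Proof.
have [_ _ _ sp] := cphi; move=> fw fw' Ep Ew.
have [e1 [Ee1 p1]] := sp (wsum phi w); have [e0 [Ee0 p0]] := sp 0.
apply: hull_trans (hull_normal_form fw Ee1 Ee0 p0 p1) _.
apply: hull_sym; rewrite Ew.
by apply: hull_normal_form => //; rewrite -Ep.
Qed.

Lemma aff_on_coord V (f : tot E -> V) (e0 : tot E) (ej : 'I_k -> tot E) e :
  aff_on b f -> bproj e = b -> bproj e0 = b -> phi e0 = 0 ->
  (forall j, bproj (ej j) = b /\ phi (ej j) = delta_mx ord0 j) ->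
  f e = f e0 + \sum_j phi e ord0 j *: (f (ej j) - f e0).
Proof.
move=> af Ee Ee0 p0 Hj.
(* The point [e] as an affine combination of the frame; the coefficient of [e0] makes the total
   weight 1. *)
pose w := (1 - \sum_j phi e ord0 j, e0) ::
  [seq (phi e ord0 j, ej j) | j <- enum 'I_k].
have H : [:: (1, e)] ~~> w.
  apply: hull_eq_coord; rewrite /w /in_fiber /= ?Ee ?Ee0 ?asboolT//.
  - by rewrite all_map; apply/allP => j _ /=; rewrite asboolT//; have [] := Hj j.
  - rewrite wsum1 scale1r /wsum big_cons p0 scaler0 add0r big_map big_enum /=.
    rewrite {1}[phi e]row_sum_delta; apply: eq_bigr => j _.
    by have [_ ->] := Hj j.
  - by rewrite /weight big_seq1 big_cons big_map big_enum /= subrK.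
have := hull_eq_wsum af H; rewrite wsum1 scale1r => ->.
rewrite /wsum big_cons big_map big_enum /= scalerBl scale1r -addrA; congr (_ + _).
rewrite scaler_suml -sumrN -big_split /=; apply: eq_bigr => j _.
by rewrite scalerBr addrC.
Qed.

End Fiber.

Section HullRecords.
Context {E : abun R}.
Implicit Types (h : hull E) (b : base E) (w : seq (R * tot E)).

Lemma hull_recP h h' : hproj h = hproj h' -> hclass h = hclass h' -> h = h'.
Proof.
case: h h' => [b c p] [b' c' p'] /= Eb Ec; subst b' c'.
by congr Hull; exact: Prop_irrelevance.
Qed.

Lemma hrepP h : hclass h (hrep h).
Proof.
rewrite /hrep; case: xgetP => // H.
have [w fw Ew] := hullP h.
by case: (H w); rewrite Ew; split=> //; exact: hull_refl.
Qed.

Lemma hrep_fiber h : in_fiber (hproj h) (hrep h).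
Proof.
by have := hrepP h; have [w fw ->] := hullP h => -[].
Qed.

Lemma filter_fiber b w : in_fiber b w -> [seq re <- w | `[< bproj re.2 = b >]] = w.
Proof. exact: all_filterP. Qed.

Lemma hmk_eq b w w' : in_fiber b w -> in_fiber b w' -> hull_eq b w w' ->
  hmk b w = hmk b w'.
Proof.
move=> fw fw' ww'; apply: hull_recP => //=; rewrite !filter_fiber//.
apply/seteqP; split=> w'' [fw'' H]; split=> //.
  exact: hull_trans (hull_sym ww') H.
exact: hull_trans ww' H.
Qed.

Lemma hmk_hrep h : hmk (hproj h) (hrep h) = h.
Proof.
apply: hull_recP => //=; rewrite filter_fiber ?hrep_fiber//.
have := hrepP h; have [w fw ->] := hullP h => -[fh wh].
apply/seteqP; split=> w'' [fw'' H]; split=> //; first exact: hull_trans wh H.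
exact: hull_trans (hull_sym wh) H.
Qed.

Lemma hrep_hmk b w : in_fiber b w -> hull_eq b w (hrep (hmk b w)).
Proof. by move=> fw; have [_] := hrepP (hmk b w); rewrite /= filter_fiber. Qed.

Lemma hext_hmk V b (f : tot E -> V) w :
  aff_on b f -> in_fiber b w -> hext f (hmk b w) = wsum f w.
Proof. by move=> af fw; rewrite (hull_eq_wsum af (hrep_hmk fw)). Qed.

Lemma hext_hadd V (f : tot E -> V) h h' : aff_on (hproj h) f ->
  hproj h' = hproj h -> hext f (hadd h h') = hext f h + hext f h'.
Proof.
move=> af Eh; rewrite hext_hmk ?wsum_cat// /in_fiber all_cat.
by rewrite [X in X && _]hrep_fiber -Eh [X in _ && X]hrep_fiber.
Qed.

Lemma hext_hscale V (f : tot E -> V) r h : aff_on (hproj h) f ->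
  hext f (hscale r h) = r *: hext f h.
Proof.
move=> af; rewrite hext_hmk//; last first.
  by rewrite /in_fiber all_map; exact: (hrep_fiber h).
by rewrite /wsum big_map /hext scaler_sumr; apply: eq_bigr => re _; rewrite scalerA.
Qed.

Lemma hext_hzero V (f : tot E -> V) b : aff_on b f -> hext f (hzero b) = 0.
Proof. by move=> af; rewrite hext_hmk// /wsum big_nil. Qed.

Lemma hext_hpt V (f : tot E -> V) e : aff_on (bproj e) f -> hext f (hpt e) = f e.
Proof. by move=> af; rewrite hext_hmk ?wsum1 ?scale1r//= asboolT. Qed.

Lemma hext_hsub V (f : tot E -> V) h h' : aff_on (hproj h) f ->
  hproj h' = hproj h -> hext f (hsub h h') = hext f h - hext f h'.
Proof.
move=> af Eh; rewrite hext_hadd// hext_hscale ?Eh//.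
by rewrite scaleN1r.
Qed.

(** The canonical linear function of the hull, 1 on points and 0 on the model space, valued in rows
    of length 1 to be a coordinate block of [hull_mfd]. *)
Definition hwt h : 'rV[R]_1 := hext (fun=> const_mx 1) h.

Lemma hwtE h : hwt h = const_mx (weight (hrep h)).
Proof.
rewrite /hwt [LHS]wsum_cst; apply/rowP => i; rewrite !mxE mulr1.
by [].
Qed.

Context {b : base E} {k : nat} {phi : tot E -> 'rV[R]_k}.
Hypothesis cphi : aff_chart b phi.

Lemma hull_inj h h' : hproj h = b -> hproj h' = b ->
  hext phi h = hext phi h' -> hwt h = hwt h' -> h = h'.
Proof.
move=> Eh Eh' Ep; rewrite !hwtE => /matrixP/(_ ord0 ord0); rewrite !mxE => Ew.
rewrite -(hmk_hrep h) -(hmk_hrep h') Eh Eh'.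
have [fh fh'] := (hrep_fiber h, hrep_fiber h'); rewrite Eh in fh; rewrite Eh' in fh'.
by apply: hmk_eq => //; exact: hull_eq_coord cphi _ _ fh fh' Ep Ew.
Qed.

Lemma hull_surj v (s : 'rV[R]_1) :
  exists h, [/\ hproj h = b, hext phi h = v & hwt h = s].
Proof.
have [_ af _ sp] := cphi.
have [e1 [Ee1 p1]] := sp v; have [e0 [Ee0 p0]] := sp 0.
exists (hmk b [:: (1, e1); (s ord0 ord0 - 1, e0)]).
have fw : in_fiber b [:: (1, e1); (s ord0 ord0 - 1, e0)].
  by rewrite /= Ee1 Ee0 asboolT.
split=> //; first by rewrite hext_hmk// wsum2 p1 p0 scaler0 addr0 scale1r.
rewrite /hwt hext_hmk//; last exact: aff_on_cst.
rewrite wsum2 -scalerDl addrC subrK.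
by apply/rowP => i; rewrite !mxE mulr1 (ord1 i).
Qed.

(** An affine function is evaluated on the normal form; with another fibre coordinate for [f] this
    is the transition law of the hull. *)
Lemma hext_coord V (f : tot E -> V) h e1 e0 : aff_on b f -> hproj h = b ->
  bproj e1 = b -> bproj e0 = b -> phi e0 = 0 -> phi e1 = hext phi h ->
  hext f h = f e1 + (hwt h ord0 ord0 - 1) *: f e0.
Proof.
move=> af Eh Ee1 Ee0 p0 p1; have fh := hrep_fiber h; rewrite Eh in fh.
have := hull_normal_form cphi fh Ee1 Ee0 p0 p1.
by move=> /(hull_eq_wsum af); rewrite wsum2 scale1r hwtE mxE.
Qed.

End HullRecords.

Lemma hext_hmap (E E' : abun R) V (F : tot E -> tot E') (F0 : base E -> base E')
    (f : tot E' -> V) (h : hull E) :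
  (forall e, bproj e = hproj h -> bproj (F e) = F0 (hproj h)) ->
  aff_on (F0 (hproj h)) f -> hext f (hmap F F0 h) = hext (fun e => f (F e)) h.
Proof.
move=> FF af; rewrite hext_hmk//; first by rewrite /wsum big_map.
rewrite /in_fiber all_map; have := hrep_fiber h; apply: sub_all => re /=.
by move=> /asboolP /FF ?; exact/asboolP.
Qed.

End HullAlgebra.

(** * Manifold structures on hulls and affine duals *)

Section HullDaggerManifolds.
Context {R : realType}.
Implicit Types (E : abun R) (V : lmodType R) (Z : mfd R).

Lemma msat_transition E Z (d d' : chart R (base E)) k k'
    (phi : tot E -> 'rV[R]_k) (phi' : tot E -> 'rV[R]_k') e0
    (b : Z -> base E) (v : Z -> 'rV[R]_k) z :
  pre_affine E -> premfd Z -> affine_triv d phi -> affine_triv d' phi' ->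
  cdom d (b z) -> cdom d' (b z) -> smap b z -> msat v z ->
  msat (fun y => phi' (tpt d phi e0 (b y) (v y))) z.
Proof.
move=> hE hZ tphi tphi' db db' sb sv; have [hT _ _] := hE.
have st := smap_tpt hE tphi e0 hZ db sb sv.
apply: (smap_msat hZ hT st); apply: (triv_msat hE tphi').
by have [-> _] := tptP tphi e0 (v z) db.
Qed.

Section Hull.
Context {E : abun R} (hE : pre_affine E).
Let hT : premfd (tot E). Proof. by case: hE. Qed.
Let hB : premfd (base E). Proof. by case: hE. Qed.

Definition hcoord k (phi : tot E -> 'rV[R]_k) (h : hull_mfd E) : 'rV[R]_(k + 1) :=
  row_mx (hext phi h) (hwt h).

(** An inductive family, so that case analysis also identifies the dependent length of the fibre
    coordinate with k + 1. *)
Inductive hull_atlas :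
    forall (d : chart R (base E)) N, (hull_mfd E -> 'rV[R]_N) -> Prop :=
  HullAtlas d k phi of @affine_triv R E d k phi : @hull_atlas d (k + 1) (hcoord phi).

Lemma hull_fiber_coord (d : chart R (base E)) k (phi : tot E -> 'rV[R]_k) :
  affine_triv d phi -> fiber_coord (@hproj R E : hull_mfd E -> base E) d (hcoord phi).
Proof.
move=> tphi; split=> [h h' dh Eh|b v db].
  move=> /eq_row_mx[Ep Ew].
  by apply: (hull_inj (triv_aff_chart tphi dh)) => //; rewrite -Eh.
have [h [Eh Ep Ew]] := hull_surj (triv_aff_chart tphi db) (lsubmx v) (rsubmx v).
by exists h; split=> //; rewrite /hcoord Ep Ew hsubmxK.
Qed.

Lemma premfd_hull : premfd (hull_mfd E).
Proof.
have [_ _ tE] := hE.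
apply: (premfd_fiber (p := @hproj R E : hull_mfd E -> base E) (Q := hull_atlas) hB).
- move=> c; split=> [[d [k [phi [tphi ->]]]]|[d [N [psi [[]]]]]].
    by exists d, (k + 1)%N, (hcoord phi); split.
  by move=> {}d k phi tphi ->; exists d, k, phi.
- by move=> d N psi [{}d k phi tphi]; split; [case: tphi|exact: hull_fiber_coord].
- move=> b; have [d [k [phi [db tphi]]]] := tE b.
  by exists d, (k + 1)%N, (hcoord phi).
move=> d N psi d' N' psi' h q q'; case: q => {}d k phi tphi.
case: q' => {}d' k' phi' tphi' dh dh'.
have [md mt st _] := tphi; have [e0 [Ee0 _]] := st _ 0 dh.
pose b (u : 'rV[R]_(cdim d + (k + 1))) := cinv d (hproj h) (lsubmx u).
pose T u v := phi' (tpt d phi e0 (b u) v).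
(* The vector with coordinates (v, s) is the point v plus s - 1 times the point with coordinate 0;
   the fibre transition [T] is applied to both points. *)
exists d, (fun u => row_mx (T u (lsubmx (rsubmx u)) +
  (rsubmx (rsubmx u) ord0 ord0 - 1) *: T u 0) (rsubmx (rsubmx u))).
set u0 := row_mx _ _.
have Eb : b u0 = hproj h by rewrite /b row_mxKl cinvx.
have hU := premfd_euc (R := R) (cdim d + (k + 1)).
have sb : @smap R (euc _) _ b u0.
  apply: (smap_cinv_comp _ hB hU md dh); last by rewrite row_mxKl.
  by apply/msat_euc; exact: sat_lsubmx (sat_id _).
have sT (v : 'rV[R]_(cdim d + (k + 1)) -> 'rV[R]_k) : sat v u0 ->
    sat (fun u => T u (v u)) u0.
  move=> sv; apply/(@msat_euc R).
  apply: (msat_transition e0 hE hU tphi tphi'); rewrite ?Eb//.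
  exact/(@msat_euc R).
have s2 : sat (fun u : 'rV[R]_(cdim d + (k + 1)) => rsubmx (rsubmx u)) u0.
  exact: sat_rsubmx (sat_rsubmx (sat_id _)).
split=> //.
  apply: sat_row_mx => //; apply: satD.
    by apply: sT; exact: sat_lsubmx (sat_rsubmx (sat_id _)).
  apply: sat_scale; last by apply: sT; exact: sat_cst.
  by apply: (@satD _ _ R); [exact: sat_entry|exact: sat_cst].
have FB := mnear_filter hB (hproj h).
apply: filterS2 (mnear_cdom hB md dh) (mnear_cdom hB _ dh'); last by case: tphi'.
move=> b1 db db' h1 Eh1.
rewrite !row_mxKr /hcoord !row_mxKl; congr row_mx.
have Eb1 : b (row_mx (cmap d b1) (row_mx (hext phi h1) (hwt h1))) = b1.
  by rewrite /b row_mxKl cinvK//; exact: mchart_inj.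
have [tb tp] := tptP tphi e0 (hext phi h1) db.
have [tb0 tp0] := tptP tphi e0 0 db.
rewrite /T Eb1 [LHS](@hext_coord R E b1 k phi _ _ _ h1 (tpt d phi e0 b1 (hext phi h1)) (tpt d phi e0 b1 0)) ?row_mxKr//.
  exact: triv_aff_chart tphi db.
by have [_] := triv_aff_chart tphi' db'.
Qed.

Lemma hull_mchart (d : chart R (base E)) k (phi : tot E -> 'rV[R]_k) :
  affine_triv d phi ->
  mchart (fchart (@hproj R E : hull_mfd E -> base E) d (hcoord phi)).
Proof. by move=> tphi; apply: (atlas_mchart premfd_hull); exists d, k, phi. Qed.

End Hull.

Section Dagger.
Context {E : abun R}.

Lemma dagger_ext (f g : dagger_type E) : dpt f = dpt g ->
  (forall e, bproj e = dpt f -> dfun f e = dfun g e) -> f = g.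
Proof.
rewrite /dpt /dfun => Ep Ef; apply: val_inj.
have := set_valP f; have := set_valP g.
case: (val f) (val g) Ep Ef => [b F] [b' F'] /= -> Ef [_ /= z'] [_ /= z].
congr (_, _); apply/funext => e.
by have [Ee|ne] := pselect (bproj e = b'); [exact: Ef|rewrite z// z'].
Qed.

Lemma dfun_aff (f : dagger_type E) : aff_on (V := R^o) (dpt f) (dfun f).
Proof. by have [+ _] := set_valP f => af l e e' Ee Ee'; exact: af. Qed.

Lemma dfun0 (f : dagger_type E) e : bproj e <> dpt f -> dfun f e = 0.
Proof. by have [_ +] := set_valP f; exact. Qed.

Lemma dagger_mk (b : base E) (g : tot E -> R) :
  (forall l e e', bproj e = b -> bproj e' = b -> bproj (aff l e e') = b) ->
  aff_on (V := R^o) b g ->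
  exists f : dagger_type E, dpt f = b /\ forall e, bproj e = b -> dfun f e = g e.
Proof.
move=> cl ag.
pose F e := if `[< bproj e = b >] then g e else 0.
have FE e : bproj e = b -> F e = g e by move=> Ee; rewrite /F asboolT.
have P : dagger_pred (b, F).
  split=> /= [l e e' Ee Ee'|e ne]; last by rewrite /F asboolF.
  by rewrite !FE//; [exact: ag|exact: cl].
by exists (exist _ (b, F) (mem_set P)).
Qed.

Definition dagger_coef (d : chart R (base E)) k (phi : tot E -> 'rV[R]_k)
    (a0 : dagger_type E -> R) (a : dagger_type E -> 'rV[R]_k) : Prop :=
  forall f, cdom d (dpt f) -> forall e, bproj e = dpt f ->
    dfun f e = a0 f + \sum_j a f ord0 j * phi e ord0 j.

Section Coef.
Context {d : chart R (base E)} {k : nat} {phi : tot E -> 'rV[R]_k}.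
Hypothesis tphi : affine_triv d phi.

(** The constant term is the value at the origin of a frame, the slopes are the differences to its
    unit points. Off the chart domain the pair (0, 0) is a dummy. *)
Lemma dagger_coef_ex : exists a0 a, dagger_coef d phi a0 a.
Proof.
have [md mt st _] := tphi.
have H (f : dagger_type E) : exists c : R * 'rV[R]_k, cdom d (dpt f) ->
    forall e, bproj e = dpt f -> dfun f e = c.1 + \sum_j c.2 ord0 j * phi e ord0 j.
  have [df|ndf] := pselect (cdom d (dpt f)); last by exists (0, 0).
  have [e0 [Ee0 p0]] := st _ 0 df.
  have [ej Hj] := choice (fun j : 'I_k => st _ (delta_mx ord0 j) df).
  exists (dfun f e0, \row_j (dfun f (ej j) - dfun f e0)) => _ e Ee /=.
  rewrite (aff_on_coord (triv_aff_chart tphi df) (@dfun_aff f) Ee Ee0 p0 Hj).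
  by congr (_ + _); apply: eq_bigr => j _; rewrite mxE mulrC.
have [c Hc] := choice H.
by exists (fun f => (c f).1), (fun f => (c f).2) => f df; exact: Hc.
Qed.

Context {a0 : dagger_type E -> R} {a : dagger_type E -> 'rV[R]_k}.
Hypothesis Ha : dagger_coef d phi a0 a.

Lemma dagger_coef0 f e0 : cdom d (dpt f) -> bproj e0 = dpt f -> phi e0 = 0 ->
  dfun f e0 = a0 f.
Proof.
move=> df Ee0 p0; rewrite (Ha df Ee0) p0 big1 ?addr0// => j _.
by rewrite mxE mulr0.
Qed.

Lemma dagger_coefj f e j : cdom d (dpt f) -> bproj e = dpt f ->
  phi e = delta_mx ord0 j -> dfun f e = a0 f + a f ord0 j.
Proof.
move=> df Ee pj; rewrite (Ha df Ee) pj (bigD1 j)//= !mxE !eqxx mulr1.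
rewrite big1 ?addr0// => i ij.
by rewrite mxE (negbTE ij) andbF mulr0.
Qed.

Lemma dagger_coef_uniq f c0 (c : 'rV[R]_k) : cdom d (dpt f) ->
  (forall e, bproj e = dpt f -> dfun f e = c0 + \sum_j c ord0 j * phi e ord0 j) ->
  a0 f = c0 /\ a f = c.
Proof.
move=> df Hc; have [md mt st _] := tphi.
have [e0 [Ee0 p0]] := st _ 0 df.
have E0 : a0 f = c0.
  rewrite -(dagger_coef0 df Ee0 p0) Hc// p0 big1 ?addr0// => j _.
  by rewrite mxE mulr0.
split=> //; apply/rowP => j; have [e [Ee pj]] := st _ (delta_mx ord0 j) df.
have := dagger_coefj df Ee pj; rewrite Hc// E0 => /addrI <-.
rewrite pj (bigD1 j)//= !mxE !eqxx mulr1 big1 ?addr0// => i ij.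
by rewrite mxE (negbTE ij) andbF mulr0.
Qed.

Lemma dagger_surj b c0 (c : 'rV[R]_k) : cdom d b ->
  exists f, [/\ dpt f = b, a0 f = c0 & a f = c].
Proof.
move=> db; have [cl af _ _] := triv_aff_chart tphi db.
have ag : aff_on (V := R^o) b
    (fun e => c0 + \sum_j c ord0 j * phi e ord0 j : R^o).
  move=> l e e' Ee Ee'; rewrite af//.
  rewrite /GRing.scale /=.
  have -> : \sum_j c ord0 j * (l *: phi e + (1 - l) *: phi e') ord0 j =
      l * (\sum_j c ord0 j * phi e ord0 j) +
      (1 - l) * (\sum_j c ord0 j * phi e' ord0 j).
    rewrite !mulr_sumr -big_split /=; apply: eq_bigr => j _.
    by rewrite !mxE; ring.
  by ring.
have [f [Ef Hf]] := dagger_mk cl ag; exists f.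
have df : cdom d (dpt f) by rewrite Ef.
have [] := @dagger_coef_uniq f c0 c df; last by split.
by move=> e; rewrite Ef => /Hf.
Qed.

Lemma dagger_inj f g : cdom d (dpt f) -> dpt f = dpt g -> a0 f = a0 g ->
  a f = a g -> f = g.
Proof.
move=> df Efg E0 Ea; apply: dagger_ext => // e Ee.
by rewrite (Ha df Ee) (@Ha g) -?Efg// E0 Ea.
Qed.

End Coef.

Definition dcoord k (a0 : dagger_type E -> R) (a : dagger_type E -> 'rV[R]_k)
    (f : dagger E) : 'rV[R]_(1 + k) := row_mx (const_mx (a0 f)) (a f).

Inductive dagger_atlas :
    forall (d : chart R (base E)) N, (dagger E -> 'rV[R]_N) -> Prop :=
  DaggerAtlas d k phi a0 a of @affine_triv R E d k phi & dagger_coef d phi a0 a :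
    @dagger_atlas d (1 + k) (dcoord a0 a).

Lemma dagger_fiber_coord (d : chart R (base E)) k (phi : tot E -> 'rV[R]_k) a0 a :
  affine_triv d phi -> dagger_coef d phi a0 a ->
  fiber_coord (@dpt R E : dagger E -> base E) d (dcoord a0 a).
Proof.
move=> tphi Ha; split=> [f g df Efg /eq_row_mx[/matrixP/(_ ord0 ord0)]|b v db].
  by rewrite !mxE; exact: dagger_inj Ha _ _ df Efg.
have [f [Ef E0 Ea]] := dagger_surj tphi Ha (lsubmx v ord0 ord0) (rsubmx v) db.
exists f; split=> //; rewrite /dcoord E0 Ea -[RHS]hsubmxK; congr row_mx.
by apply/rowP => i; rewrite mxE (ord1 i).
Qed.

Lemma premfd_dagger : pre_affine E -> premfd (dagger E).
Proof.
move=> hE; have [hT hB tE] := hE.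
apply: (premfd_fiber (p := @dpt R E : dagger E -> base E) (Q := dagger_atlas) hB).
- move=> c; split=> [[d [k [phi [a0 [a [tphi Ha ->]]]]]]|[d [N [psi [[]]]]]].
    by exists d, (1 + k)%N, (dcoord a0 a); split=> //; exists phi.
  by move=> {}d k phi a0 a tphi Ha ->; exists d, k, phi, a0, a.
- move=> d N psi [{}d k phi a0 a tphi Ha]; split; first by case: tphi.
  exact: dagger_fiber_coord tphi Ha.
- move=> b; have [d [k [phi [db tphi]]]] := tE b.
  have [a0 [a Ha]] := dagger_coef_ex tphi.
  by exists d, (1 + k)%N, (dcoord a0 a); split=> //; exists phi.
move=> d N psi d' N' psi' f q q'; case: q => {}d k phi a0 a tphi Ha.
case: q' => {}d' k' phi' a0' a' tphi' Ha' df df'.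
have [md' _ st' _] := tphi'; have [e0 [Ee0 _]] := st' _ 0 df'.
have [md _ _ _] := tphi.
pose b (u : 'rV[R]_(cdim d' + (1 + k))) := cinv d' (dpt f) (lsubmx u).
pose T u v := phi (tpt d' phi' e0 (b u) v).
pose c0 (u : 'rV[R]_(cdim d' + (1 + k))) := lsubmx (rsubmx u) ord0 ord0.
pose c (u : 'rV[R]_(cdim d' + (1 + k))) := rsubmx (rsubmx u).
(* The new coefficients are values at the frame points of [phi'], whose old coordinates are [T u 0]
   and [T u (delta_mx ord0 i)]. These points come from the trivialisation over [d'], hence the
   choice of base chart. *)
exists d', (fun u => row_mx (const_mx (c0 u + \sum_j c u ord0 j * T u 0 ord0 j))
  (\row_i \sum_j c u ord0 j * (T u (delta_mx ord0 i) - T u 0) ord0 j)).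
set u0 := row_mx _ _.
have Eb : b u0 = dpt f by rewrite /b row_mxKl cinvx.
have hU := premfd_euc (R := R) (cdim d' + (1 + k)).
have sb : @smap R (euc _) _ b u0.
  apply: (smap_cinv_comp _ hB hU md' df'); last by rewrite row_mxKl.
  by apply/msat_euc; exact: sat_lsubmx (sat_id _).
have sT v : sat (fun u => T u v) u0.
  apply/(@msat_euc R).
  apply: (msat_transition e0 hE hU tphi' tphi); rewrite ?Eb//.
  exact/(@msat_cst R).
have sc : sat c u0 by exact: sat_rsubmx (sat_rsubmx (sat_id _)).
have sc0 : sat c0 u0.
  by apply: sat_entry; exact: sat_lsubmx (sat_rsubmx (sat_id _)).
split=> //.
  apply: sat_row_mx.
    apply: sat_const_mx; apply: (@satD _ _ R) => //.
    by apply: sat_sum => j; apply: satM; exact: sat_entry.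
  apply: sat_row => i; apply: sat_sum => j.
  by apply: satM; apply: sat_entry => //; exact: satB.
have FB := mnear_filter hB (dpt f).
apply: filterS2 (mnear_cdom hB md df) (mnear_cdom hB md' df').
move=> b1 db db' g Eg.
have dg : cdom d (dpt g) by rewrite Eg.
have dg' : cdom d' (dpt g) by rewrite Eg.
set u := row_mx _ (dcoord _ _ _).
have Eb1 : b u = b1 by rewrite /b row_mxKl cinvK//; exact: mchart_inj.
have Ec : c u = a g by rewrite /c !row_mxKr.
have Ec0 : c0 u = a0 g by rewrite /c0 row_mxKr row_mxKl mxE.
have E0 : a0' g = a0 g + \sum_j a g ord0 j * T u 0 ord0 j.
  have [tb tp] := tptP tphi' e0 0 db'.
  by rewrite -(dagger_coef0 Ha' dg' (etrans tb (esym Eg)) tp) (Ha _ dg) ?tb// /T Eb1.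
rewrite Ec Ec0 /dcoord -E0; congr row_mx; apply/rowP => i; rewrite mxE.
have [tb tp] := tptP tphi' e0 (delta_mx ord0 i) db'.
have := dagger_coefj Ha' dg' (etrans tb (esym Eg)) tp.
rewrite (Ha _ dg) ?tb// E0 -addrA => /addrI/esym/(canRL (addKr _)) ->.
rewrite -sumrN -big_split /=; apply: eq_bigr => j _.
by rewrite /T Eb1 !mxE; ring.
Qed.

Lemma dagger_mchart (d : chart R (base E)) k (phi : tot E -> 'rV[R]_k) a0 a :
  pre_affine E -> affine_triv d phi -> dagger_coef d phi a0 a ->
  mchart (fchart (@dpt R E : dagger E -> base E) d (dcoord a0 a)).
Proof.
move=> hE tphi Ha; apply: (atlas_mchart (premfd_dagger hE)).
by exists d, k, phi, a0, a.
Qed.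

End Dagger.

End HullDaggerManifolds.

(** * Adapted coordinates *)

Section AdaptedCharts.
Context {R : realType}.
Implicit Types (A : dab R).

(** A single block [c] completes [z] on the fibres of [pi1] and [y] on those of [pi2]. That it is
    common to both is the content: separate trivialisations would produce two unrelated blocks. *)
Definition adapted A (d : chart R (dM A)) p q r (y : dA1 A -> 'rV[R]_p)
    (z : dA2 A -> 'rV[R]_q) (c : dA A -> 'rV[R]_r) : Prop :=
  [/\ @affine_triv R (bun2' A) d p y, @affine_triv R (bun1' A) d q z,
      @affine_triv R (bun1 A) (fchart (@pi2' R A) d y) (q + r)
        (fun x => row_mx (z (pi2 x)) (c x)) &
      @affine_triv R (bun2 A) (fchart (@pi1' R A) d z) (p + r)
        (fun x => row_mx (y (pi1 x)) (c x))].

(** The normal form shared by a double affine bundle and its dual; hull and core are computed from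
    it alone, hence for both at once. *)
Definition adapted_dab A : Prop :=
  [/\ [/\ premfd (dA A), premfd (dA1 A), premfd (dA2 A) & premfd (dM A)],
      forall x : dA A, pi2' (pi1 x) = pi1' (pi2 x) &
      forall m : dM A, exists (d : chart R (dM A)) p q r (y : dA1 A -> 'rV[R]_p)
        (z : dA2 A -> 'rV[R]_q) (c : dA A -> 'rV[R]_r),
        cdom d m /\ adapted d y z c].

Lemma eq_sum_all (V : zmodType) T (P : pred T) (w : seq T) (F G : T -> V) :
  all P w -> (forall x, P x -> F x = G x) ->
  \sum_(x <- w) F x = \sum_(x <- w) G x.
Proof.
move=> + FG; elim: w => [|x w IH]; first by rewrite !big_nil.
by move=> /andP[Px /IH Ew]; rewrite !big_cons FG// Ew.
Qed.

Lemma hext_row_mx (E : abun R) n k (f : tot E -> 'rV[R]_n) (g : tot E -> 'rV[R]_k) h :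
  hext (fun e => row_mx (f e) (g e)) h = row_mx (hext f h) (hext g h).
Proof.
rewrite /hext; elim: (hrep h) => [|re w IH]; first by rewrite !big_nil row_mx0.
by rewrite !big_cons IH scale_row_mx add_row_mx.
Qed.

Lemma aff_on_row_mxl (E : abun R) b n k (f : tot E -> 'rV[R]_n) (g : tot E -> 'rV[R]_k) :
  aff_on b (fun e => row_mx (f e) (g e)) -> aff_on b f.
Proof.
move=> H l e e' Ee Ee'; have := H l e e' Ee Ee'.
by rewrite !scale_row_mx add_row_mx => /eq_row_mx[].
Qed.

Lemma aff_on_row_mxr (E : abun R) b n k (f : tot E -> 'rV[R]_n) (g : tot E -> 'rV[R]_k) :
  aff_on b (fun e => row_mx (f e) (g e)) -> aff_on b g.
Proof.
move=> H l e e' Ee Ee'; have := H l e e' Ee Ee'.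
by rewrite !scale_row_mx add_row_mx => /eq_row_mx[].
Qed.

Section Local.
Context {A : dab R} (hA : adapted_dab A).
Context {d : chart R (dM A)} {p q r : nat} {y : dA1 A -> 'rV[R]_p}
  {z : dA2 A -> 'rV[R]_q} {c : dA A -> 'rV[R]_r} (had : adapted d y z c).

Lemma adapted_comm (x : dA A) : pi2' (pi1 x) = pi1' (pi2 x).
Proof. by case: hA. Qed.

Lemma adapted_mchart : mchart d.
Proof. by have [[]] := had. Qed.

Lemma adapted_y a : cdom d (pi2' a) -> @aff_chart R (bun2' A) (pi2' a) p y.
Proof. by move=> da; have [ty _ _ _] := had; exact: triv_aff_chart ty da. Qed.

Lemma adapted_z b : cdom d (pi1' b) -> @aff_chart R (bun1' A) (pi1' b) q z.
Proof. by move=> db; have [_ tz _ _] := had; exact: triv_aff_chart tz db. Qed.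

Lemma adapted_zc a : cdom d (pi2' a) ->
  @aff_chart R (bun1 A) a (q + r) (fun x => row_mx (z (pi2 x)) (c x)).
Proof. by move=> da; have [_ _ t _] := had; exact: triv_aff_chart t da. Qed.

Lemma adapted_yc b : cdom d (pi1' b) ->
  @aff_chart R (bun2 A) b (p + r) (fun x => row_mx (y (pi1 x)) (c x)).
Proof. by move=> db; have [_ _ _ t] := had; exact: triv_aff_chart t db. Qed.

Lemma adapted_y_inj a a' : cdom d (pi2' a) -> pi2' a = pi2' a' -> y a = y a' ->
  a = a'.
Proof. by move=> da Ea; have [_ _ + _] := adapted_y da; exact. Qed.

Lemma adapted_z_inj b b' : cdom d (pi1' b) -> pi1' b = pi1' b' -> z b = z b' ->
  b = b'.
Proof. by move=> db Eb; have [_ _ + _] := adapted_z db; exact. Qed.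

Lemma adapted_inj x x' : cdom d (pi2' (pi1 x)) ->
  pi2' (pi1 x) = pi2' (pi1 x') -> y (pi1 x) = y (pi1 x') ->
  z (pi2 x) = z (pi2 x') -> c x = c x' -> x = x'.
Proof.
move=> dx Ex Ey Ez Ec; have E1 := adapted_y_inj dx Ex Ey.
have [_ _ + _] := adapted_zc dx; apply=> //=; last by rewrite Ez Ec.
Qed.

Lemma adapted_aff1 l x x' : cdom d (pi2' (pi1 x)) -> pi1 x' = pi1 x ->
  [/\ pi1 (aff1 l x x') = pi1 x,
      z (pi2 (aff1 l x x')) = l *: z (pi2 x) + (1 - l) *: z (pi2 x') &
      c (aff1 l x x') = l *: c x + (1 - l) *: c x'].
Proof.
move=> dx Ex; have [cl af _ _] := adapted_zc dx.
have := af l x x' erefl Ex; rewrite !scale_row_mx add_row_mx => /eq_row_mx[Ez Ec].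
by split=> //; exact: cl.
Qed.

Lemma adapted_aff2 l x x' : cdom d (pi2' (pi1 x)) -> pi2 x' = pi2 x ->
  [/\ pi2 (aff2 l x x') = pi2 x,
      y (pi1 (aff2 l x x')) = l *: y (pi1 x) + (1 - l) *: y (pi1 x') &
      c (aff2 l x x') = l *: c x + (1 - l) *: c x'].
Proof.
rewrite adapted_comm => dx Ex; have [cl af _ _] := adapted_yc dx.
have := af l x x' erefl Ex; rewrite !scale_row_mx add_row_mx => /eq_row_mx[Ey Ec].
by split=> //; exact: cl.
Qed.

Lemma adapted_aff1' l b b' : cdom d (pi1' b) -> pi1' b' = pi1' b ->
  pi1' (aff1' l b b') = pi1' b /\ z (aff1' l b b') = l *: z b + (1 - l) *: z b'.
Proof.
move=> db Eb; have [cl af _ _] := adapted_z db.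
by split; [exact: cl|exact: af].
Qed.

Lemma adapted_aff2' l a a' : cdom d (pi2' a) -> pi2' a' = pi2' a ->
  pi2' (aff2' l a a') = pi2' a /\ y (aff2' l a a') = l *: y a + (1 - l) *: y a'.
Proof.
move=> da Ea; have [cl af _ _] := adapted_y da.
by split; [exact: cl|exact: af].
Qed.

(** Both sides have the same z: the affine law on the fibres of [pi1] computes it on the left, that
    on the fibres of [pi1'] on the right. *)
Lemma adapted_pi2_aff1 l x x' : cdom d (pi2' (pi1 x)) -> pi1 x' = pi1 x ->
  pi2 (aff1 l x x') = aff1' l (pi2 x) (pi2 x').
Proof.
move=> dx Ex; have [E1 E2 E3] := adapted_aff1 l dx Ex.
have db : cdom d (pi1' (pi2 x)) by rewrite -adapted_comm.
have Eb : pi1' (pi2 x') = pi1' (pi2 x) by rewrite -!adapted_comm Ex.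
have [F1 F2] := adapted_aff1' l db Eb.
have E : pi1' (pi2 (aff1 l x x')) = pi1' (pi2 x).
  by rewrite -adapted_comm E1 adapted_comm.
by apply: adapted_z_inj; rewrite ?E ?F1 ?F2 ?E2.
Qed.

Lemma adapted_pi1_aff2 l x x' : cdom d (pi2' (pi1 x)) -> pi2 x' = pi2 x ->
  pi1 (aff2 l x x') = aff2' l (pi1 x) (pi1 x').
Proof.
move=> dx Ex; have [E1 E2 E3] := adapted_aff2 l dx Ex.
have Ea : pi2' (pi1 x') = pi2' (pi1 x) by rewrite !adapted_comm Ex.
have [F1 F2] := adapted_aff2' l dx Ea.
have E : pi2' (pi1 (aff2 l x x')) = pi2' (pi1 x).
  by rewrite adapted_comm E1 -adapted_comm.
by apply: adapted_y_inj; rewrite ?E ?F1 ?F2 ?E2.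
Qed.

Lemma adapted_surj a b w : cdom d (pi2' a) -> pi2' a = pi1' b ->
  exists x, [/\ pi1 x = a, pi2 x = b & c x = w].
Proof.
move=> da Eab; have [_ _ _ /(_ (row_mx (z b) w))[x [Ex]]] := adapted_zc da.
move=> /eq_row_mx[Ez Ec]; have {}Ex : pi1 x = a := Ex; exists x; split=> //.
by apply: adapted_z_inj; rewrite // -adapted_comm Ex.
Qed.

(* The interchange law holds because all operations are affine in adapted
   coordinates. *)
Lemma adapted_interchange l m (x u x' u' : dA A) : cdom d (pi2' (pi1 x)) ->
  pi1 x = pi1 u -> pi1 x' = pi1 u' -> pi2 x = pi2 x' -> pi2 u = pi2 u' ->
  aff1 l (aff2 m x x') (aff2 m u u') = aff2 m (aff1 l x u) (aff1 l x' u').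
Proof.
move=> dx E1 E2 E3 E4.
have dx' : cdom d (pi2' (pi1 x')) by rewrite adapted_comm -E3 -adapted_comm.
have du : cdom d (pi2' (pi1 u)) by rewrite -E1.
have [a1 a2 a3] := adapted_aff2 m dx (esym E3).
have [b1 b2 b3] := adapted_aff2 m du (esym E4).
have [c1 c2 c3] := adapted_aff1 l dx (esym E1).
have [e1 e2 e3] := adapted_aff1 l dx' (esym E2).
have dA2 : cdom d (pi2' (pi1 (aff2 m x x'))) by rewrite adapted_comm a1 -adapted_comm.
have dA1 : cdom d (pi2' (pi1 (aff1 l x u))) by rewrite c1.
have E5 : pi1 (aff2 m u u') = pi1 (aff2 m x x').
  by rewrite (adapted_pi1_aff2 m du) ?(adapted_pi1_aff2 m dx)// E1 E2.
have E6 : pi2 (aff1 l x' u') = pi2 (aff1 l x u).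
  by rewrite (adapted_pi2_aff1 l dx') ?(adapted_pi2_aff1 l dx)// E3 E4.
have [f1 f2 f3] := adapted_aff1 l dA2 E5.
have [g1 g2 g3] := adapted_aff2 m dA1 E6.
apply: adapted_inj.
- by rewrite f1.
- by rewrite f1 [RHS]adapted_comm g1 -adapted_comm c1 adapted_comm a1 -adapted_comm.
- by rewrite f1 a2 g2 c1 e1.
- by rewrite f2 a1 b1 g1 c2.
rewrite f3 g3 a3 b3 c3 e3 !scalerDr !scalerA.
rewrite addrACA; congr (_ *: _ + _ *: _ + (_ *: _ + _ *: _)); exact: mulrC.
Qed.

End Local.

Section Global.
Context {A : dab R} (hA : adapted_dab A).

Lemma adapted_pre_affine : [/\ pre_affine (bun1 A), pre_affine (bun2 A),
  pre_affine (bun1' A) & pre_affine (bun2' A)].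
Proof.
have [[h h1 h2 hM] comm H] := hA; split; split=> //.
- move=> a; have [d [p [q [r [y [z [c [dm [_ _ t _]]]]]]]]] := H (pi2' a).
  by exists (fchart (@pi2' R A) d y), (q + r)%N, (fun x => row_mx (z (pi2 x)) (c x)).
- move=> b; have [d [p [q [r [y [z [c [dm [_ _ _ t]]]]]]]]] := H (pi1' b).
  by exists (fchart (@pi1' R A) d z), (p + r)%N, (fun x => row_mx (y (pi1 x)) (c x)).
- move=> m; have [d [p [q [r [y [z [c [dm [_ t _ _]]]]]]]]] := H m.
  by exists d, q, z.
- move=> m; have [d [p [q [r [y [z [c [dm [t _ _ _]]]]]]]]] := H m.
  by exists d, p, y.
Qed.

(** The manifold axioms climb from [M] to [A1] and [A2], and from there to [A]; the algebraic axioms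
    are read in coordinates at the point in question. *)
Lemma adapted_double_affine_bundle : manifold (dM A) -> double_affine_bundle A.
Proof.
move=> mM; have [[h h1 h2 hM] comm H] := hA.
have [p1 p2 p1' p2'] := adapted_pre_affine.
have b1' := pre_affine_bundle p1' mM; have b2' := pre_affine_bundle p2' mM.
have m2 : manifold (dA2 A) by case: b1'.
have m1 : manifold (dA1 A) by case: b2'.
have b1 := pre_affine_bundle p1 m1; have b2 := pre_affine_bundle p2 m2.
split=> //.
- split; split=> //.
  + exact: (pre_affine_smooth_bproj p1).
  + exact: (pre_affine_smooth_bproj p1').
  + move=> l x x' Ex.
    have [d [p [q [r [y [z [c [dm had]]]]]]]] := H (pi2' (pi1 x)).
    exact: (adapted_pi1_aff2 hA had l dm (esym Ex)).
  + exact: (pre_affine_smooth_bproj p2).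
  + exact: (pre_affine_smooth_bproj p2').
  + by move=> x; exact/esym/comm.
  + move=> l x x' Ex.
    have [d [p [q [r [y [z [c [dm had]]]]]]]] := H (pi2' (pi1 x)).
    exact: (adapted_pi2_aff1 hA had l dm (esym Ex)).
- move=> a b Eab; have [d [p [q [r [y [z [c [dm had]]]]]]]] := H (pi2' a).
  by have [x [Ex1 Ex2 _]] := adapted_surj hA had 0 dm Eab; exists x.
move=> l; split; split.
- exact: (smooth_aff_fibprod l p1).
- exact: (smooth_aff_fibprod l p1').
- move=> x x' Ex.
  have [d [p [q [r [y [z [c [dm had]]]]]]]] := H (pi2' (pi1 x)).
  exact: (adapted_pi2_aff1 hA had l dm (esym Ex)).
- move=> m x u x' u' *.
  have [d [p [q [r [y [z [c [dm had]]]]]]]] := H (pi2' (pi1 x)).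
  exact: (adapted_interchange hA had).
- exact: (smooth_aff_fibprod l p2).
- exact: (smooth_aff_fibprod l p2').
- move=> x x' Ex.
  have [d [p [q [r [y [z [c [dm had]]]]]]]] := H (@pi2' R A (@pi1 R A x)).
  exact: (adapted_pi1_aff2 hA had l dm (esym Ex)).
- move=> m x u x' u' E1 E2 E3 E4; apply/esym.
  have [d [p [q [r [y [z [c [dm had]]]]]]]] := H (@pi2' R A (@pi1 R A x)).
  exact: (adapted_interchange hA had).
Qed.

End Global.

(** * The hull of the first projection as an affine bundle over the hull of [A2] *)

Section Hat.
Context {A : dab R} (hA : adapted_dab A).
Context {d : chart R (dM A)} {p q r : nat} {y : dA1 A -> 'rV[R]_p}
  {z : dA2 A -> 'rV[R]_q} {c : dA A -> 'rV[R]_r} (had : adapted d y z c).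
Implicit Types (h u v : hull (bun1 A)).

Let comm := adapted_comm hA.

Lemma aff_on_z a : cdom d (pi2' a) ->
  @aff_on R (bun1 A) _ a (fun x => z (pi2 x)).
Proof. by move=> /(adapted_zc had)[_ /aff_on_row_mxl]. Qed.

Lemma aff_on_c a : cdom d (pi2' a) -> @aff_on R (bun1 A) _ a c.
Proof. by move=> /(adapted_zc had)[_ /aff_on_row_mxr]. Qed.

Lemma hull1_surj a vz vc s : cdom d (pi2' a) -> exists u : hull (bun1 A),
  [/\ hproj u = a, hext (E := bun1 A) (fun x => z (pi2 x)) u = vz,
      hext (E := bun1 A) c u = vc & hwt u = s].
Proof.
move=> da; have [u [Eu + Es]] := hull_surj (adapted_zc had da) (row_mx vz vc) s.
by rewrite (@hext_row_mx (bun1 A)) => /eq_row_mx[Ez Ec]; exists u.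
Qed.

Lemma hat_projP h : cdom d (pi2' (hproj h)) ->
  let h' := @bproj R (hat A) h : hull (bun1' A) in
  [/\ hproj h' = pi2' (hproj h),
      hext (E := bun1' A) z h' = hext (E := bun1 A) (fun x => z (pi2 x)) h &
      hwt h' = hwt h].
Proof.
move=> dh /=; split=> //.
  rewrite (@hext_hmap R (bun1 A) (bun1' A))//.
    by move=> e <-; exact/esym/comm.
  by have [_ tz _ _] := had; have [_] := triv_aff_chart tz dh.
rewrite /hwt (@hext_hmap R (bun1 A) (bun1' A))//.
  by move=> e <-; exact/esym/comm.
exact: aff_on_cst.
Qed.

Lemma hull1'_inj (u v : hull (bun1' A)) : cdom d (hproj u) -> hproj v = hproj u ->
  hext (E := bun1' A) z u = hext (E := bun1' A) z v -> hwt u = hwt v -> u = v.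
Proof.
move=> du Ev Ez Ew; have [_ tz _ _] := had.
exact: (hull_inj (triv_aff_chart tz du)).
Qed.

Lemma hat_proj_eq u v : cdom d (pi2' (hproj u)) ->
  @bproj R (hat A) v = @bproj R (hat A) u ->
  [/\ pi2' (hproj v) = pi2' (hproj u),
      hext (E := bun1 A) (fun x => z (pi2 x)) v = hext (E := bun1 A) (fun x => z (pi2 x)) u &
      hwt v = hwt u].
Proof.
move=> du Euv; have [E1 E2 E3] := hat_projP du.
have dv : cdom d (pi2' (hproj v)).
  by have := congr1 (fun h : hull (bun1' A) => hproj h) Euv => /= ->.
have [F1 F2 F3] := hat_projP dv.
by rewrite -F1 -E1 -E2 -F2 -E3 -F3 Euv.
Qed.

(** [haff] chooses a value by means of a simultaneous representation of [u] and [v] by pairs of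
    points. Coordinates and weight of the result are independent of the representation, and one
    exists. *)
Lemma haffP l u v : cdom d (pi2' (hproj u)) ->
  @bproj R (hat A) v = @bproj R (hat A) u ->
  [/\ hproj (haff l u v) = aff2' l (hproj u) (hproj v),
      hext (E := bun1 A) (fun x => z (pi2 x)) (haff l u v) =
        hext (E := bun1 A) (fun x => z (pi2 x)) u,
      hext (E := bun1 A) c (haff l u v) =
        l *: hext (E := bun1 A) c u + (1 - l) *: hext (E := bun1 A) c v &
      hwt (haff l u v) = hwt u].
Proof.
move=> du Euv; have [E1 E2 E3] := hat_proj_eq du Euv.
have dv : cdom d (pi2' (hproj v)) by rewrite E1.
have [cl1 cl2] := adapted_aff2' had l du E1.
have dl : cdom d (pi2' (aff2' l (hproj u) (hproj v))) by rewrite cl1.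
rewrite /haff; case: xgetP => [h _ [w [fw Eu Ev ->]]|].
  pose w1 := [seq (qq.1, qq.2.1) | qq <- w] : seq (R * tot (bun1 A)).
  pose w2 := [seq (qq.1, qq.2.2) | qq <- w] : seq (R * tot (bun1 A)).
  pose w3 := [seq (qq.1, aff2 l qq.2.1 qq.2.2) | qq <- w] : seq (R * tot (bun1 A)).
  have Ha (qq : R * (dA A * dA A)) :
      `[< [/\ pi1 qq.2.1 = hproj u, pi1 qq.2.2 = hproj v & pi2 qq.2.1 = pi2 qq.2.2] >] ->
      [/\ pi1 (aff2 l qq.2.1 qq.2.2) = aff2' l (hproj u) (hproj v),
      z (pi2 (aff2 l qq.2.1 qq.2.2)) = z (pi2 qq.2.1) &
      c (aff2 l qq.2.1 qq.2.2) = l *: c qq.2.1 + (1 - l) *: c qq.2.2].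
    move=> /asboolP[H1 H2 H3].
    have dq : cdom d (pi2' (pi1 qq.2.1)) by rewrite H1.
    have [-> _ ->] := adapted_aff2 hA had l dq (esym H3).
    by rewrite (adapted_pi1_aff2 hA had l dq (esym H3)) H1 H2.
  have f1 : in_fiber (E := bun1 A) (hproj u) w1.
    rewrite /in_fiber all_map; apply: sub_all fw => qq /asboolP[H1 _ _].
    exact/asboolP.
  have f2 : in_fiber (E := bun1 A) (hproj v) w2.
    rewrite /in_fiber all_map; apply: sub_all fw => qq /asboolP[_ H2 _].
    exact/asboolP.
  have f3 : in_fiber (E := bun1 A) (aff2' l (hproj u) (hproj v)) w3.
    rewrite /in_fiber all_map; apply: sub_all fw => qq /Ha[H1 _ _].
    exact/asboolP.
  split=> //.
  - rewrite (hext_hmk (aff_on_z dl) f3) [in RHS]Eu (hext_hmk (aff_on_z du) f1).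
    by rewrite /wsum !big_map; apply: eq_sum_all fw _ => qq /Ha[_ /= -> _].
  - rewrite (hext_hmk (aff_on_c dl) f3) [in X in _ = l *: X + _]Eu [in X in _ = _ + X]Ev.
    rewrite (hext_hmk (aff_on_c du) f1) (hext_hmk (aff_on_c dv) f2).
    rewrite /wsum !big_map !scaler_sumr -big_split /=.
    apply: eq_sum_all fw _ => qq /Ha[_ _ /= ->].
    by rewrite scalerDr !scalerA ![_ * qq.1]mulrC.
  - rewrite /hwt (hext_hmk _ f3); last exact: aff_on_cst.
    rewrite [in RHS]Eu (hext_hmk _ f1); last exact: aff_on_cst.
    by rewrite /wsum !big_map.
(* A representation from normal forms, each a point plus a multiple of an origin: [u] and [v] share
   z-coordinate and weight, so both points can be taken over [b1] in [A2] and both origins over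
   [b0], with the common coefficient weight - 1. *)
move=> H; exfalso.
set hz := hext (E := bun1 A) (fun x => z (pi2 x)) u in E2.
have [_ _ _ /(_ hz)[b1 [Eb1 zb1]]] := triv_aff_chart (let: And4 _ t _ _ := had in t) du.
have [_ _ _ /(_ 0)[b0 [Eb0 zb0]]] := triv_aff_chart (let: And4 _ t _ _ := had in t) du.
have [x1 [p1 q1 c1]] := adapted_surj hA had (hext (E := bun1 A) c u) du (esym Eb1).
have [x2 [p2 q2 c2]] := adapted_surj hA had (hext (E := bun1 A) c v) dv
  (etrans E1 (esym Eb1)).
have [x3 [p3 q3 c3]] := adapted_surj hA had 0 du (esym Eb0).
have [x4 [p4 q4 c4]] := adapted_surj hA had 0 dv (etrans E1 (esym Eb0)).
pose s := weight (hrep u) - 1.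
have := H (@hmk R (bun1 A) (aff2' l (hproj u) (hproj v))
  [seq (qq.1, aff2 l qq.2.1 qq.2.2) | qq <- [:: (1, (x1, x2)); (s, (x3, x4))]]).
case; exists [:: (1, (x1, x2)); (s, (x3, x4))]; split=> //=.
- by rewrite p1 p2 p3 p4 q1 q2 q3 q4 !asboolT.
- have fw : in_fiber (E := bun1 A) (hproj u) [:: (1, x1); (s, x3)].
    by rewrite /in_fiber /= p1 p3 asboolT.
  rewrite -[LHS](@hmk_hrep R (bun1 A)); apply: hmk_eq => //; first exact: hrep_fiber.
  apply: (hull_normal_form (adapted_zc had du)) => //; first exact: (@hrep_fiber R (bun1 A)).
    by rewrite q3 zb0 c3 row_mx0.
  by rewrite -[RHS]/(hext (E := bun1 A) _ u) (@hext_row_mx (bun1 A)) q1 zb1 c1.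
- have fw : in_fiber (E := bun1 A) (hproj v)
      [:: (1, x2); (weight (hrep v) - 1, x4)].
    by rewrite /in_fiber /= p2 p4 asboolT.
  have -> : s = weight (hrep v) - 1.
    by move: E3; rewrite !hwtE => /matrixP/(_ ord0 ord0); rewrite !mxE => ->.
  rewrite -[LHS](@hmk_hrep R (bun1 A)); apply: hmk_eq => //; first exact: hrep_fiber.
  apply: (hull_normal_form (adapted_zc had dv)) => //; first exact: (@hrep_fiber R (bun1 A)).
    by rewrite q4 zb0 c4 row_mx0.
  by rewrite -[RHS]/(hext (E := bun1 A) _ v) (@hext_row_mx (bun1 A)) q2 zb1 c2 -E2.
Qed.

End Hat.

End AdaptedCharts.

Ltac smooth_coord :=
  repeat first [exact: sat_id | exact: sat_cst | apply: sat_row_mx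
    | apply: sat_lsubmx | apply: sat_rsubmx | apply: satB | apply: satD].

Lemma hwt_hzero (R : realType) (E : abun R) (b : base E) : hwt (hzero b) = 0.
Proof. by rewrite /hwt hext_hzero//; exact: aff_on_cst. Qed.

Lemma hwt_hpt (R : realType) (E : abun R) (e : tot E) : hwt (hpt e) = const_mx 1.
Proof. by rewrite /hwt hext_hpt//; exact: aff_on_cst. Qed.

Lemma hwt_hadd (R : realType) (E : abun R) (h h' : hull E) :
  hproj h' = hproj h -> hwt (hadd h h') = hwt h + hwt h'.
Proof. by move=> Eh; rewrite /hwt hext_hadd//; exact: aff_on_cst. Qed.

Lemma hwt_hscale (R : realType) (E : abun R) l (h : hull E) :
  hwt (hscale l h) = l *: hwt h.
Proof. by rewrite /hwt hext_hscale//; exact: aff_on_cst. Qed.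

Lemma hwt_hsub (R : realType) (E : abun R) (h h' : hull E) :
  hproj h' = hproj h -> hwt (hsub h h') = hwt h - hwt h'.
Proof. by move=> Eh; rewrite /hwt hext_hsub//; exact: aff_on_cst. Qed.

(** * The core in adapted coordinates *)

Section Core.
Context {R : realType} {A : dab R} (hA : adapted_dab A).
Context {d : chart R (dM A)} {p q r : nat} {y : dA1 A -> 'rV[R]_p}
  {z : dA2 A -> 'rV[R]_q} {c : dA A -> 'rV[R]_r} (had : adapted d y z c).

Let comm := adapted_comm hA.

Definition hat_chart : chart R (hull_mfd (bun1' A)) :=
  fchart (@hproj R (bun1' A) : hull_mfd (bun1' A) -> dM A) d (hcoord (E := bun1' A) z).

Definition hat_coord (h : hull (bun1 A)) : 'rV[R]_(p + r) :=
  row_mx (y (hproj h)) (hext (E := bun1 A) c h).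

Lemma hat_chart_mchart : mchart hat_chart.
Proof.
have [_ _ p1' _] := adapted_pre_affine hA; have [_ tz _ _] := had.
exact: (hull_mchart p1' tz).
Qed.

(** The entries are those of the chart of the hull of [pi1], regrouped from (x, y | z, c, s) to (x,
    z, s | y, c); [r1] and [r2] are block permutations. *)
Lemma hat_triv : @affine_triv R (hat A) hat_chart (p + r) hat_coord.
Proof.
have [p1 _ p1' _] := adapted_pre_affine hA; have [ty tz t1 _] := had.
split=> /=.
- exact: hat_chart_mchart.
- pose r1 (u : 'rV[R]_((cdim d + p) + ((q + r) + 1))) :
      'rV[R]_((cdim d + (q + 1)) + (p + r)) :=
    row_mx (row_mx (lsubmx (lsubmx u))
                   (row_mx (lsubmx (lsubmx (rsubmx u))) (rsubmx (rsubmx u))))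
           (row_mx (rsubmx (lsubmx u)) (rsubmx (lsubmx (rsubmx u)))).
  pose r2 (v : 'rV[R]_((cdim d + (q + 1)) + (p + r))) :
      'rV[R]_((cdim d + p) + ((q + r) + 1)) :=
    row_mx (row_mx (lsubmx (lsubmx v)) (lsubmx (rsubmx v)))
           (row_mx (row_mx (lsubmx (rsubmx (lsubmx v))) (rsubmx (rsubmx v)))
                   (rsubmx (rsubmx (lsubmx v)))).
  pose e : chart R (hull_mfd (bun1 A)) := fchart
    (@bproj R (hat A) : hull_mfd (bun1 A) -> hull_mfd (bun1' A)) hat_chart hat_coord.
  have mc := hull_mchart p1 t1; set c0 := fchart _ _ _ in mc.
  apply: (@mchart_post R (hull_mfd (bun1 A)) c0 e r1 r2 (premfd_hull p1) mc).
  + by [].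
  + move=> h /= dh.
    have [_ Ez Es] := hat_projP hA had dh.
    rewrite /hcoord /= Ez Es (@hext_row_mx R (bun1 A)) /r1.
    by rewrite !(row_mxKl, row_mxKr).
  + by move=> u; rewrite /r1; smooth_coord.
  + by move=> u; rewrite /r2; smooth_coord.
  + by move=> u; rewrite /r1 /r2 !(row_mxKl, row_mxKr, hsubmxK).
  + by move=> u; rewrite /r1 /r2 !(row_mxKl, row_mxKr, hsubmxK).
- move=> b v db.
  have [_ _ _ /(_ (lsubmx v))[a [/= Ea ya]]] := triv_aff_chart ty db.
  have {}Ea : pi2' a = hproj b := Ea.
  have da : cdom d (pi2' a) by rewrite Ea.
  have [h [Eh hz hc hs]] := hull1_surj had (hext (E := bun1' A) z b) (rsubmx v) (hwt b) da.
  exists h; split; last by rewrite /hat_coord Eh ya hc hsubmxK.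
  have dh : cdom d (pi2' (hproj h)) by rewrite Eh.
  have [E1 E2 E3] := hat_projP hA had dh.
  apply/esym; apply: (hull1'_inj had) => //; first by rewrite E1 Eh.
    by rewrite E2 hz.
  by rewrite E3 hs.
- move=> l u v du Euv.
  have {}du : cdom d (pi2' (hproj u)) := du.
  have [E1 E2 E3 E4] := haffP hA had l du Euv.
  have [F1 F2 F3] := hat_proj_eq hA had du Euv.
  have [G1 G2] := adapted_aff2' had l du F1.
  have du' : cdom d (pi2' (hproj (haff l u v))) by rewrite E1 G1.
  split; last by rewrite /hat_coord E1 G2 E3 !scale_row_mx add_row_mx.
  have [H1 H2 H3] := hat_projP hA had du; have [K1 K2 K3] := hat_projP hA had du'.
  apply: (hull1'_inj had).
  + by rewrite K1.
  + by rewrite H1 K1 E1 G1.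
  + by rewrite H2 K2 E2.
  + by rewrite H3 K3 E4.
Qed.

Definition core_y (D : hull (hat A)) : 'rV[R]_p :=
  hext (E := hat A) (fun h => y (@hproj R (bun1 A) h)) D.

Definition core_c (D : hull (hat A)) : 'rV[R]_r :=
  hext (E := hat A) (fun h : hull (bun1 A) => hext (E := bun1 A) c h) D.

Definition dhull_base (D : hull (hat A)) : dM A :=
  @hproj R (bun1' A) (@hproj R (hat A) D).

Lemma hext_hat_coord D :
  hext (E := hat A) hat_coord D = row_mx (core_y D) (core_c D).
Proof. exact: (@hext_row_mx R (hat A)). Qed.

Lemma hat_aff_chart (h : hull (bun1' A)) : cdom d (hproj h) ->
  @aff_chart R (hat A) h (p + r) hat_coord.
Proof. by move=> dh; exact: triv_aff_chart hat_triv dh. Qed.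

Lemma hat_aff_y (h : hull (bun1' A)) : cdom d (hproj h) ->
  @aff_on R (hat A) _ h (fun h => y (@hproj R (bun1 A) h)).
Proof.
by move=> /hat_aff_chart[_ /(@aff_on_row_mxl R (hat A))].
Qed.

Lemma hat_aff_c (h : hull (bun1' A)) : cdom d (hproj h) ->
  @aff_on R (hat A) _ h (fun h : hull (bun1 A) => hext (E := bun1 A) c h).
Proof.
by move=> /hat_aff_chart[_ /(@aff_on_row_mxr R (hat A))].
Qed.

Lemma hext_y_proj1 D : cdom d (dhull_base D) ->
  hext (E := bun2' A) y (@dhull_proj1 R A D) = core_y D.
Proof.
move=> dD; rewrite (@hext_hmap R (hat A) (bun2' A))//.
  by move=> h <-.
by have [ty _ _ _] := had; have [_] := triv_aff_chart ty dD.
Qed.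

Lemma hwt_proj1 D : hwt (@dhull_proj1 R A D) = hwt D.
Proof.
rewrite /hwt (@hext_hmap R (hat A) (bun2' A))//; last exact: aff_on_cst.
by move=> h <-.
Qed.

Lemma hull1'_zero (h : hull (bun1' A)) : cdom d (hproj h) ->
  h = @hzero R (bun1' A) (hproj h) <-> hcoord (E := bun1' A) z h = 0.
Proof.
move=> dh; have [_ tz _ _] := had; have [_ af _ _] := triv_aff_chart tz dh.
split=> [->|H].
  by rewrite /hcoord (hext_hzero af) hwt_hzero row_mx0.
apply: (hull1'_inj had) => //; move: H; rewrite /hcoord -row_mx0 => /eq_row_mx[Hz Hs].
  by rewrite Hz (hext_hzero af).
by rewrite Hs hwt_hzero.
Qed.

(** In the coordinates (x; y, t, z, s; c) of the double hull the core is y = t = z = s = 0: the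
    first block comes from the projection to the hull of [A2], the other two from that to the hull
    of [A1]. *)
Lemma core_predP D : cdom d (dhull_base D) -> @core_pred R A D <->
  [/\ hcoord (E := bun1' A) z (hproj D) = 0, core_y D = 0 & hwt D = 0].
Proof.
move=> dD; have [ty tz _ _] := had; have [_ af _ _] := triv_aff_chart ty dD.
split=> [[m [E1 E2]]|[E1 E2 E3]].
  have Em : m = dhull_base D by rewrite /dhull_base E1.
  split.
  - by apply/hull1'_zero => //; rewrite E1.
  - by rewrite -hext_y_proj1// E2 Em (hext_hzero af).
  - by rewrite -hwt_proj1 E2 hwt_hzero.
exists (dhull_base D); split; first exact/hull1'_zero.
apply: (hull_inj (triv_aff_chart ty dD)) => //.
  by rewrite hext_y_proj1// E2 (hext_hzero af).
by rewrite hwt_proj1 E3 hwt_hzero.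
Qed.

Lemma core_eq D D' : @core_pred R A D -> @core_pred R A D' -> cdom d (dhull_base D) ->
  dhull_base D' = dhull_base D -> core_c D = core_c D' -> D = D'.
Proof.
move=> cD cD' dD ED Ec; have dD' : cdom d (dhull_base D') by rewrite ED.
have [E1 E2 E3] := (core_predP dD).1 cD; have [F1 F2 F3] := (core_predP dD').1 cD'.
have EP : hproj D' = hproj D.
  by rewrite ((hull1'_zero dD).2 E1) ((hull1'_zero dD').2 F1) -/(dhull_base D) -ED.
apply: (hull_inj (hat_aff_chart dD)) => //; last by rewrite E3 F3.
by rewrite !hext_hat_coord E2 F2 Ec.
Qed.

Lemma core_mk m w : cdom d m ->
  exists D, [/\ @core_pred R A D, dhull_base D = m & core_c D = w].
Proof.
move=> dm; have [_ tz _ _] := had; have [_ af _ _] := triv_aff_chart tz dm.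
have dm' : cdom d (hproj (@hzero R (bun1' A) m)) by [].
have [D [ED]] := hull_surj (hat_aff_chart dm') (row_mx 0 w) 0.
rewrite hext_hat_coord => /eq_row_mx[Ey Ec] Es.
have EDm : dhull_base D = m by rewrite /dhull_base ED.
exists D; split=> //; apply/core_predP; first by rewrite EDm.
by split=> //; rewrite ED; apply/hull1'_zero.
Qed.

(** The weights [l] and [k] are arbitrary: the equations of the core are linear, so it is stable
    under all linear combinations of the hull. *)
Lemma core_linear_comb (l k : R) D D' : @core_pred R A D -> @core_pred R A D' ->
  cdom d (dhull_base D) -> dhull_base D' = dhull_base D ->
  let D'' := @hadd R (hat A) (@hscale R (hat A) l D) (@hscale R (hat A) k D') in
  [/\ @core_pred R A D'', dhull_base D'' = dhull_base D &
      core_c D'' = l *: core_c D + k *: core_c D'].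
Proof.
move=> cD cD' dD ED D''; have dD' : cdom d (dhull_base D') by rewrite ED.
have [E1 E2 E3] := (core_predP dD).1 cD; have [F1 F2 F3] := (core_predP dD').1 cD'.
have EP : hproj D' = hproj D.
  by rewrite ((hull1'_zero dD).2 E1) ((hull1'_zero dD').2 F1) -/(dhull_base D) -ED.
have EP' : hproj (@hscale R (hat A) k D') = hproj (@hscale R (hat A) l D) by [].
have EB : dhull_base D'' = dhull_base D by [].
have H (V : lmodType R) (f : tot (hat A) -> V) : @aff_on R (hat A) V (hproj D) f ->
    hext (E := hat A) f D'' = l *: hext (E := hat A) f D + k *: hext (E := hat A) f D'.
  by move=> af; rewrite hext_hadd// !hext_hscale ?EP.
have dDD : cdom d (hproj (@hproj R (hat A) D)) := dD.
split=> //; last by apply: H; exact: hat_aff_c.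
apply/core_predP => //; split=> //.
  by rewrite /core_y H; [rewrite -/(core_y D) -/(core_y D') E2 F2 !scaler0 addr0|
    exact: hat_aff_y].
by rewrite hwt_hadd// !hwt_hscale E3 F3 !scaler0 addr0.
Qed.

(** The equations of the core come last, as slice charts require. *)
Definition core_phi (D : dhull A) : 'rV[R]_((cdim d + r) + ((q + 1) + (p + 1))) :=
  row_mx (row_mx (cmap d (dhull_base D)) (core_c D))
    (row_mx (hcoord (E := bun1' A) z (@hproj R (hat A) D))
      (row_mx (core_y D) (hwt D))).

End Core.
Arguments hat_chart {R A} d {q} z.
Arguments hat_coord {R A p r} y c h.
Arguments core_y {R A p} y D.
Arguments core_c {R A r} c D.
Arguments core_phi {R A} d {p q r} y z c D.

Section CoreGlobal.
Context {R : realType} {A : dab R} (hA : adapted_dab A).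

Lemma hat_pre_affine : pre_affine (hat A).
Proof.
have [p1 _ p1' _] := adapted_pre_affine hA; split.
- exact: premfd_hull p1.
- exact: premfd_hull p1'.
- move=> b; have [_ _ H] := hA.
  have [d [p [q [r [y [z [c [dm had]]]]]]]] := H (hproj b).
  by exists (hat_chart d z), (p + r)%N, (hat_coord y c); split=> //; exact: hat_triv.
Qed.

Lemma premfd_dhull : premfd (dhull A).
Proof. exact: premfd_hull hat_pre_affine. Qed.

Section Slice.
Context {d : chart R (dM A)} {p q r : nat} {y : dA1 A -> 'rV[R]_p}
  {z : dA2 A -> 'rV[R]_q} {c : dA A -> 'rV[R]_r} (had : adapted d y z c).

Lemma core_slice :
  slice_chart (@core_pred R A) (fun D => cdom d (dhull_base D)) (core_phi d y z c).
Proof.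
split; last first.
  move=> D dD; rewrite /core_phi row_mxKr; split=> [/(core_predP had dD)[-> -> ->]|].
    by rewrite !row_mx0.
  rewrite -row_mx0 => /eq_row_mx[E1]; rewrite -row_mx0 => /eq_row_mx[E2 E3].
  exact/(core_predP had dD).
pose r1 (u : 'rV[R]_((cdim d + (q + 1)) + ((p + r) + 1))) :
    'rV[R]_((cdim d + r) + ((q + 1) + (p + 1))) :=
  row_mx (row_mx (lsubmx (lsubmx u)) (rsubmx (lsubmx (rsubmx u))))
    (row_mx (rsubmx (lsubmx u)) (row_mx (lsubmx (lsubmx (rsubmx u))) (rsubmx (rsubmx u)))).
pose r2 (v : 'rV[R]_((cdim d + r) + ((q + 1) + (p + 1)))) :
    'rV[R]_((cdim d + (q + 1)) + ((p + r) + 1)) :=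
  row_mx (row_mx (lsubmx (lsubmx v)) (lsubmx (rsubmx v)))
    (row_mx (row_mx (lsubmx (rsubmx (rsubmx v))) (rsubmx (lsubmx v)))
            (rsubmx (rsubmx (rsubmx v)))).
have mc := hull_mchart hat_pre_affine (hat_triv hA had); set c0 := fchart _ _ _ in mc.
apply: (@mchart_post R (dhull A) c0 (Chart (fun D => cdom d (dhull_base D))
  (core_phi d y z c)) r1 r2 premfd_dhull mc).
- by [].
- move=> D /= dD; rewrite /core_phi /hcoord hext_hat_coord /r1.
  by rewrite !(row_mxKl, row_mxKr).
- by move=> u; rewrite /r1; smooth_coord.
- by move=> u; rewrite /r2; smooth_coord.
- by move=> u; rewrite /r1 /r2 !(row_mxKl, row_mxKr, hsubmxK).
- by move=> u; rewrite /r1 /r2 !(row_mxKl, row_mxKr, hsubmxK).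
Qed.

End Slice.

Lemma core_cover D : @core_pred R A D -> exists k l U (phi : dhull A -> 'rV[R]_(k + l)),
  slice_chart (@core_pred R A) U phi /\ U D.
Proof.
move=> _; have [_ _ H] := hA.
have [d [p [q [r [y [z [c [dm had]]]]]]]] := H (dhull_base D).
exists (cdim d + r)%N, ((q + 1) + (p + 1))%N, (fun D => cdom d (dhull_base D)).
by exists (core_phi d y z c); split=> //; exact: core_slice.
Qed.

Lemma premfd_core : premfd (core A).
Proof. exact: (@premfd_sub R (dhull A) premfd_dhull _ core_cover). Qed.

Section CoreTriv.
Context {d : chart R (dM A)} {p q r : nat} {y : dA1 A -> 'rV[R]_p}
  {z : dA2 A -> 'rV[R]_q} {c : dA A -> 'rV[R]_r} (had : adapted d y z c).

Definition core_coord (e : core A) : 'rV[R]_r := core_c c (val e).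

Lemma core_predE (e : core A) : core_pred (val e).
Proof. exact: sub_mfdP. Qed.

Lemma core_triv : @affine_triv R (core_bun A) d r core_coord.
Proof.
have md := adapted_mchart had.
split=> //=.
- have := mchart_sub premfd_dhull core_cover (core_slice had).
  congr mchart; congr Chart; apply/funext => e.
  by rewrite /core_phi row_mxKl.
- move=> m w dm; have [D [cD Em Ec]] := core_mk hA had w dm.
  by exists (exist _ D (mem_set cD)).
- move=> l e e' de Ee.
  have [cD ED Ec] := core_linear_comb hA had l (1 - l) (core_predE e)
    (core_predE e') de Ee.
  (* By [cD] the combination lies in the core, so [insubd] returns it and not its default. *)
  rewrite /core_coord /core_proj val_insubd mem_set//.
Qed.

Lemma core_proj_dhull (e : core A) : core_proj e = dhull_base (val e).
Proof. by []. Qed.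

Lemma core_coord_inj (e e' : core A) : cdom d (core_proj e) ->
  core_proj e' = core_proj e -> core_coord e = core_coord e' -> e = e'.
Proof.
move=> de Ee Ec; apply: val_inj.
exact: (core_eq hA had (core_predE e) (core_predE e') de Ee Ec).
Qed.

Lemma hull1_zero_proj (v : hull (bun1 A)) : cdom d (pi2' (hproj v)) ->
  hext (E := bun1 A) (fun x => z (pi2 x)) v = 0 -> hwt v = 0 ->
  @bproj R (hat A) v = @hzero R (bun1' A) (pi2' (hproj v)).
Proof.
move=> dv Ez Es; have [E1 E2 E3] := hat_projP hA had dv.
have dv' : cdom d (hproj (@bproj R (hat A) v : hull (bun1' A))) by rewrite E1.
rewrite -E1; apply/(hull1'_zero had dv').
by rewrite /hcoord E2 E3 Ez Es row_mx0.
Qed.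

Lemma core_ofP (v : hull (bun1 A)) : cdom d (pi2' (hproj v)) ->
  hext (E := bun1 A) (fun x => z (pi2 x)) v = 0 -> hwt v = 0 ->
  [/\ core_pred (core_of v), dhull_base (core_of v) = pi2' (hproj v) &
      core_c c (core_of v) = hext (E := bun1 A) c v].
Proof.
move=> dv Ez Es; have Ev := hull1_zero_proj dv Ez Es.
set v0 := @hzero R (bun1 A) (hproj v).
have Ez0 : hext (E := bun1 A) (fun x => z (pi2 x)) v0 = 0.
  by rewrite hext_hzero//; exact: (aff_on_z had).
have Ec0 : hext (E := bun1 A) c v0 = 0.
  by rewrite hext_hzero//; exact: (aff_on_c had).
have Ev0 : @bproj R (hat A) v0 = @hzero R (bun1' A) (pi2' (hproj v)).
  by apply: hull1_zero_proj => //; exact: hwt_hzero.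
(* [hsub] is meaningful within one fibre: [v] and the zero vector over its base point both project
   to the zero of the hull of [A2]. *)
have EP : hproj (@hpt R (hat A) v0) = hproj (@hpt R (hat A) v).
  by rewrite /= -[LHS]/(@bproj R (hat A) v0) Ev0 -Ev.
have dD : cdom d (hproj (@hproj R (hat A) (@hpt R (hat A) v))).
  by rewrite -[@hproj R (hat A) _]/(@bproj R (hat A) v) Ev.
have H (V : lmodType R) (f : tot (hat A) -> V) :
    @aff_on R (hat A) V (hproj (@hpt R (hat A) v)) f ->
    hext (E := hat A) f (core_of v) = f v - f v0.
  move=> af; rewrite /core_of hext_hsub//.
  rewrite (@hext_hpt R (hat A))// (@hext_hpt R (hat A))//.
  by move: af; rewrite -EP.
have EB : dhull_base (core_of v) = pi2' (hproj v).
  by rewrite /dhull_base -[@hproj R (hat A) _]/(@bproj R (hat A) v) Ev.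
split=> //; last by rewrite /core_c H ?Ec0 ?subr0//; exact: (hat_aff_c hA had).
apply/(core_predP had); first by rewrite EB.
split.
- apply/(hull1'_zero had); first by rewrite -/(dhull_base (core_of v)) EB.
  by rewrite -[@hproj R (hat A) _]/(@bproj R (hat A) v) Ev.
- by rewrite /core_y H ?subrr//; exact: (hat_aff_y hA had).
- by rewrite /core_of hwt_hsub// !hwt_hpt subrr.
Qed.

(** The conditions defining [core_incl] fix all coordinates of the vector, and the vector with these
    coordinates satisfies them; the chosen value is the translation by [e] in the c-directions. *)
Lemma core_inclP a (e : core A) : cdom d (pi2' a) -> core_proj e = pi2' a ->
  [/\ @hproj R (bun1 A) (core_incl a e) = a,
      hext (E := bun1 A) (fun x => z (pi2 x)) (core_incl a e) = 0,
      hext (E := bun1 A) c (core_incl a e) = core_coord e &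
      hwt (core_incl a e) = 0].
Proof.
move=> da Ee; rewrite /core_incl; case: xgetP => [v _ [Ev Bv Cv]|].
  have dv : cdom d (pi2' (hproj v)) by rewrite Ev.
  have [E1 E2 E3] := hat_projP hA had dv; rewrite Bv in E1 E2 E3.
  have [_ tz _ _] := had; have [_ af _ _] := triv_aff_chart tz da.
  have Ez : hext (E := bun1 A) (fun x => z (pi2 x)) v = 0.
    by rewrite -E2 hext_hzero.
  have Es : hwt v = 0 by rewrite -E3 hwt_hzero.
  have [C1 C2 C3] := core_ofP dv Ez Es.
  by split=> //; rewrite -C3 Cv.
move=> H; exfalso.
have [v [Ev Ez Ec Es]] := hull1_surj had 0 (core_coord e) 0 da.
have dv : cdom d (pi2' (hproj v)) by rewrite Ev.
apply: (H v); split=> //; first by rewrite (hull1_zero_proj dv Ez Es) Ev.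
have [C1 C2 C3] := core_ofP dv Ez Es.
apply: (core_eq hA had C1 (core_predE e)).
- by rewrite C2.
- by rewrite C2 Ev.
- by rewrite C3 Ec.
Qed.

Lemma core_diffP (x x' : dA A) : cdom d (pi2' (pi1 x)) -> pi1 x' = pi1 x ->
  pi2 x' = pi2 x ->
  [/\ core_pred (core_diff x x'), dhull_base (core_diff x x') = pi2' (pi1 x) &
      core_c c (core_diff x x') = c x' - c x].
Proof.
move=> dx E1 E2; rewrite /core_diff.
set v := @hsub R (bun1 A) _ _.
have Ev : hproj v = pi1 x by rewrite /= -[LHS]/(pi1 x') E1.
have dv : cdom d (pi2' (hproj v)) by rewrite Ev.
have H (V : lmodType R) (f : tot (bun1 A) -> V) : @aff_on R (bun1 A) V (pi1 x) f ->
    hext (E := bun1 A) f v = f x' - f x.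
  move=> af; have af' : @aff_on R (bun1 A) V (pi1 x') f by rewrite E1.
  rewrite hext_hsub//.
  by rewrite (@hext_hpt R (bun1 A))// (@hext_hpt R (bun1 A)).
have Ez : hext (E := bun1 A) (fun x => z (pi2 x)) v = 0.
  by rewrite H ?E2 ?subrr//; exact: (aff_on_z had).
have Es : hwt v = 0 by rewrite hwt_hsub ?hwt_hpt ?subrr//= -[RHS]/(pi1 x') E1.
have [C1 C2 C3] := core_ofP dv Ez Es.
split=> //; first by rewrite C2 Ev.
by rewrite C3 H//; exact: (aff_on_c had).
Qed.

End CoreTriv.
Arguments core_coord {r} c e.

Lemma core_pre_affine : pre_affine (core_bun A).
Proof.
have [[_ _ _ hM] _ H] := hA; split=> //; first exact: premfd_core.
move=> m; have [d [p [q [r [y [z [c [dm had]]]]]]]] := H m.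
by exists d, r, (core_coord c); split=> //; exact: (core_triv had).
Qed.

End CoreGlobal.
Arguments core_coord {R A r} c e.

(** * Existence of adapted coordinates *)

Section HalvingInvariant.
Context {R : realType} {n : nat}.

(* If [h t = 2 * h (t / 2)], then the difference quotients [h (t / 2^n) / (t / 2^n)]
   are all equal to [h t / t], hence to the derivative of [h] at 0. *)
Lemma halving_zero (h : 'rV[R]_1 -> 'rV[R]_n) : sat h 0 ->
  (forall t : R, h (const_mx (t / 2)) = 2^-1 *: h (const_mx t)) ->
  h (const_mx 1) = 0 -> forall t : R, h (const_mx t) = 0.
Proof.
move=> [U [oU U0 /(_ 1%N)[_ [/(_ 0 (const_mx 1) U0) dh _]]]] hh h1.
have h0 : h 0 = 0.
  have := hh 0; rewrite mul0r; have -> : const_mx 0 = 0 :> 'rV[R]_1.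
    by apply/rowP => i; rewrite !mxE.
  move=> /eqP; rewrite -subr_eq0 -{1}[h 0]scale1r -scalerBl scaler_eq0.
  case/orP => [/eqP E|/eqP->//]; exfalso.
  have : (1 - 2^-1 : R) != 0.
    by rewrite subr_eq0 eq_sym lt_eqF// invf_lt1// ltr1n.
  by rewrite E eqxx.
pose q (t : R) := t^-1 *: h (const_mx t).
have qD : q t @[t --> (0:R)^'] --> 'D_(const_mx 1) h 0.
  have := dh; rewrite /derivable -/(derive h 0 (const_mx 1)).
  apply: cvg_trans; apply: near_eq_cvg; near=> t.
  rewrite /q /= addr0 h0 subr0; congr (_ *: h _).
  by apply/rowP => i; rewrite !mxE mulr1.
have qh (t : R) m : q (t * 2^-1 ^+ m) = q t.
  elim: m => [|m IH]; first by rewrite expr0 mulr1.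
  rewrite -IH /q exprSr mulrA hh scalerA invfM invrK -mulrA.
  by rewrite divff ?mulr1.
have qE (t : R) : t != 0 -> q t = 'D_(const_mx 1) h 0.
  move=> t0.
  (* The halved weights tend to 0 without reaching it, so the constant value of [q] along them is
     its limit. *)
  have s0 : (fun m => t * 2^-1 ^+ m) @ \oo --> (0 : R)^'.
    have s0' : (fun m => t * 2^-1 ^+ m) @ \oo --> (0 : R).
      rewrite -(mulr0 t); apply: cvgM; first exact: cvg_cst.
      by apply: cvg_expr; rewrite ger0_norm// invf_lt1// ltr1n.
    move=> A [e /= e0 Ae]; have /cvgrPdist_lt/(_ e e0) := s0'.
    apply: (filterS (F := \oo)) => m Hm; apply: Ae; first exact: Hm.
    by rewrite /= mulf_neq0// expf_neq0// invr_neq0.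
  have := cvg_comp _ _ s0 qD.
  have -> : (q \o fun m => t * 2^-1 ^+ m) = (fun=> q t).
    by apply/funext => m; exact: qh.
  by move=> /(cvg_lim (@norm_hausdorff _ _)) <-; rewrite lim_cst.
have D0 : 'D_(const_mx 1) h 0 = 0.
  by rewrite -(qE 1)// /q h1 scaler0.
move=> t; have [->|t0] := eqVneq t 0.
  by rewrite -[RHS]h0; congr h; apply/rowP => i; rewrite !mxE.
have := qE t t0; rewrite D0 /q => /eqP; rewrite scaler_eq0 invr_eq0 (negbTE t0).
by move=> /eqP.
Unshelve. all: by end_near. Qed.

End HalvingInvariant.

(** Elimination gives B = L (U; 0) with [L] and [U] invertible; adjoining the columns L (0; 1) makes
    it [L] times a block diagonal matrix. *)
Lemma row_full_complete (F : fieldType) (q r : nat) (B : 'M[F]_(q + r, q)) :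
  row_full B -> exists P : 'M[F]_(q + r, r), row_mx B P \in unitmx.
Proof.
move=> /eqP rB; exists (col_ebase B *m col_mx 0 1%:M).
have EB : B = col_ebase B *m col_mx (row_ebase B) 0.
  rewrite -{1}[B]mulmx_ebase rB pid_mx_col -mulmxA mul_col_mx mul1mx mul0mx.
  by [].
rewrite {1}EB -mul_mx_row unitmx_mul col_ebase_unit /=.
rewrite -block_mxEh unitmxE det_ublock det1 mulr1 -unitmxE.
exact: row_ebase_unit.
Qed.

Section AffineOperations.
Context {R : realType}.
Implicit Types (E : abun R).

Lemma pre_affine_chart E (b : base E) : pre_affine E ->
  exists k (phi : tot E -> 'rV[R]_k), aff_chart b phi.
Proof.
move=> [_ _ /(_ b)[d [k [phi [db tphi]]]]].
by exists k, phi; exact: triv_aff_chart tphi db.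
Qed.

Lemma bproj_aff E l (e e' : tot E) : pre_affine E -> bproj e' = bproj e ->
  bproj (aff l e e') = bproj e.
Proof.
move=> hE Ee; have [k [phi [cl _ _ _]]] := pre_affine_chart (bproj e) hE.
exact: cl.
Qed.

Lemma aff_idem E l (e : tot E) : pre_affine E -> aff l e e = e.
Proof.
move=> hE; have [k [phi [cl af ip _]]] := pre_affine_chart (bproj e) hE.
apply: ip => //; first exact: cl.
by rewrite af// -scalerDl addrC subrK scale1r.
Qed.

Lemma aff_half_sym E (e e' : tot E) : pre_affine E -> bproj e' = bproj e ->
  aff 2^-1 e e' = aff 2^-1 e' e.
Proof.
move=> hE Ee; have [k [phi [cl af ip _]]] := pre_affine_chart (bproj e) hE.
apply: ip => //; try exact: cl.
rewrite !af// addrC; have -> // : 1 - 2^-1 = 2^-1 :> R.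
by field.
Qed.

Lemma aff1_left E (e e' : tot E) : pre_affine E -> bproj e' = bproj e ->
  aff 1 e e' = e.
Proof.
move=> hE Ee; have [k [phi [cl af ip _]]] := pre_affine_chart (bproj e) hE.
apply: ip => //; try exact: cl.
by rewrite !af// subrr scale0r addr0 scale1r.
Qed.

Lemma aff_half_mul E l (e e' : tot E) : pre_affine E -> bproj e' = bproj e ->
  aff (l / 2) e e' = aff 2^-1 (aff l e e') e'.
Proof.
move=> hE Ee; have [k [phi [cl af ip _]]] := pre_affine_chart (bproj e) hE.
have El : bproj (aff l e e') = bproj e by exact: cl.
apply: ip => //; try exact: cl.
rewrite !af// scalerDr !scalerA -addrA -scalerDl.
by congr (_ *: _ + _ *: _); field.
Qed.

(* [pll r e f g = e + r (g - f)] in the fibres of [E]. *)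
Definition pll E (r : R) (e f g : tot E) : tot E :=
  aff 2 (aff 2^-1 e (aff r g f)) f.

Lemma pllP E b r (e f g : tot E) : pre_affine E -> bproj e = b -> bproj f = b ->
  bproj g = b -> bproj (pll r e f g) = b /\
  forall (V : lmodType R) (F : tot E -> V), aff_on b F ->
    F (pll r e f g) = F e + r *: (F g - F f).
Proof.
move=> hE Ee Ef Eg.
have E1 : bproj (aff r g f) = b by rewrite bproj_aff ?Ef ?Eg.
have E2 : bproj (aff 2^-1 e (aff r g f)) = b by rewrite bproj_aff ?Ee ?E1.
split=> [|V F af]; first by rewrite /pll bproj_aff ?Ef ?E2.
rewrite /pll !af// !scalerDr !scalerA scalerN.
have -> : 2 * 2^-1 = 1 :> R by field.
have -> : 2 * (1 - 2^-1) * r = r by field.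
have -> : 2 * ((1 - 2^-1) * (1 - r)) = 1 - r by field.
rewrite scale1r -!addrA; congr (_ + (_ + _)).
by rewrite -scalerDl -scaleNr; congr (_ *: _); ring.
Qed.

End AffineOperations.

Lemma mchart_restrict (R : realType) (X : mfd R) (c : chart R X) (U : set X) :
  premfd X -> mchart c -> (forall x, U x -> mnear x U) -> U `<=` cdom c ->
  mchart (Chart U (cmap c)).
Proof.
move=> hX mc Uo Uc; apply: mchartI => //.
  move=> x x' /set_mem /= Ux /set_mem /= Ux'.
  by apply: cinjE (mchart_inj mc) _ _; exact: Uc.
move=> x /= Ux; have cx := Uc _ Ux.
split; [exact: Uo|exact: msat_cmap|].
exists (cinv c x); split; first exact: smap_cinv.
apply: filterS (mnear_chart hX (Uo x Ux) mc cx) => _ [x' [cx' Ux'] <-].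
by rewrite cinvK//; exact: mchart_inj.
Qed.

Lemma smap_pll (R : realType) (E : abun R) (Z : mfd R) (l : Z -> R)
    (e f g : Z -> tot E) t : pre_affine E -> premfd Z ->
  msat (fun s => const_mx (l s) : 'rV[R]_1) t -> smap e t -> smap f t -> smap g t ->
  mnear t [set s | bproj (f s) = bproj (e s) /\ bproj (g s) = bproj (e s)] ->
  smap (fun s => pll (l s) (e s) (f s) (g s)) t.
Proof.
move=> hE hZ sl se sf sg nE; have FZ := mnear_filter hZ t.
apply: smap_aff => //; first exact: msat_cst.
  apply: smap_aff => //; first exact: msat_cst.
    by apply: smap_aff => //; apply: filterS nE => s /= [-> ->].
  apply: filterS nE => s /= [Ef Eg].
  by rewrite bproj_aff ?Ef ?Eg.
apply: filterS nE => s /= [Ef Eg].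
have E1 : bproj (aff (l s) (g s) (f s)) = bproj (e s) by rewrite bproj_aff ?Ef ?Eg.
by rewrite bproj_aff ?E1 ?Ef.
Qed.

Section Existence.
Context {R : realType} {A : dab R} (hA : double_affine_bundle A).

Let p1 : pre_affine (bun1 A).
Proof. by have [[/affine_bundle_pre]] := hA. Qed.
Let p2 : pre_affine (bun2 A).
Proof. by have [[_ /affine_bundle_pre]] := hA. Qed.
Let p1' : pre_affine (bun1' A).
Proof. by have [[_ _ /affine_bundle_pre]] := hA. Qed.
Let p2' : pre_affine (bun2' A).
Proof. by have [[_ _ _ /affine_bundle_pre]] := hA. Qed.
Let h0 : premfd (dA A). Proof. by case: p1. Qed.
Let h1 : premfd (dA1 A). Proof. by case: p1. Qed.
Let h2 : premfd (dA2 A). Proof. by case: p2. Qed.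
Let hM : premfd (dM A). Proof. by case: p1'. Qed.
Let comm (x : dA A) : pi2' (pi1 x) = pi1' (pi2 x).
Proof. by have [_ ] := hA. Qed.

Let mor1 l (x x' : dA A) : pi2 x' = pi2 x ->
  pi1 (aff2 l x x') = aff2' l (pi1 x) (pi1 x').
Proof. by move=> E; have [_ _ [[_ _ _ H] _] _ _] := hA; exact: H (esym E). Qed.
Let mor2 l (x x' : dA A) : pi1 x' = pi1 x ->
  pi2 (aff1 l x x') = aff1' l (pi2 x) (pi2 x').
Proof. by move=> E; have [_ _ [_ [_ _ _ H]] _ _] := hA; exact: H (esym E). Qed.
Let surj (a : dA1 A) (b : dA2 A) : pi2' a = pi1' b -> exists x, pi1 x = a /\ pi2 x = b.
Proof. by have [_ _ _ H _] := hA; exact: H. Qed.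
Let inter l m (x u x' u' : dA A) : pi1 u = pi1 x -> pi1 u' = pi1 x' ->
  pi2 x' = pi2 x -> pi2 u' = pi2 u ->
  aff1 l (aff2 m x x') (aff2 m u u') = aff2 m (aff1 l x u) (aff1 l x' u').
Proof.
by move=> E1 E2 E3 E4; have [_ _ _ _ /(_ l)[[_ _ _ H] _]] := hA; apply: H.
Qed.
Let pr1 l (x x' : dA A) : pi1 x' = pi1 x -> pi1 (aff1 l x x') = pi1 x.
Proof. exact: (bproj_aff l p1). Qed.
Let pr2 l (x x' : dA A) : pi2 x' = pi2 x -> pi2 (aff2 l x x') = pi2 x.
Proof. exact: (bproj_aff l p2). Qed.

Let half1 (x x' : dA A) : pi1 x' = pi1 x -> aff1 2^-1 x x' = aff1 2^-1 x' x.
Proof. exact: (aff_half_sym p1). Qed.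
Let half2 (x x' : dA A) : pi2 x' = pi2 x -> aff2 2^-1 x x' = aff2 2^-1 x' x.
Proof. exact: (aff_half_sym p2). Qed.
Let idem1 l (x : dA A) : aff1 l x x = x.
Proof. exact: (aff_idem (E := bun1 A) l x p1). Qed.
Let idem2 l (x : dA A) : aff2 l x x = x.
Proof. exact: (aff_idem (E := bun2 A) l x p2). Qed.

(* By the interchange law both sides are equal to
   [aff2 2^-1 (aff1 2^-1 u v) (aff1 2^-1 v u)]. *)
Lemma aff_agree_half (u v : dA A) : pi1 v = pi1 u -> pi2 v = pi2 u ->
  aff1 2^-1 u v = aff2 2^-1 u v.
Proof.
move=> E1 E2.
have := @inter 2^-1 2^-1 u v v u E1 (esym E1) E2 (esym E2).
by rewrite -(half1 E1) idem2 -(half2 E2) idem1.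
Qed.

Lemma aff_agree l (x x' : dA A) : pi1 x' = pi1 x -> pi2 x' = pi2 x ->
  aff1 l x x' = aff2 l x x'.
Proof.
move=> E1 E2.
have [_ _ /(_ (pi2 x))[d [k [phi [db tphi]]]]] := p2.
have [cl af ip _] := triv_aff_chart tphi db.
pose f (u : 'rV[R]_1) : R := u ord0 ord0.
have P1 t : pi1 (aff1 t x x') = pi1 x by exact: pr1.
have P2 t : pi2 (aff1 t x x') = pi2 x.
  by rewrite mor2// E2; exact: (aff_idem (E := bun1' A) t (pi2 x) p1').
(* [phi] is affine for [aff2] and has no known relation to [aff1] beyond smoothness; the deviation
   of the curve of [aff1] from a straight line is studied as a function of the weight. *)
pose h (u : 'rV[R]_1) := phi (aff1 (f u) x x') - (f u *: phi x + (1 - f u) *: phi x').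
have sf (u : 'rV[R]_1) : sat f u by apply: sat_entry; exact: sat_id.
have sh : sat h 0.
  apply: satB; last first.
    apply: satD; apply: sat_scale; try exact: sat_cst; first exact: sf.
    have := satM (@sat_cst _ _ R (-1) 0) (sf 0).
    by move=> /(satD (@sat_cst _ _ R 1 0)); apply: sat_eq => u; rewrite mulN1r.
  apply/(@msat_euc R 1).
  have hU := premfd_euc (R := R) 1.
  apply: (@smap_msat R (euc 1) (dA A) k phi (fun u => aff1 (f u) x x') 0 hU h0).
    apply: (smap_aff (E := bun1 A) p1 hU).
    - apply/(@msat_euc R 1); apply: sat_const_mx; exact: sf.
    - exact: smap_cst.
    - exact: smap_cst.
    - by apply/mnear_euc; apply: filterS filterT => u _ /=.
  apply: (triv_msat p2 tphi); rewrite /= -[X in cdom d X]/(pi2 (aff1 (f 0) x x')).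
  by rewrite P2.
(* Halving the weight amounts to a midpoint with [x'], and midpoints of the two structures agree. *)
have hh t : h (const_mx (t / 2)) = 2^-1 *: h (const_mx t).
  have fE (s : R) : f (const_mx s) = s by rewrite /f mxE.
  rewrite /h !fE.
  have -> : aff1 (t / 2) x x' = aff2 2^-1 (aff1 t x x') x'.
    rewrite -[LHS]/(@aff R (bun1 A) _ _ _) aff_half_mul//.
    by rewrite -aff_agree_half//= ?P1 ?P2.
  have -> : phi (aff2 2^-1 (aff1 t x x') x') =
      2^-1 *: phi (aff1 t x x') + (1 - 2^-1) *: phi x'.
    by apply: af => //; exact: P2.
  by apply/rowP => i; rewrite !mxE; field.
have hz := halving_zero sh hh.
apply: ip; first exact: P2.
  by rewrite -[LHS]/(pi2 (aff2 l x x')) pr2.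
rewrite -[X in _ = phi X]/(@aff R (bun2 A) l x x') af//.
apply/eqP; rewrite -subr_eq0; apply/eqP.
have := hz _ l; rewrite /h /f !mxE; apply.
rewrite subrr scale0r addr0 scale1r; apply/eqP; rewrite subr_eq0; apply/eqP.
congr phi; exact: (aff1_left (E := bun1 A) p1 E1).
Qed.

(** Coordinates (pi2, w) on the part of [A] over a section [a] of [A1], with inverse [S]. *)
Record lift_family (U : set (dM A)) (a : dM A -> dA1 A) r
    (S : dA2 A -> 'rV[R]_r -> dA A) (w : dA A -> 'rV[R]_r) : Prop := LiftFamily {
  lf_pi1 : forall b v, U (pi1' b) -> pi1 (S b v) = a (pi1' b);
  lf_pi2 : forall b v, U (pi1' b) -> pi2 (S b v) = b;
  lf_w : forall b v, U (pi1' b) -> w (S b v) = v;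
  lf_S : forall x, U (pi2' (pi1 x)) -> pi1 x = a (pi2' (pi1 x)) -> S (pi2 x) (w x) = x;
  lf_aff : forall l x x', U (pi2' (pi1 x)) -> pi1 x = a (pi2' (pi1 x)) ->
    pi1 x' = pi1 x -> w (aff1 l x x') = l *: w x + (1 - l) *: w x';
  lf_smap : forall (Z : mfd R) (b : Z -> dA2 A) (v : Z -> 'rV[R]_r) t, premfd Z ->
    U (pi1' (b t)) -> smap b t -> msat v t -> smap (fun s => S (b s) (v s)) t;
  lf_msat : forall x, U (pi2' (pi1 x)) -> pi1 x = a (pi2' (pi1 x)) -> msat w x }.

Section AtPoint.
Context {m0 : dM A} {d : chart R (dM A)} {p q : nat} {y : dA1 A -> 'rV[R]_p}
  {z : dA2 A -> 'rV[R]_q}.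
Hypotheses (dm0 : cdom d m0) (ty : @affine_triv R (bun2' A) d p y)
  (tz : @affine_triv R (bun1' A) d q z).
Context (a0 : dA1 A).

Let md : mchart d. Proof. by case: ty. Qed.

Definition frame_pt (v : 'rV[R]_p) (m : dM A) : dA1 A :=
  @tpt R (bun2' A) d p y a0 m v.

Lemma frame_ptP v m : cdom d m -> pi2' (frame_pt v m) = m /\ y (frame_pt v m) = v.
Proof. exact: (tptP ty). Qed.

(** On a fibre of [pi1] the function z of [pi2] is affine in a fibre coordinate [phi], with linear
    part [B]. Since (pi1, pi2) is onto, [B] has full rank; constant columns [P] complete it to an
    invertible matrix near [m0], and phi P is the missing coordinate [w]. *)
Lemma lift_family_exists (v : 'rV[R]_p) : exists U r S w,
  [/\ mnear m0 U, U `<=` cdom d & @lift_family U (frame_pt v) r S w].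
Proof.
have [_ _ /(_ (frame_pt v m0))[d1 [N [phi [/= d1m0 tphi]]]]] := p1.
have [md1 _ st1 _] := tphi.
have [x0 _] := st1 _ 0 d1m0.
have [Ea0 Ya0] := frame_ptP v dm0.
pose W (m : dM A) := cdom d m /\ cdom d1 (frame_pt v m).
have FM := mnear_filter hM m0.
have sfr (Z : mfd R) (mm : Z -> dM A) t : premfd Z -> cdom d (mm t) -> smap mm t ->
    smap (fun s => frame_pt v (mm s)) t.
  move=> hZ dt sm; apply: (smap_tpt p2' ty a0 hZ dt sm); exact: msat_cst.
have nW m : W m -> mnear m W.
  move=> [dm d1m]; have FM' := mnear_filter hM m.
  apply: filterI; first exact: mnear_cdom.
  apply: (smap_mnear hM h1 (sfr _ id m hM dm (smap_id m hM))).
  exact: mnear_cdom.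
pose X m u : dA A := tpt d1 phi x0 (frame_pt v m) u.
have XP m u : W m -> [/\ pi1 (X m u) = frame_pt v m, phi (X m u) = u & pi1' (pi2 (X m u)) = m].
  move=> [dm d1m]; have [E1 E2] := tptP tphi x0 u d1m.
  split=> //; rewrite -comm -[pi1 _]/(@bproj R (bun1 A) _) E1.
  by have [] := frame_ptP v dm.
pose th m u := z (pi2 (X m u)).
have cph m : W m -> @aff_chart R (bun1 A) (frame_pt v m) N phi.
  by move=> [_ d1m]; exact: triv_aff_chart tphi d1m.
have azp m : W m -> @aff_on R (bun1 A) _ (frame_pt v m) (fun x => z (pi2 x)).
  move=> [dm d1m] l x x' /= Ex Ex'; have [Em _] := frame_ptP v dm.
  have {}Ex : pi1 x = frame_pt v m := Ex; have {}Ex' : pi1 x' = frame_pt v m := Ex'.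
  rewrite mor2 ?Ex ?Ex'//.
  have db : cdom d (pi1' (pi2 x)) by rewrite -comm Ex Em.
  have [_ af _ _] := triv_aff_chart tz db.
  by apply: af => //; rewrite /= -[LHS]comm -[RHS]comm Ex Ex'.
pose B m : 'M[R]_(N, q) := \matrix_i (th m (delta_mx ord0 i) - th m 0).
have thE m x : W m -> pi1 x = frame_pt v m -> z (pi2 x) = th m 0 + phi x *m B m.
  move=> Wm Ex; have [E1 E2 _] := XP m 0 Wm.
  rewrite (aff_on_coord (e0 := X m 0) (ej := fun j => X m (delta_mx ord0 j))
    (cph m Wm) (azp m Wm) Ex E1 E2); last first.
    by move=> j; have [] := XP m (delta_mx ord0 j) Wm.
  congr (_ + _); rewrite mulmx_sum_row; apply: eq_bigr => j _.
  by rewrite rowK.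
have Wm0 : W m0 by [].
(* A point of [A2] whose z exceeds [th m0 0] by a unit vector lifts to the fibre of [pi1]; the [phi]
   of the lift is a preimage of that unit vector. *)
have fullB : row_full (B m0).
  have H (i : 'I_q) : exists u : 'rV[R]_N, u *m B m0 = delta_mx ord0 i.
    have [_ _ stz _] := tz.
    have [b [/= Eb zb]] := stz _ (th m0 0 + delta_mx ord0 i) dm0.
    have [x [Ex1 Ex2]] := surj (etrans Ea0 (esym Eb)).
    exists (phi x); have := thE _ _ Wm0 Ex1.
    by rewrite Ex2 zb => /addrI.
  have [f Hf] := choice H; apply/row_fullP; exists (\matrix_i f i).
  by apply/row_matrixP => i; rewrite row_mul rowK Hf row1.
(* Full rank gives q <= N; [r] is the number of missing coordinates. *)
have [r EN] : exists r, N = (q + r)%N.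
  exists (N - q)%N; rewrite subnKC//.
  by rewrite -(eqP fullB) rank_leq_row.
subst N.
have [P uP] := row_full_complete fullB.
pose K m : 'M[R]_(q + r) := row_mx (B m) P.
pose mm (u : 'rV[R]_(cdim d)) := cinv d m0 u.
have mmK m : cdom d m -> mm (cmap d m) = m by move=> dm; rewrite /mm cinvK//; exact: mchart_inj.
have sth m u : W m -> sat (fun s => th (mm s) u) (cmap d m).
  move=> Wm; have [dm d1m] := Wm; have hU := premfd_euc (R := R) (cdim d).
  apply/(@msat_euc R).
  have smm : @smap R (euc (cdim d)) _ mm (cmap d m) by exact: smap_cinv.
  have sX : @smap R (euc (cdim d)) _ (fun s => X (mm s) u) (cmap d m).
    apply: (smap_tpt p1 tphi x0 hU); first by rewrite /= mmK.
      by apply: sfr => //; rewrite mmK.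
    exact: msat_cst.
  have [E1 E2 E3] := XP m u Wm.
  apply: (@smap_msat R (euc (cdim d)) _ q (fun x => z (pi2 x)) _ (cmap d m) hU h0 sX).
  apply: (@smap_msat R (dA A) (dA2 A) q z (@pi2 R A) _ h0 h2 (bproj_smap p2 _)).
  by apply: (triv_msat p1' tz); rewrite /= mmK// -[X in cdom d X]/(pi1' (pi2 (X m u))) E3.
have sK m : W m -> sat (fun s => K (mm s)) (cmap d m).
  move=> Wm; apply: sat_mx => i j.
  rewrite /K; case: (split_ordP j) => k ->; last first.
    by apply: (sat_eq _ (@sat_cst _ _ R (P i k) _)) => s; rewrite row_mxEr.
  apply: (sat_eq (f := fun s => (th (mm s) (delta_mx ord0 i) - th (mm s) 0) ord0 k)).
    by move=> s; rewrite row_mxEl !mxE.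
  by apply: sat_entry; apply: satB; exact: sth.
pose U (m : dM A) := W m /\ K m \in unitmx.
have nU : mnear m0 U.
  apply: filterI; first exact: nW.
  have sd : sat (fun s => (const_mx (\det (K (mm s))) : 'rV[R]_1)) (cmap d m0).
    by apply: sat_const_mx; apply: sat_det; exact: sK.
  have sdm : msat (fun m => const_mx (\det (K (mm (cmap d m)))) : 'rV[R]_1) m0.
    exact: (msat_comp hM sd (msat_cmap hM md dm0)).
  have : nbhs (const_mx (\det (K (mm (cmap d m0)))) : 'rV[R]_1)
      [set u | u ord0 ord0 != 0].
    set D := const_mx _.
    have s1 : sat (fun u : 'rV[R]_1 => u ord0 ord0 : R) D.
      by apply: sat_entry; exact: sat_id.
    have nD : nbhs (D ord0 ord0) [set t : R | t != 0].
      apply: open_nbhs_nbhs; split; first exact: open_neq.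
      by rewrite /= mxE mmK// -unitfE -unitmxE.
    exact: (sat_near s1 nD).
  move=> /(msat_continuous hM sdm) nn.
  apply: filterS2 nn (mnear_cdom hM md dm0) => m /= + dm.
  by rewrite mxE mmK// unitmxE unitfE.
(* The solution of phi K = (z - th 0, o): the coordinate of the point over [b] with w = o. *)
pose vec m b (o : 'rV[R]_r) := (row_mx (z b) o - row_mx (th m 0) 0) *m invmx (K m).
pose S b o := X (pi1' b) (vec (pi1' b) b o).
pose w x := phi x *m P.
have SP b o : U (pi1' b) -> [/\ pi1 (S b o) = frame_pt v (pi1' b), pi2 (S b o) = b & w (S b o) = o].
  move=> [Wb ub]; have [E1 E2 E3] := XP (pi1' b) (vec (pi1' b) b o) Wb.
  have EK : vec (pi1' b) b o *m K (pi1' b) = row_mx (z b) o - row_mx (th (pi1' b) 0) 0.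
    by rewrite /vec mulmxKV.
  move: EK; rewrite /K mul_mx_row opp_row_mx add_row_mx => /eq_row_mx[EB EP].
  split=> //; last by rewrite /w E2 EP subr0.
  have [_ _ ipz _] := triv_aff_chart tz Wb.1.
  apply: ipz => //=.
  by rewrite (thE _ _ Wb E1) E2 EB addrC subrK.
exists U, r, S, w; split=> //; first by move=> m [[]].
split.
- by move=> b o /SP-/(_ o)[].
- by move=> b o /SP-/(_ o)[].
- by move=> b o /SP-/(_ o)[].
- move=> x Ux Ex.
  have [Wx ux] := Ux; have [E1 E2 E3] := XP (pi2' (pi1 x)) (phi x) Wx.
  have -> : S (pi2 x) (w x) = X (pi2' (pi1 x)) (phi x).
    rewrite /S -comm /vec (thE _ _ Wx Ex) opp_row_mx add_row_mx addrAC subrr add0r subr0.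
    by rewrite /w -mul_mx_row mulmxK.
  have [_ _ ip _] := cph _ Wx.
  by apply: ip => //; rewrite E1.
- move=> l x x' [Wx _] Ex Ex'; have [_ af _ _] := cph _ Wx.
  rewrite /w !scalemxAl -mulmxDl; congr (_ *m _).
  by apply: af => //; rewrite /= -[LHS]/(pi1 x') Ex'.
- move=> Z b o t hZ [Wt ut] sb so.
  have [dt d1t] := Wt.
  have smb : smap (fun s => pi1' (b s)) t.
    exact: (smap_comp hZ h2 sb (bproj_smap p1' _)).
  apply: (smap_tpt p1 tphi x0 hZ); first exact: d1t.
    exact: sfr.
  have szb : msat (fun s => z (b s)) t.
    by apply: (smap_msat hZ h2 sb); apply: (triv_msat p1' tz).
  have smd : msat (fun s => cmap d (pi1' (b s))) t.
    by apply: (smap_msat hZ hM smb); exact: msat_cmap.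
  pose g (u : 'rV[R]_(cdim d + (q + r))) :=
    (rsubmx u - row_mx (th (mm (lsubmx u)) 0) 0) *m invmx (K (mm (lsubmx u))).
  apply: (msat_ext hZ (f := fun s => g (row_mx (cmap d (pi1' (b s))) (row_mx (z (b s)) (o s))))).
    have FZ := mnear_filter hZ t.
    apply: filterS (smap_mnear hZ hM smb (mnear_cdom hM md dt)) => s /= ds.
    by rewrite /g row_mxKl row_mxKr mmK.
  apply: msat_comp => //; last by do 2 apply: msat_row_mx => //.
  set u0 := row_mx _ _.
  have sl : sat lsubmx u0 by exact: sat_lsubmx (sat_id _).
  have El : lsubmx u0 = cmap d (pi1' (b t)) by rewrite row_mxKl.
  apply: sat_mulmx.
    apply: satB; first exact: sat_rsubmx (sat_id _).
    apply: sat_row_mx; last exact: sat_cst.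
    by apply: (sat_comp (g := fun s => th (mm s) 0) _ sl); rewrite El; exact: sth.
  apply: sat_invmx; first by rewrite El mmK.
  by apply: (sat_comp (g := fun s => K (mm s)) _ sl); rewrite El; exact: sK.
- move=> x [Wx _] Ex.
  have sphi : msat phi x by apply: (triv_msat p1 tphi); rewrite /= -[X in cdom _ X]/(pi1 x) Ex; case: Wx.
  apply: (msat_lift1 h0 _ sphi) => n k u su.
  by apply: sat_mulmx => //; exact: sat_cst.
Qed.

Definition affine_section (U : set (dM A)) (a : dM A -> dA1 A) (s : dA2 A -> dA A) :=
  [/\ forall b, U (pi1' b) -> pi1 (s b) = a (pi1' b),
      forall b, U (pi1' b) -> pi2 (s b) = b,
      forall l b b', U (pi1' b) -> pi1' b' = pi1' b ->
        s (aff1' l b b') = aff1 l (s b) (s b') &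
      forall (Z : mfd R) (b : Z -> dA2 A) t, premfd Z -> U (pi1' (b t)) ->
        smap b t -> smap (fun s' => s (b s')) t].

(** Combinations of points with w = 0 have w = 0, and (pi2, w) separates points over the frame
    section; so w = 0 cuts out a section of [pi2] that is affine along the fibres of [pi1']. *)
Lemma lift_section (U : set (dM A)) v r S w : U `<=` cdom d ->
  @lift_family U (frame_pt v) r S w ->
  affine_section U (frame_pt v) (fun b => S b 0).
Proof.
move=> Ud L; split.
- by move=> b Ub; exact: lf_pi1 L _ _ Ub.
- by move=> b Ub; exact: lf_pi2 L _ _ Ub.
- move=> l b b' Ub Eb; have Ub' : U (pi1' b') by rewrite Eb.
  have E1 := lf_pi1 L 0 Ub; have E1' := lf_pi1 L 0 Ub'.
  have E11 : pi1 (S b' 0) = pi1 (S b 0) by rewrite E1 E1' Eb.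
  have [Fm _] := frame_ptP v (Ud _ Ub).
  set x := aff1 l (S b 0) (S b' 0).
  have Ex : pi1 x = pi1 (S b 0) by exact: pr1.
  have Ux : U (pi2' (pi1 x)) by rewrite Ex E1 Fm.
  have Ex2 : pi2 x = aff1' l b b'.
    by rewrite mor2// (lf_pi2 L 0 Ub) (lf_pi2 L 0 Ub').
  have Ex' : pi1 x = frame_pt v (pi2' (pi1 x)) by rewrite Ex E1 Fm.
  have Uxx : U (pi2' (pi1 (S b 0))) by rewrite E1 Fm.
  have Exx : pi1 (S b 0) = frame_pt v (pi2' (pi1 (S b 0))) by rewrite E1 Fm.
  have wx : w x = 0.
    rewrite (lf_aff L l Uxx Exx E11) (lf_w L 0 Ub) (lf_w L 0 Ub').
    by rewrite !scaler0 addr0.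
  by rewrite -[RHS](lf_S L Ux Ex') Ex2 wx.
- move=> Z b t hZ Ub sb; apply: (lf_smap L hZ Ub sb); exact: msat_cst.
Qed.

Lemma affine_section_sub (U U' : set (dM A)) a s :
  U' `<=` U -> affine_section U a s -> affine_section U' a s.
Proof.
move=> UU [s1 s2 s3 s4]; split.
- by move=> b /UU; exact: s1.
- by move=> b /UU; exact: s2.
- by move=> l b b' /UU; exact: s3.
- by move=> Z b t hZ /UU; exact: s4.
Qed.

Section Shift.
Context {U : set (dM A)} {s0 : dA2 A -> dA A} {si : 'I_p -> dA2 A -> dA A}.
Hypotheses (Uo : forall m, U m -> mnear m U) (Ud : U `<=` cdom d)
  (s0P : affine_section U (frame_pt 0) s0)
  (siP : forall i, affine_section U (frame_pt (delta_mx ord0 i)) (si i)).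

(* [shift x t] is [x + \sum_i t_i (si_i - s0)] in the fibre of [pi2]. *)
Definition shift_seq (t : 'rV[R]_p) (b : dA2 A) (x : dA A) (r : seq 'I_p) : dA A :=
  foldr (fun i e => @pll R (bun2 A) (t ord0 i) e (s0 b) (si i b)) x r.

Definition shift (x : dA A) (t : 'rV[R]_p) : dA A :=
  shift_seq t (pi2 x) x (enum 'I_p).

Lemma shift_seqP t b x r : U (pi1' b) -> pi2 x = b ->
  pi2 (shift_seq t b x r) = b /\
  forall (V : lmodType R) (F : dA A -> V), @aff_on R (bun2 A) V b F ->
    F (shift_seq t b x r) =
    F x + \sum_(i <- r) t ord0 i *: (F (si i b) - F (s0 b)).
Proof.
move=> Ub Ex; have [_ s02 _ _] := s0P.
elim: r => [|i r [IH1 IH2]]; first by split=> // V F _; rewrite big_nil addr0.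
have [_ si2 _ _] := siP i.
have [H1 H2] := @pllP R (bun2 A) b (t ord0 i) _ _ _ p2 IH1 (s02 _ Ub) (si2 _ Ub).
split; first exact: H1.
by move=> V F aF; rewrite [LHS]H2// IH2// big_cons -addrA [in RHS](addrC (_ *: _)).
Qed.

Lemma shiftP x t : U (pi1' (pi2 x)) -> pi2 (shift x t) = pi2 x /\
  forall (V : lmodType R) (F : dA A -> V), @aff_on R (bun2 A) V (pi2 x) F ->
    F (shift x t) =
    F x + \sum_i t ord0 i *: (F (si i (pi2 x)) - F (s0 (pi2 x))).
Proof.
move=> Ub; have [H1 H2] := shift_seqP t (enum 'I_p) Ub erefl.
by split=> // V F /H2; rewrite big_enum.
Qed.

Lemma aff_on_y b : cdom d (pi1' b) ->
  @aff_on R (bun2 A) _ b (fun x => y (pi1 x)).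
Proof.
move=> db l x x' Ex Ex'.
have {}Ex : pi2 x = b := Ex; have {}Ex' : pi2 x' = b := Ex'.
rewrite mor1 ?Ex ?Ex'//.
have dx : cdom d (pi2' (pi1 x)) by rewrite comm Ex.
have [_ af _ _] := triv_aff_chart ty dx.
by apply: af => //; rewrite /= [LHS]comm [RHS]comm Ex Ex'.
Qed.

(** The reference points have y equal to 0 and to the unit vectors, so the coefficients [t] are
    exactly the displacement of y. *)
Lemma shift_y x t : U (pi1' (pi2 x)) -> y (pi1 (shift x t)) = y (pi1 x) + t.
Proof.
move=> Ub; have [_ H] := shiftP t Ub.
rewrite (H _ _ (aff_on_y (Ud Ub))); congr (_ + _).
have [s01 _ _ _] := s0P; rewrite s01//.
have [_ ->] := frame_ptP 0 (Ud Ub).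
rewrite [RHS]row_sum_delta; apply: eq_bigr => i _.
have [si1 _ _ _] := siP i; rewrite si1//.
by have [_ ->] := frame_ptP (delta_mx ord0 i) (Ud Ub); rewrite subr0.
Qed.

(** All translations stay in one affine fibre of [pi2] and use vectors depending only on its base
    point, hence they add. *)
Lemma shift_shift x t t' : U (pi1' (pi2 x)) ->
  shift (shift x t) t' = shift x (t + t').
Proof.
move=> Ub; have [k [phi cphi]] := @pre_affine_chart R (bun2 A) (pi2 x) p2.
have [_ af ip _] := cphi.
have [E1 H1] := shiftP t Ub; have [E2 H2] := shiftP (t + t') Ub.
have Ub' : U (pi1' (pi2 (shift x t))) by rewrite E1.
have [E3 H3] := shiftP t' Ub'.
apply: ip; [by rewrite -[LHS]/(pi2 (shift (shift x t) t')) E3 E1|exact: E2|].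
rewrite H3 ?E1// H1// H2// -addrA; congr (_ + _).
by rewrite -big_split /=; apply: eq_bigr => i _; rewrite mxE scalerDl.
Qed.

Lemma shift0 x : U (pi1' (pi2 x)) -> shift x 0 = x.
Proof.
move=> Ub; have [k [phi cphi]] := @pre_affine_chart R (bun2 A) (pi2 x) p2.
have [_ af ip _] := cphi; have [E1 H1] := shiftP 0 Ub.
apply: ip => //; rewrite H1// big1 ?addr0// => i _.
by rewrite mxE scale0r.
Qed.

(** The translating vectors depend on the common [pi2] only, so the translate is affine in point and
    coefficient jointly. Two coefficients occur because points of one fibre of [pi2] differ in y. *)
Lemma shift_aff2 l x x' t t' : U (pi1' (pi2 x)) -> pi2 x' = pi2 x ->
  shift (aff2 l x x') (l *: t + (1 - l) *: t') = aff2 l (shift x t) (shift x' t').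
Proof.
move=> Ub Ex; have [k [phi cphi]] := @pre_affine_chart R (bun2 A) (pi2 x) p2.
have [_ af ip _] := cphi.
have Ub' : U (pi1' (pi2 x')) by rewrite Ex.
have E0 : pi2 (aff2 l x x') = pi2 x by exact: pr2.
have Ub2 : U (pi1' (pi2 (aff2 l x x'))) by rewrite E0.
have [E1 H1] := shiftP t Ub; have [E2 H2] := shiftP t' Ub'.
have [E3 H3] := shiftP (l *: t + (1 - l) *: t') Ub2.
have E4 : pi2 (shift x' t') = pi2 (shift x t) by rewrite E1 E2 Ex.
apply: ip; [by rewrite -[LHS]/(pi2 (shift _ _)) E3 E0|by rewrite -[LHS]/(pi2 (aff2 l _ _)) pr2|].
rewrite H3 ?E0// -[X in _ = phi X]/(@aff R (bun2 A) l (shift x t) (shift x' t')).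
rewrite [in RHS]af//; last by rewrite -[LHS]/(pi2 _) E4.
rewrite H1// H2 ?Ex//.
rewrite -[aff2 l x x']/(@aff R (bun2 A) l x x') af// !scalerDr addrACA; congr (_ + _).
rewrite !scaler_sumr -big_split /=; apply: eq_bigr => i _.
by rewrite !mxE !scalerA -scalerDl.
Qed.

(** [pll] is a composite of three [aff2], and interchange is applied to each of them; the equalities
    [G1] to [Q2] make it applicable. *)
Lemma pll_interchange l r (e f g e' f' g' : dA A) :
  pi1 e' = pi1 e -> pi1 f' = pi1 f -> pi1 g' = pi1 g ->
  pi2 f = pi2 e -> pi2 g = pi2 e -> pi2 f' = pi2 e' -> pi2 g' = pi2 e' ->
  pi1 (@pll R (bun2 A) r e' f' g') = pi1 (@pll R (bun2 A) r e f g) /\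
  @pll R (bun2 A) r (aff1 l e e') (aff1 l f f') (aff1 l g g') =
  aff1 l (@pll R (bun2 A) r e f g) (@pll R (bun2 A) r e' f' g').
Proof.
move=> E1 E2 E3 F1 F2 F3 F4; rewrite /pll /=.
have G1 : pi2 (aff2 r g f) = pi2 e by rewrite pr2 ?F1 ?F2.
have G2 : pi2 (aff2 r g' f') = pi2 e' by rewrite pr2 ?F3 ?F4.
have G3 : pi2 (aff2 2^-1 e (aff2 r g f)) = pi2 e by rewrite pr2 ?G1.
have G4 : pi2 (aff2 2^-1 e' (aff2 r g' f')) = pi2 e' by rewrite pr2 ?G2.
have Q1 : pi1 (aff2 r g' f') = pi1 (aff2 r g f).
  by rewrite !mor1 ?F1 ?F2 ?F3 ?F4// E2 E3.
have Q2 : pi1 (aff2 2^-1 e' (aff2 r g' f')) = pi1 (aff2 2^-1 e (aff2 r g f)).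
  by rewrite mor1 ?G2// [in RHS]mor1 ?G1// Q1 E1.
split; first by rewrite mor1 ?G4// [in RHS]mor1 ?G3// Q2 E2.
rewrite inter ?Q2 ?G3 ?G4//; congr aff2.
rewrite inter ?Q1 ?G1 ?G2//; congr aff2.
by rewrite inter ?F1 ?F2 ?F3 ?F4.
Qed.

(** The frame sections are affine along the fibres of [pi1'], so at each stage all arguments of
    [pll] are combinations for the first structure and [pll_interchange] applies. *)
Lemma shift_aff1 l x x' t : U (pi1' (pi2 x)) -> pi1 x' = pi1 x ->
  shift (aff1 l x x') t = aff1 l (shift x t) (shift x' t).
Proof.
move=> Ub Ex; have Eb : pi1' (pi2 x') = pi1' (pi2 x) by rewrite -!comm Ex.
have Ub' : U (pi1' (pi2 x')) by rewrite Eb.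
have [s01 s02 s03 _] := s0P.
rewrite /shift mor2//.
suff /(_ (enum 'I_p))[_ ->//] : forall r,
  pi1 (shift_seq t (pi2 x') x' r) = pi1 (shift_seq t (pi2 x) x r) /\
  shift_seq t (aff1' l (pi2 x) (pi2 x')) (aff1 l x x') r =
  aff1 l (shift_seq t (pi2 x) x r) (shift_seq t (pi2 x') x' r).
elim=> [|i r [IH1 IH2]] //=.
have [si1 si2 si3 _] := siP i.
have [E1 _] := shift_seqP t r Ub erefl; have [E2 _] := shift_seqP t r Ub' erefl.
rewrite IH2 s03// si3//.
by apply: pll_interchange => //; rewrite ?s01 ?si1 ?s02 ?si2 ?Eb ?E1 ?E2.
Qed.

Lemma smap_shift (Z : mfd R) (x : Z -> dA A) (t : Z -> 'rV[R]_p) z0 : premfd Z ->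
  U (pi1' (pi2 (x z0))) -> smap x z0 -> msat t z0 ->
  smap (fun s => shift (x s) (t s)) z0.
Proof.
move=> hZ Ux sx st; have FZ := mnear_filter hZ z0.
have sb : smap (fun s => pi2 (x s)) z0 by exact: (smap_comp hZ h0 sx (bproj_smap p2 _)).
have sm : smap (fun s => pi1' (pi2 (x s))) z0.
  exact: (smap_comp hZ h2 sb (bproj_smap p1' _)).
have nU := smap_mnear hZ hM sm (Uo Ux).
have [_ s02 _ s04] := s0P.
rewrite /shift; elim: (enum 'I_p) => [|i r IH] //=.
have [_ si2 _ si4] := siP i.
apply: (@smap_pll R (bun2 A) Z (fun s => t s ord0 i)) => //.
- by apply: (msat_lift1 hZ _ st) => n k u su; apply: sat_const_mx; exact: sat_entry.
- exact: s04.
- exact: si4.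
apply: filterS nU => s /= Us.
have [E1 _] := shift_seqP (t s) r Us erefl.
by split; [rewrite [LHS]s02//|rewrite [LHS]si2//]; apply/esym.
Qed.

Context {r : nat} {S : dA2 A -> 'rV[R]_r -> dA A} {w : dA A -> 'rV[R]_r}.
Hypothesis L : lift_family U (frame_pt 0) S w.

Definition shift_coord (x : dA A) : 'rV[R]_r := w (shift x (- y (pi1 x))).

Lemma shift_base x : U (pi2' (pi1 x)) ->
  let x' := shift x (- y (pi1 x)) in
  [/\ pi2 x' = pi2 x, pi1 x' = frame_pt 0 (pi2' (pi1 x)) & pi2' (pi1 x') = pi2' (pi1 x)].
Proof.
move=> Ux x'; have Ub : U (pi1' (pi2 x)) by rewrite -comm.
have [E1 _] := shiftP (- y (pi1 x)) Ub.
have E2 : pi2' (pi1 x') = pi2' (pi1 x) by rewrite comm E1 comm.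
split=> //; have [F1 F2] := frame_ptP 0 (Ud Ux).
have [_ _ ip _] := triv_aff_chart ty (Ud Ux).
by apply: ip => //; rewrite F2 /x' shift_y// subrr.
Qed.

Lemma shift_param b v t : U (pi1' b) ->
  let x := shift (S b v) t in
  [/\ pi2 x = b, y (pi1 x) = t & shift_coord x = v].
Proof.
move=> Ub x; have E2 := lf_pi2 L v Ub; have E1 := lf_pi1 L v Ub.
have US : U (pi1' (pi2 (S b v))) by rewrite E2.
have [H _] := shiftP t US.
have [_ F2] := frame_ptP 0 (Ud Ub).
have Ey : y (pi1 x) = t by rewrite /x shift_y// E1 F2 add0r.
split=> //; first by rewrite /x H.
by rewrite /shift_coord Ey shift_shift// subrr shift0// (lf_w L).
Qed.

Lemma shift_coord_inj x x' : U (pi2' (pi1 x)) -> pi1 x' = pi1 x ->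
  pi2 x' = pi2 x -> shift_coord x' = shift_coord x -> x' = x.
Proof.
move=> Ux E1 E2; rewrite /shift_coord => Ew.
have Ux' : U (pi2' (pi1 x')) by rewrite E1.
have [F1 F2 F3] := shift_base Ux; have [G1 G2 G3] := shift_base Ux'.
rewrite E1 in Ew G1 G2 G3.
have Ub : U (pi1' (pi2 x)) by rewrite -comm.
have Ub' : U (pi1' (pi2 x')) by rewrite -comm.
have Es : shift x' (- y (pi1 x)) = shift x (- y (pi1 x)).
  have <- := lf_S L (x := shift x' (- y (pi1 x))); rewrite ?G3//.
  by rewrite G1 Ew E2 -F1 (lf_S L)// F3.
have := congr1 (shift ^~ (y (pi1 x))) Es.
by rewrite /= !shift_shift// addNr !shift0.
Qed.

Lemma shift_coord_aff1 l x x' : U (pi2' (pi1 x)) -> pi1 x' = pi1 x ->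
  shift_coord (aff1 l x x') = l *: shift_coord x + (1 - l) *: shift_coord x'.
Proof.
move=> Ux E1; have Ux' : U (pi2' (pi1 x')) by rewrite E1.
have [F1 F2 F3] := shift_base Ux; have [G1 G2 G3] := shift_base Ux'.
rewrite /shift_coord pr1// E1 shift_aff1//; last by rewrite -comm.
rewrite E1 in G2 G3.
by rewrite (lf_aff L)// ?F3// G2.
Qed.

(** After translation both points lie over the origin of the frame and over one point of [A2], that
    is, in one double fibre. There [aff_agree] exchanges the second structure for the first, for
    which [w] is affine. *)
Lemma shift_coord_aff2 l x x' : U (pi2' (pi1 x)) -> pi2 x' = pi2 x ->
  shift_coord (aff2 l x x') = l *: shift_coord x + (1 - l) *: shift_coord x'.
Proof.
move=> Ux E2; have Em : pi2' (pi1 x') = pi2' (pi1 x) by rewrite !comm E2.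
have Ux' : U (pi2' (pi1 x')) by rewrite Em.
have [F1 F2 F3] := shift_base Ux; have [G1 G2 G3] := shift_base Ux'.
rewrite /shift_coord.
have -> : - y (pi1 (aff2 l x x')) = l *: (- y (pi1 x)) + (1 - l) *: (- y (pi1 x')).
  have db : cdom d (pi1' (pi2 x)) by rewrite -comm; exact: Ud.
  have := aff_on_y db l erefl E2; rewrite /= => ->.
  by rewrite opprD !scalerN.
rewrite shift_aff2//; last by rewrite -comm.
rewrite -aff_agree; [|by rewrite F2 G2 Em|by rewrite F1 G1].
by rewrite (lf_aff L)// ?F3// G2 F2 Em.
Qed.

Definition shift_chart : chart R (dM A) := Chart U (cmap d).

Lemma shift_adapted : adapted shift_chart y z shift_coord.
Proof.
have mU : mchart shift_chart by exact: mchart_restrict.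
have tyU : @affine_triv R (bun2' A) shift_chart p y by exact: triv_restrict ty mU Ud.
have tzU : @affine_triv R (bun1' A) shift_chart q z by exact: triv_restrict tz mU Ud.
have sat_b (x : dA A) : @smap R (dA A) (dM A) (fun x => pi2' (pi1 x)) x.
  exact: (@smap_comp R (dA A) (dA1 A) (dM A) (@pi2' R A) (@pi1 R A) x h0 h1 (bproj_smap p1 _) (bproj_smap p2' _)).
pose C1 : chart R (dA A) := fchart (@pi1 R A) (fchart (@pi2' R A) shift_chart y)
  (fun x => row_mx (z (pi2 x)) (shift_coord x)).
have mC1 : mchart C1.
  apply: mchartI => //.
    move=> x x' /set_mem /= Ux /set_mem /= Ux'.
    move=> /eq_row_mx[/eq_row_mx[Em Ey] /eq_row_mx[Ez Ec]].
    have {}Em := cinjE (mchart_inj md) (Ud Ux) (Ud Ux') Em.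
    have E1 : pi1 x' = pi1 x.
      have [_ _ ip _] := triv_aff_chart ty (Ud Ux').
      by apply: ip => //; exact: Em.
    have Ub : cdom d (pi1' (pi2 x)) by rewrite -comm; exact: Ud.
    have E2 : pi2 x' = pi2 x.
      have [_ _ ip _] := triv_aff_chart tz Ub.
      by apply: ip => //; rewrite /= -[LHS]comm -[RHS]comm E1.
    by apply/esym; exact: shift_coord_inj.
  move=> x /= Ux; have Ub : U (pi1' (pi2 x)) by rewrite -comm.
  have dx := Ud Ux.
  have sy : msat (fun x => y (pi1 x)) x.
    apply: (@smap_msat R (dA A) (dA1 A) p y (@pi1 R A) x h0 h1 (bproj_smap p1 _)).
    exact: (triv_msat p2' ty).
  have sz : msat (fun x => z (pi2 x)) x.
    apply: (@smap_msat R (dA A) (dA2 A) q z (@pi2 R A) x h0 h2 (bproj_smap p2 _)).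
    by apply: (triv_msat p1' tz); rewrite /= -[X in cdom d X]comm.
  have sc : msat shift_coord x.
    have ss : smap (fun x => shift x (- y (pi1 x))) x.
      apply: smap_shift => //; first exact: smap_id.
      by apply: (msat_lift1 h0 _ sy) => n k u; exact: satN.
    apply: (@smap_msat R (dA A) (dA A) r w _ x h0 h0 ss).
    have [F1 F2 F3] := shift_base Ux.
    by apply: (lf_msat L); rewrite ?F3.
  split.
  - exact: (smap_mnear h0 hM (sat_b x) (Uo Ux)).
  - apply: msat_row_mx => //; last exact: msat_row_mx.
    apply: msat_row_mx => //.
    apply: (@smap_msat R (dA A) (dM A) _ (cmap d) _ x h0 hM (sat_b x)).
    exact: msat_cmap.
  have hU := premfd_euc (R := R) ((cdim d + p) + (q + r)).
  pose mm (u : 'rV[R]_((cdim d + p) + (q + r))) := cinv d (pi2' (pi1 x)) (lsubmx (lsubmx u)).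
  pose bb u : dA2 A := @tpt R (bun1' A) d q z (pi2 x) (mm u) (lsubmx (rsubmx u)).
  (* The inverse of the coordinates: the point of [A2] is rebuilt from (x, z), lifted over the
     origin of the frame with w equal to the c-block, then translated by the y-block. *)
  pose I u := shift (S (bb u) (rsubmx (rsubmx u))) (rsubmx (lsubmx u)).
  exists I; set u0 := row_mx _ _.
  have sll : sat (fun u : 'rV[R]_((cdim d + p) + (q + r)) => lsubmx (lsubmx u)) u0.
    by smooth_coord.
  have Ell : lsubmx (lsubmx u0) = cmap d (pi2' (pi1 x)) by rewrite !row_mxKl.
  have Emm : mm u0 = pi2' (pi1 x) by rewrite /mm Ell cinvx.
  have smm : @smap R (euc _) _ mm u0.
    apply: (smap_cinv_comp _ hM hU md dx) => //.
    exact/(@msat_euc R).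
  have Ebb u : cdom d (mm u) -> pi1' (bb u) = mm u /\ z (bb u) = lsubmx (rsubmx u).
    exact: (tptP tz).
  have dmm : cdom d (mm u0) by rewrite Emm.
  have [Eb1 _] := Ebb u0 dmm.
  have sbb : @smap R (euc _) _ bb u0.
    apply: (smap_tpt p1' tz _ hU) => //; try exact: dmm.
    by apply/(@msat_euc R); smooth_coord.
  have Ubb : U (pi1' (bb u0)) by rewrite Eb1 ?Emm.
  split.
    have sS : @smap R (euc _) _ (fun u => S (bb u) (rsubmx (rsubmx u))) u0.
      by apply: (lf_smap L hU) => //; apply/(@msat_euc R); smooth_coord.
    apply: (smap_shift hU) => //; first by rewrite (lf_pi2 L).
    by apply/(@msat_euc R); smooth_coord.
  have : \forall u \near u0, (cmap d @` (cdom d `&` U)) (lsubmx (lsubmx u)).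
    by apply: (sat_near sll); rewrite Ell; exact: (mnear_chart hM (Uo Ux)).
  apply: filterS => u [m [dm Um] Em].
  have Emu : mm u = m by rewrite /mm -Em cinvK//; exact: mchart_inj.
  have [F1 F2] : pi1' (bb u) = m /\ z (bb u) = lsubmx (rsubmx u).
    by have [] := Ebb u; rewrite Emu.
  have Ub' : U (pi1' (bb u)) by rewrite F1.
  have [G1 G2 G3] := shift_param (rsubmx (rsubmx u)) (rsubmx (lsubmx u)) Ub'.
  have EI : pi2' (pi1 (I u)) = m by rewrite comm G1.
  split; first by rewrite /= EI.
  by rewrite /= EI G1 G2 G3 F2 Em !hsubmxK.
have surjU a b v : U (pi2' a) -> pi2' a = pi1' b ->
    exists x, [/\ pi1 x = a, pi2 x = b & shift_coord x = v].
  move=> Ua Eab; have Ub : U (pi1' b) by rewrite -Eab.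
  have [G1 G2 G3] := shift_param v (y a) Ub.
  exists (shift (S b v) (y a)); split=> //.
  have [_ _ ip _] := triv_aff_chart ty (Ud Ua).
  by apply: ip => //; rewrite /= [LHS]comm G1.
split=> //; split=> //=.
- by case: tyU.
- move=> a v Ua.
  have [_ _ stz _] := tz; have [b [/= Eb Ez]] := stz (pi2' a) (lsubmx v) (Ud Ua).
  have [x [E1 E2 E3]] := surjU a b (rsubmx v) Ua (esym Eb).
  by exists x; rewrite E2 Ez E3 hsubmxK.
- move=> l x x' Ux Ex; split; first exact: pr1.
  have {}Ex : pi1 x' = pi1 x := Ex.
  have Ub : cdom d (pi1' (pi2 x)) by rewrite -comm; exact: Ud.
  have [_ af _ _] := triv_aff_chart tz Ub.
  have Eb : pi1' (pi2 x') = pi1' (pi2 x) by rewrite -!comm Ex.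
  rewrite mor2// shift_coord_aff1// !scale_row_mx add_row_mx; congr row_mx.
  exact: af.
- by case: tzU.
- pose r1 (u : 'rV[R]_((cdim d + p) + (q + r))) : 'rV[R]_((cdim d + q) + (p + r)) :=
    row_mx (row_mx (lsubmx (lsubmx u)) (lsubmx (rsubmx u)))
           (row_mx (rsubmx (lsubmx u)) (rsubmx (rsubmx u))).
  pose r2 (u : 'rV[R]_((cdim d + q) + (p + r))) : 'rV[R]_((cdim d + p) + (q + r)) :=
    row_mx (row_mx (lsubmx (lsubmx u)) (lsubmx (rsubmx u)))
           (row_mx (rsubmx (lsubmx u)) (rsubmx (rsubmx u))).
  pose C2 : chart R (dA A) := fchart (@pi2 R A) (fchart (@pi1' R A) shift_chart z)
    (fun x => row_mx (y (pi1 x)) (shift_coord x)).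
  apply: (@mchart_post R (dA A) C1 C2 r1 r2 h0 mC1).
  + by move=> x /=; rewrite comm.
  + by move=> x /= Ux; rewrite /r1 !(row_mxKl, row_mxKr) -comm.
  + by move=> u; rewrite /r1; smooth_coord.
  + by move=> u; rewrite /r2; smooth_coord.
  + by move=> u; rewrite /r1 /r2 !(row_mxKl, row_mxKr, hsubmxK).
  + by move=> u; rewrite /r1 /r2 !(row_mxKl, row_mxKr, hsubmxK).
- move=> b v Ub.
  have [_ _ sty _] := ty; have [a [/= Ea Ey]] := sty (pi1' b) (lsubmx v) (Ud Ub).
  have Ua : U (pi2' a) by rewrite Ea.
  have [x [E1 E2 E3]] := surjU a b (rsubmx v) Ua Ea.
  by exists x; rewrite E1 Ey E3 hsubmxK.
- move=> l x x' Ub Ex; split; first exact: pr2.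
  have {}Ex : pi2 x' = pi2 x := Ex.
  have Ux : U (pi2' (pi1 x)) by rewrite comm.
  rewrite shift_coord_aff2// !scale_row_mx add_row_mx; congr row_mx.
  by apply: (aff_on_y (Ud Ub)).
Qed.

End Shift.

Lemma adapted_at : exists (dU : chart R (dM A)) r (c : dA A -> 'rV[R]_r),
  cdom dU m0 /\ adapted dU y z c.
Proof.
have [U0 [r [S [w [nU0 dU0 L0]]]]] := lift_family_exists 0.
have H (i : 'I_p) : exists Us : set (dM A) * (dA2 A -> dA A),
    [/\ mnear m0 Us.1, Us.1 `<=` cdom d &
        affine_section Us.1 (frame_pt (delta_mx ord0 i)) Us.2].
  have [Ui [ri [Si [wi [nUi dUi Li]]]]] := lift_family_exists (delta_mx ord0 i).
  by exists (Ui, fun b => Si b 0); split=> //=; exact: lift_section Li.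
have [Us Hs] := choice H.
have FM := mnear_filter hM m0.
pose U' m := U0 m /\ forall i, (Us i).1 m.
have nI : mnear m0 (fun m => forall i, (Us i).1 m).
  by apply: (@filter_forall _ _ (fun i => (Us i).1) (mnear m0) _ _) => i; have [] := Hs i.
have nU' : mnear m0 U' by apply: filterS2 nU0 nI.
(* The interior of [U']: chart domains have to be open. *)
pose U m := mnear m U'.
have UU' : U `<=` U' by move=> m; exact: mnear_self.
have Uo m : U m -> mnear m U by exact: mnear_mnear.
have Ud : U `<=` cdom d by move=> m /UU'[/dU0].
have L : lift_family U (frame_pt 0) S w.
  split.
  - by move=> b v /UU'[U0b _]; exact: (lf_pi1 L0).
  - by move=> b v /UU'[U0b _]; exact: (lf_pi2 L0).
  - by move=> b v /UU'[U0b _]; exact: (lf_w L0).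
  - by move=> x /UU'[U0b _]; exact: (lf_S L0).
  - by move=> l x x' /UU'[U0b _]; exact: (lf_aff L0).
  - by move=> Z b v t hZ /UU'[U0b _]; exact: (lf_smap L0).
  - by move=> x /UU'[U0b _]; exact: (lf_msat L0).
have s0P := lift_section Ud L.
have siP i : affine_section U (frame_pt (delta_mx ord0 i)) (Us i).2.
  have [_ _] := Hs i; apply: affine_section_sub => m /UU'[_]; exact.
exists (@shift_chart U), r, (@shift_coord (fun b => S b 0) (fun i => (Us i).2) r w).
by split=> //; exact: shift_adapted s0P siP _ _ _ L.
Qed.

End AtPoint.

Lemma double_affine_adapted : adapted_dab A.
Proof.
split=> // m0.
have [_ _ /(_ m0)[d2 [q [z [dm2 tz]]]]] := p1'.
have [_ _ /(_ m0)[d1 [p [y [dm1 ty]]]]] := p2'.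
have md1 : mchart d1 by case: ty.
have md2 : mchart d2 by case: tz.
(* The trivialisations come over different charts of [M]; both are restricted to the common domain
   with the coordinates of [d1]. *)
pose U := cdom d1 `&` cdom d2.
have Uo m : U m -> mnear m U.
  move=> [m1 m2]; have FM := mnear_filter hM m.
  by apply: filterI; exact: mnear_cdom.
have mU : mchart (Chart U (cmap d1)) by apply: mchart_restrict => // m [].
have ty' := triv_restrict p2' ty mU (@subIsetl _ _ _).
have tz' := triv_restrict p1' tz mU (@subIsetr _ _ _).
have [_ _ sty _] := ty; have [a0 _] := sty m0 0 dm1.
have dm0 : cdom (Chart U (cmap d1)) m0 by [].
have [dU [r [c [dUm had]]]] := adapted_at dm0 ty' tz' a0.
by exists dU, p, q, r, y, z, c.
Qed.

End Existence.

(** * Normalisation of the distinguished section *)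

Section Normalisation.
Context {R : realType} {A : dab R} (hA : adapted_dab A).

Let p1 : pre_affine (bun1 A). Proof. by have [] := adapted_pre_affine hA. Qed.
Let p1' : pre_affine (bun1' A). Proof. by have [] := adapted_pre_affine hA. Qed.
Let p2' : pre_affine (bun2' A). Proof. by have [] := adapted_pre_affine hA. Qed.
Let h0 : premfd (dA A). Proof. by case: p1. Qed.
Let hM : premfd (dM A). Proof. by case: p1'. Qed.
Let comm := adapted_comm hA.

Section Change.
Context {d : chart R (dM A)} {p q r : nat} {y : dA1 A -> 'rV[R]_p}
  {z : dA2 A -> 'rV[R]_q} {c : dA A -> 'rV[R]_r} (had : adapted d y z c).
Context (V : set (dM A)) (K : dM A -> 'M[R]_r).
Hypotheses (Vo : forall m, V m -> mnear m V) (Vd : V `<=` cdom d)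
  (uK : forall m, V m -> K m \in unitmx)
  (sK : forall m, V m -> sat (fun u => K (cinv d m u)) (cmap d m)).

Definition change_coord (x : dA A) : 'rV[R]_r := c x *m K (pi2' (pi1 x)).

Definition change_chart : chart R (dM A) := Chart V (cmap d).

(** [K] depends on the point of [M] only, so multiplication by it is linear in every fibre and
    respects both affine structures. *)
Lemma change_adapted : adapted change_chart y z change_coord.
Proof.
have [ty tz t1 t2] := had; have md : mchart d by case: ty.
have mV : mchart change_chart by exact: mchart_restrict.
have tyV := triv_restrict p2' ty mV Vd; have tzV := triv_restrict p1' tz mV Vd.
have mVy : mchart (fchart (@pi2' R A) change_chart y) by case: tyV.
have mVz : mchart (fchart (@pi1' R A) change_chart z) by case: tzV.
have t1V := triv_restrict p1 t1 mVy (fun a => @Vd (pi2' a)).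
have mC : mchart (fchart (@pi1 R A) (fchart (@pi2' R A) change_chart y)
    (fun x => row_mx (z (pi2 x)) (c x))) by case: t1V.
set C := fchart _ _ _ in mC.
pose C1 : chart R (dA A) := fchart (@pi1 R A) (fchart (@pi2' R A) change_chart y)
  (fun x => row_mx (z (pi2 x)) (change_coord x)).
have mC1 : mchart C1.
  (* The inverse chart needs a default point [mm], available if [V] is inhabited; a chart with empty
     domain is compatible with every other. *)
  have [m0|nV] := pselect (exists m, V m); last first.
    split=> [x x' /set_mem /= Ux||e ae].
    - by case: nV; exists (pi2' (pi1 x)).
    - rewrite (_ : _ @` _ = set0); first exact: open0.
      by apply/seteqP; split=> // u [x /= Ux]; case: nV; exists (pi2' (pi1 x)).
    - have E1 : cdom C1 `&` cdom e = set0.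
        by apply/seteqP; split=> // x [/= Ux _]; case: nV; exists (pi2' (pi1 x)).
      have E2 : cdom e `&` cdom C1 = set0 by rewrite setIC.
      split; rewrite /smooth_overlap ?E1 ?E2 image_set0; split; try exact: open0.
      + by exists (fun=> 0) => [|x Cx ex]; [apply/smooth_onP => //; exact: open0|
          case: nV; exists (pi2' (pi1 x))].
      + by exists (fun=> 0) => [|x Cx ex]; [apply/smooth_onP => //; exact: open0|
          case: nV; exists (pi2' (pi1 x))].
  have [mm Vmm] := m0.
  pose k (u : 'rV[R]_((cdim d + p) + (q + r))) := K (cinv d mm (lsubmx (lsubmx u))).
  pose r1 (u : 'rV[R]_((cdim d + p) + (q + r))) : 'rV[R]_((cdim d + p) + (q + r)) :=
    row_mx (lsubmx u) (row_mx (lsubmx (rsubmx u)) (rsubmx (rsubmx u) *m k u)).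
  pose r2 (u : 'rV[R]_((cdim d + p) + (q + r))) : 'rV[R]_((cdim d + p) + (q + r)) :=
    row_mx (lsubmx u) (row_mx (lsubmx (rsubmx u)) (rsubmx (rsubmx u) *m invmx (k u))).
  have kE u m : V m -> lsubmx (lsubmx u) = cmap d m -> k u = K m.
    by move=> Vm E; rewrite /k E cinvK//; [exact: mchart_inj|exact: Vd].
  have sk u m : V m -> lsubmx (lsubmx u) = cmap d m -> sat k u.
    move=> Vm E.
    apply: (sat_comp (g := fun v => K (cinv d mm v)) (f := fun u => lsubmx (lsubmx u))).
      rewrite E; apply: sat_ext (sK Vm).
      apply: filterS (mchart_open md (Vd Vm)) => _ [m' dm' <-].
      by rewrite !cinvK//; exact: mchart_inj.
    by smooth_coord.
  apply: (@mchart_post_local R (dA A) C C1 r1 r2 h0 mC) => // x /= Ux.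
  set u0 := row_mx _ (row_mx _ (c x)); set u1 := row_mx _ (row_mx _ (change_coord x)).
  have E0 : lsubmx (lsubmx u0) = cmap d (pi2' (pi1 x)) by rewrite !row_mxKl.
  have E1 : lsubmx (lsubmx u1) = cmap d (pi2' (pi1 x)) by rewrite !row_mxKl.
  split.
  - by rewrite /r1 (kE _ _ Ux E0) !(row_mxKl, row_mxKr).
  - apply: sat_row_mx; first by smooth_coord.
    apply: sat_row_mx; first by smooth_coord.
    by apply: sat_mulmx; [smooth_coord|exact: sk E0].
  - apply: sat_row_mx; first by smooth_coord.
    apply: sat_row_mx; first by smooth_coord.
    apply: sat_mulmx; first by smooth_coord.
    by apply: sat_invmx; [rewrite (kE _ _ Ux E1); exact: uK|exact: sk E1].
  - rewrite /r2 (kE _ _ Ux E1) !(row_mxKl, row_mxKr) /change_coord.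
    by rewrite mulmxK//; exact: uK.
  have sll : sat (fun u : 'rV[R]_((cdim d + p) + (q + r)) => lsubmx (lsubmx u)) u1.
    by smooth_coord.
  have : \forall u \near u1, (cmap d @` (cdom d `&` V)) (lsubmx (lsubmx u)).
    by apply: (sat_near sll); rewrite E1; exact: (mnear_chart hM (Vo Ux) md (Vd Ux)).
  apply: filterS => u [m [dm Vm] Em].
  have E2 : lsubmx (lsubmx (r2 u)) = cmap d m by rewrite /r2 row_mxKl Em.
  rewrite /r1 (kE _ _ Vm E2) /r2 (kE _ _ Vm (esym Em)) !(row_mxKl, row_mxKr).
  by rewrite mulmxKV ?uK// !hsubmxK.
split=> //; split=> //=.
- move=> a v Va.
  have [_ _ st _] := t1.
  have [x [/= Ex]] := st a (row_mx (lsubmx v) (rsubmx v *m invmx (K (pi2' a)))) (Vd Va).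
  move=> /eq_row_mx[Ez Ec]; exists x; split=> //.
  have {}Ex : pi1 x = a := Ex.
  by rewrite /change_coord Ez Ec Ex mulmxKV ?uK// hsubmxK.
- move=> l x x' Vx Ex; have {}Ex : pi1 x' = pi1 x := Ex.
  have [E1 E2 E3] := adapted_aff1 had l (Vd Vx) Ex; split=> //.
  rewrite /change_coord E1 E2 E3 Ex !scale_row_mx add_row_mx; congr row_mx.
  by rewrite mulmxDl !scalemxAl.
- pose r1 (u : 'rV[R]_((cdim d + p) + (q + r))) : 'rV[R]_((cdim d + q) + (p + r)) :=
    row_mx (row_mx (lsubmx (lsubmx u)) (lsubmx (rsubmx u)))
           (row_mx (rsubmx (lsubmx u)) (rsubmx (rsubmx u))).
  pose r2 (u : 'rV[R]_((cdim d + q) + (p + r))) : 'rV[R]_((cdim d + p) + (q + r)) :=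
    row_mx (row_mx (lsubmx (lsubmx u)) (lsubmx (rsubmx u)))
           (row_mx (rsubmx (lsubmx u)) (rsubmx (rsubmx u))).
  pose C2 : chart R (dA A) := fchart (@pi2 R A) (fchart (@pi1' R A) change_chart z)
    (fun x => row_mx (y (pi1 x)) (change_coord x)).
  apply: (@mchart_post R (dA A) C1 C2 r1 r2 h0 mC1).
  + by move=> x /=; rewrite comm.
  + by move=> x /= Ux; rewrite /r1 !(row_mxKl, row_mxKr) -comm.
  + by move=> u; rewrite /r1; smooth_coord.
  + by move=> u; rewrite /r2; smooth_coord.
  + by move=> u; rewrite /r1 /r2 !(row_mxKl, row_mxKr, hsubmxK).
  + by move=> u; rewrite /r1 /r2 !(row_mxKl, row_mxKr, hsubmxK).
- move=> b v Vb.
  have [_ _ _ st] := had; have [_ _ {}st _] := st.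
  have [x [/= Ex]] := st b (row_mx (lsubmx v) (rsubmx v *m invmx (K (pi1' b)))) (Vd Vb).
  move=> /eq_row_mx[Ey Ec]; exists x; split=> //.
  have {}Ex : pi2 x = b := Ex.
  by rewrite /change_coord Ey Ec comm Ex mulmxKV ?uK// hsubmxK.
- move=> l x x' Vx Ex; have {}Ex : pi2 x' = pi2 x := Ex.
  have dx : cdom d (pi2' (pi1 x)) by rewrite comm; exact: Vd.
  have [E1 E2 E3] := adapted_aff2 hA had l dx Ex; split=> //.
  rewrite /change_coord !comm E1 E2 E3 Ex !scale_row_mx add_row_mx; congr row_mx.
  by rewrite mulmxDl !scalemxAl.
Qed.

Lemma core_coord_change (e : core A) :
  core_coord change_coord e = core_coord c e *m K (core_proj e).
Proof.
rewrite /core_coord /core_c.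
have H (h : hull (bun1 A)) :
    hext (E := bun1 A) change_coord h = hext (E := bun1 A) c h *m K (pi2' (hproj h)).
  rewrite /hext mulmx_suml; apply: eq_sum_all (hrep_fiber h) _ => re.
  move=> /asboolP Ere; rewrite /change_coord.
  by rewrite -scalemxAl -[X in pi2' X]/(@bproj R (bun1 A) _) Ere.
rewrite [RHS]mulmx_suml; apply: eq_sum_all (hrep_fiber (E := hat A) (val e)) _ => re.
move=> /asboolP Ere; rewrite H -scalemxAl; congr (_ *: (_ *m K _)).
by rewrite /core_proj -Ere.
Qed.

End Change.

Definition normalised (sigma : dM A -> core A) (d : chart R (dM A)) r
    (c : dA A -> 'rV[R]_(1 + r)) : Prop :=
  forall m, cdom d m -> core_coord c (sigma m) = row_mx (const_mx 1) 0.

Lemma core_zeroP (d : chart R (dM A)) p q r (y : dA1 A -> 'rV[R]_p)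
    (z : dA2 A -> 'rV[R]_q) (c : dA A -> 'rV[R]_r) m : adapted d y z c ->
  cdom d m -> [/\ @core_pred R A (core_zero m), dhull_base (core_zero m) = m &
    core_c c (core_zero m) = 0].
Proof.
move=> had dm; have dm' : cdom d (hproj (@hzero R (bun1' A) m)) by [].
have EB : dhull_base (core_zero m) = m by [].
split=> //; last by rewrite /core_c hext_hzero//; exact: (hat_aff_c hA had).
apply/(core_predP had); first by rewrite EB.
split.
- by apply/(hull1'_zero had).
- by rewrite /core_y hext_hzero//; exact: (hat_aff_y hA had).
- exact: hwt_hzero.
Qed.

(** The nonzero vector [s m0] starts a basis. With the other basis vectors constant, [Q m] has first
    row [s m] and stays invertible nearby; then s m = (1, 0) Q m, and the change by the inverse of
    [Q] sends it to (1, 0). *)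
Lemma normalised_adapted_at (sigma : dM A -> core A) m0 : special_dab sigma ->
  exists (d : chart R (dM A)) p q r (y : dA1 A -> 'rV[R]_p)
    (z : dA2 A -> 'rV[R]_q) (c : dA A -> 'rV[R]_(1 + r)),
    [/\ cdom d m0, adapted d y z c & normalised sigma d c].
Proof.
move=> [_ ss sp s0]; have [_ _ H] := hA.
have [d [p [q [r [y [z [c [dm0 had]]]]]]]] := H m0.
have hC := premfd_core hA; have pC := core_pre_affine hA.
have tC := core_triv hA had; have md := adapted_mchart had.
pose s m := core_coord c (sigma m).
have smap_s m : smap sigma m by exact: ((smooth_mapP sigma hM hC).1 ss m).
have ssat m : cdom d m -> msat s m.
  move=> dm; apply: (@smap_msat R (dM A) (core A) r (core_coord c) sigma m hM hC) => //.
  by apply: (triv_msat pC tC); rewrite /= sp.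
have sm0 : s m0 != 0.
  apply/eqP => E; apply: (s0 m0).
  have [Z1 Z2 Z3] := core_zeroP had dm0.
  apply: (core_eq hA had (core_predE (sigma m0)) Z1).
  - by rewrite -core_proj_dhull sp.
  - by rewrite -core_proj_dhull sp.
  - by rewrite Z3.
(* In rank 0 the core has only zero vectors, which [sm0] excludes; otherwise the rank has the form 1
   + r. *)
case: r c had tC @s ssat sm0 => [|r] c had tC s ssat sm0.
  by case/eqP: sm0; apply/rowP => -[].
have full : row_full (s m0)^T.
  have [j sj] : exists j, s m0 ord0 j != 0.
    apply/existsP; apply: contraR sm0; rewrite negb_exists => /forallP H0.
    by apply/eqP/rowP => j; rewrite mxE; apply/eqP; rewrite -[_ == _]negbK H0.
  apply/row_fullP; exists ((s m0 ord0 j)^-1 *: delta_mx ord0 j).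
  rewrite -scalemxAl -rowE; apply/matrixP => i k; rewrite !mxE (ord1 i) (ord1 k) eqxx.
  by rewrite mulVf.
have [P uP] := @row_full_complete R 1 r (s m0)^T full.
pose Q m : 'M[R]_(1 + r) := col_mx (s m) P^T.
have uQ0 : Q m0 \in unitmx.
  by rewrite -unitmx_tr /Q tr_col_mx trmxK.
have sQ m : cdom d m -> sat (fun u => Q (cinv d m u)) (cmap d m).
  move=> dm; apply: sat_mx => i j.
  have /(msatP hM _ md dm) sc := ssat m dm.
  rewrite /Q; case: (split_ordP i) => k ->.
    apply: (sat_eq _ (sat_entry k j sc)) => u.
    by rewrite col_mxEu.
  by apply: (sat_eq _ (@sat_cst _ _ R (P^T k j) _)) => u; rewrite col_mxEd.
pose V m := mnear m (fun m => cdom d m /\ Q m \in unitmx).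
have FM := mnear_filter hM m0.
have V0 : V m0.
  have sd : sat (fun u => \det (Q (cinv d m0 u))) (cmap d m0) by exact/sat_det/sQ.
  have n0 : nbhs (\det (Q (cinv d m0 (cmap d m0)))) [set t : R | t != 0].
    apply: open_nbhs_nbhs; split; first exact: open_neq.
    by rewrite /= cinvx// -unitfE -unitmxE.
  apply/(mnearP hM _ md dm0).
  apply: filterS2 (sat_near sd n0) (mchart_open md dm0) => u + [m dm Eu].
  rewrite -Eu cinvK//; last exact: mchart_inj.
  by move=> um; exists m => //; split=> //; split=> //; rewrite unitmxE unitfE.
have Vd : V `<=` cdom d by move=> m /mnear_self[].
have VQ m : V m -> Q m \in unitmx by move=> /mnear_self[].
have Vo m : V m -> mnear m V by exact: mnear_mnear.
pose K m := invmx (Q m).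
have sK m : V m -> sat (fun u => K (cinv d m u)) (cmap d m).
  move=> Vm; apply: sat_invmx; first by rewrite cinvx//; [exact: VQ|exact: Vd].
  by apply: sQ; exact: Vd.
have uK m : V m -> K m \in unitmx by move=> Vm; rewrite unitmx_inv; exact: VQ.
exists (change_chart V (d := d)), p, q, r, y, z, (change_coord K (c := c)).
split=> //; first exact: change_adapted.
move=> m /= Vm.
have Es : core_coord c (sigma m) = row_mx (const_mx 1) 0 *m Q m.
  rewrite -[LHS]/(s m) /Q mul_row_col mul0mx addr0; have -> : const_mx 1 = 1%:M :> 'M[R]_1.
    by apply/matrixP => i j; rewrite !mxE (ord1 i) (ord1 j).
  by rewrite mul1mx.
by rewrite core_coord_change sp Es /K mulmxK//; exact: VQ.
Qed.

End Normalisation.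

(** * The dual *)

Section Dot.
Context {R : realType}.

Definition dot n (u v : 'rV[R]_n) : R := \sum_j u ord0 j * v ord0 j.

Lemma dot_row_mx n m (u v : 'rV[R]_n) (u' v' : 'rV[R]_m) :
  dot (row_mx u u') (row_mx v v') = dot u v + dot u' v'.
Proof.
rewrite /dot big_split_ord; congr (_ + _); apply: eq_bigr => j _.
  by rewrite !row_mxEl.
by rewrite !row_mxEr.
Qed.

Lemma dot_cst (k : R) (v : 'rV[R]_1) : dot (const_mx k) v = k * v ord0 ord0.
Proof. by rewrite /dot big_ord1 mxE. Qed.

Lemma dot0r n (u : 'rV[R]_n) : dot u 0 = 0.
Proof. by rewrite /dot big1// => j _; rewrite mxE mulr0. Qed.

Lemma dotDr n (u v w : 'rV[R]_n) : dot u (v + w) = dot u v + dot u w.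
Proof. by rewrite /dot -big_split; apply: eq_bigr => j _; rewrite mxE mulrDr. Qed.

Lemma dotZr n k (u v : 'rV[R]_n) : dot u (k *: v) = k * dot u v.
Proof. by rewrite /dot mulr_sumr; apply: eq_bigr => j _; rewrite mxE mulrCA. Qed.

Lemma dotDl n (u v w : 'rV[R]_n) : dot (u + v) w = dot u w + dot v w.
Proof. by rewrite /dot -big_split; apply: eq_bigr => j _; rewrite mxE mulrDl. Qed.

Lemma dotZl n k (u v : 'rV[R]_n) : dot (k *: u) v = k * dot u v.
Proof. by rewrite /dot mulr_sumr; apply: eq_bigr => j _; rewrite mxE mulrA. Qed.

(** The constant term is multiplied by the weight, so on vectors of weight 0 only the linear part of
    [f] is left. *)
Lemma hext_dagger (E : abun R) (d : chart R (base E)) k (phi : tot E -> 'rV[R]_k)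
    a0 a (f : dagger_type E) (v : hull E) :
  dagger_coef d phi a0 a -> cdom d (dpt f) -> hproj v = dpt f ->
  hext (dfun f : tot E -> R^o) v = a0 f * hwt v ord0 ord0 + dot (a f) (hext phi v).
Proof.
move=> Ha df Ev; rewrite hwtE mxE /weight /hext.
have : hext (dfun f : tot E -> R^o) v =
    \sum_(re <- hrep v) re.1 * (a0 f + dot (a f) (phi re.2)).
  apply: eq_sum_all (hrep_fiber v) _ => re /asboolP Ere.
  by rewrite [LHS]/GRing.scale /= (Ha _ df)// Ere.
rewrite /hext => ->; elim: (hrep v) => [|re w IH].
  by rewrite !big_nil mulr0 dot0r addr0.
by rewrite !big_cons IH dotDr dotZr; ring.
Qed.

Lemma hscale1 (E : abun R) (h : hull E) : hscale 1 h = h.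
Proof.
rewrite -[RHS]hmk_hrep /hscale; congr hmk.
by rewrite -[RHS]map_id; apply: eq_map => -[u e] /=; rewrite mul1r.
Qed.

End Dot.

(** * The affine duals as submanifolds *)

Section SharpCharts.
Context {R : realType} {A : dab R} (hA : adapted_dab A)
  {sigma : dM A -> core A} (hs : special_dab sigma).
Context {d : chart R (dM A)} {p q r : nat} {y : dA1 A -> 'rV[R]_p}
  {z : dA2 A -> 'rV[R]_q} {c : dA A -> 'rV[R]_(1 + r)} (had : adapted d y z c)
  (hn : normalised sigma d c).

Let sigma_pt m : core_proj (sigma m) = m.
Proof. by have [_ _] := hs. Qed.

Section Coefficients.
Context {a0 : dagger_type (bun1 A) -> R} {a : dagger_type (bun1 A) -> 'rV[R]_(q + (1 + r))}.
Hypothesis Ha : @dagger_coef R (bun1 A) (fchart (@pi2' R A) d y) (q + (1 + r))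
  (fun x => row_mx (z (pi2 x)) (c x)) a0 a.

(** A core vector has weight 0 and no z-part, so it meets the c-coefficients alone. *)
Lemma hext_core_incl (g : dagger_type (bun1 A)) (e : core A) :
  cdom d (pi2' (dpt g)) -> core_proj e = pi2' (dpt g) ->
  hext (E := bun1 A) (dfun g : tot (bun1 A) -> R^o) (core_incl (dpt g) e) =
  dot (rsubmx (a g)) (core_coord c e).
Proof.
move=> dg Ee; have [E1 E2 E3 E4] := core_inclP hA had dg Ee.
rewrite (hext_dagger Ha)// E4 mxE mulr0 add0r (@hext_row_mx R (bun1 A)) E2 E3.
by rewrite -{1}[a g]hsubmxK dot_row_mx dot0r add0r.
Qed.

Lemma dot_sigma m (u : 'rV[R]_(1 + r)) : cdom d m ->
  dot u (core_coord c (sigma m)) = lsubmx u ord0 ord0.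
Proof.
move=> dm; rewrite hn// -[u in LHS]hsubmxK dot_row_mx dot0r addr0.
by rewrite /dot big_ord1 [const_mx 1 ord0 ord0]mxE mulr1.
Qed.

(** [sigma] is the first core vector in normalised coordinates, so the condition of the special dual
    reads: the first c-coefficient is 1. *)
Lemma sharp_predP (g : dagger (bun1 A)) : cdom d (pi2' (dpt g)) ->
  hext (E := bun1 A) (dfun g : tot (bun1 A) -> R^o) (sigma1 sigma (dpt g)) = 1 <->
  lsubmx (rsubmx (a g)) = const_mx 1.
Proof.
move=> dg; rewrite /sigma1 hext_core_incl// dot_sigma//.
split=> [E|->]; last by rewrite mxE.
by apply/rowP => j; rewrite (ord1 j) E mxE.
Qed.

(** Slices are zero sets of the last coordinates, hence the subtracted 1. The remaining order (x, y,
    gamma, a0, alpha) is that of the adapted coordinates of the dual. *)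
Definition sharp_phi (g : dagger (bun1 A)) :
    'rV[R]_(((cdim d + p) + (r + (1 + q))) + 1) :=
  row_mx (row_mx (row_mx (cmap d (pi2' (dpt g))) (y (dpt g)))
    (row_mx (rsubmx (rsubmx (a g))) (row_mx (const_mx (a0 g)) (lsubmx (a g)))))
    (lsubmx (rsubmx (a g)) - const_mx 1).

Lemma sharp_slice : slice_chart
  [set g : dagger (bun1 A) |
    hext (E := bun1 A) (dfun g : tot (bun1 A) -> R^o) (sigma1 sigma (dpt g)) = 1]
  (fun g : dagger (bun1 A) => cdom d (pi2' (dpt g))) sharp_phi.
Proof.
have [p1 _ _ _] := adapted_pre_affine hA; have [_ _ t1 _] := had.
split; last first.
  move=> g dg; apply: iff_trans (sharp_predP dg) _.
  rewrite /sharp_phi row_mxKr.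
  by split=> [->|/eqP]; rewrite ?subrr// subr_eq0 => /eqP.
pose r1 (u : 'rV[R]_((cdim d + p) + (1 + (q + (1 + r))))) :
    'rV[R]_(((cdim d + p) + (r + (1 + q))) + 1) :=
  row_mx (row_mx (lsubmx u) (row_mx (rsubmx (rsubmx (rsubmx (rsubmx u))))
    (row_mx (lsubmx (rsubmx u)) (lsubmx (rsubmx (rsubmx u))))))
    (lsubmx (rsubmx (rsubmx (rsubmx u))) - const_mx 1).
pose r2 (v : 'rV[R]_(((cdim d + p) + (r + (1 + q))) + 1)) :
    'rV[R]_((cdim d + p) + (1 + (q + (1 + r)))) :=
  row_mx (lsubmx (lsubmx v)) (row_mx (lsubmx (rsubmx (rsubmx (lsubmx v))))
    (row_mx (rsubmx (rsubmx (rsubmx (lsubmx v))))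
      (row_mx (rsubmx v + const_mx 1) (lsubmx (rsubmx (lsubmx v)))))).
have mc := dagger_mchart p1 t1 Ha; set c0 := fchart _ _ _ in mc.
apply: (@mchart_post R (dagger (bun1 A)) c0
  (Chart (fun g : dagger (bun1 A) => cdom d (pi2' (dpt g))) sharp_phi)
  r1 r2 (premfd_dagger p1) mc).
- by [].
- move=> g /= dg; rewrite /sharp_phi /dcoord /r1.
  by rewrite !(row_mxKl, row_mxKr).
- by move=> u; rewrite /r1; smooth_coord.
- by move=> u; rewrite /r2; smooth_coord.
- by move=> u; rewrite /r1 /r2 !(row_mxKl, row_mxKr, subrK, hsubmxK).
- by move=> u; rewrite /r1 /r2 !(row_mxKl, row_mxKr, addrK, hsubmxK).
Qed.

Definition sharp_gamma (f : Asharp sigma) : 'rV[R]_r := rsubmx (rsubmx (a (val f))).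

Definition sharp_alpha (f : Asharp sigma) : 'rV[R]_(1 + q) :=
  row_mx (const_mx (a0 (val f))) (lsubmx (a (val f))).

(** The pairing <w, (1, z)> + <(1, g), c>: [w] collects the constant term and the z-coefficients,
    [g] the c-coefficients after the first. *)
Definition sharp_eval (w : 'rV[R]_(1 + q)) (g : 'rV[R]_r) (x : dA A) : R :=
  dot w (row_mx (const_mx 1) (z (pi2 x))) + dot (row_mx (const_mx 1) g) (c x).

Lemma sharp_funE (f : Asharp sigma) x : cdom d (pi2' (sh_pt f)) -> pi1 x = sh_pt f ->
  sh_fun f x = sharp_eval (sharp_alpha f) (sharp_gamma f) x.
Proof.
move=> df Ex; rewrite /sh_fun (Ha df Ex) /sharp_eval.
have Ef : a (val f) = row_mx (lsubmx (a (val f)))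
    (row_mx (const_mx 1) (sharp_gamma f)).
  have <- : lsubmx (rsubmx (a (val f))) = const_mx 1.
    exact: ((sharp_predP df).1 (sub_mfdP f)).
  by rewrite !hsubmxK.
rewrite -[\sum_j _]/(dot _ _) {1}Ef dot_row_mx dot_row_mx dot_cst.
by rewrite mxE mulr1 addrA.
Qed.

Lemma sharp_surj a1 w g : cdom d (pi2' a1) -> exists f : Asharp sigma,
  [/\ sh_pt f = a1, sharp_gamma f = g & sharp_alpha f = w].
Proof.
move=> da; have [_ _ t1 _] := had.
have [f [Ef E0 Ea]] := @dagger_surj R (bun1 A) _ _ _ t1 _ _ Ha a1
  (lsubmx w ord0 ord0) (row_mx (rsubmx w) (row_mx (const_mx 1) g)) da.
have Sf : [set g : dagger (bun1 A) | hext (E := bun1 A)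
    (dfun g : tot (bun1 A) -> R^o) (sigma1 sigma (dpt g)) = 1] f.
  by apply/sharp_predP; rewrite ?Ef// Ea row_mxKr row_mxKl.
exists (exist _ f (mem_set Sf)); split=> //=.
  by rewrite /sharp_gamma /= Ea !row_mxKr.
rewrite /sharp_alpha /= Ea E0 row_mxKl -[RHS]hsubmxK; congr row_mx.
by apply/rowP => i; rewrite mxE (ord1 i).
Qed.

Lemma sharp_coord_uniq (f : Asharp sigma) w g : cdom d (pi2' (sh_pt f)) ->
  (forall x, pi1 x = sh_pt f -> sh_fun f x = sharp_eval w g x) ->
  sharp_gamma f = g /\ sharp_alpha f = w.
Proof.
move=> df H; have [_ _ t1 _] := had.
have [E0 Ea] : a0 (val f) = lsubmx w ord0 ord0 /\
    a (val f) = row_mx (rsubmx w) (row_mx (const_mx 1) g).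
  apply: (@dagger_coef_uniq R (bun1 A) _ _ _ t1 _ _ Ha (val f) _ _ df) => x Ex.
  rewrite -[dfun _ _]/(sh_fun f x) H// /sharp_eval -[w in LHS]hsubmxK.
  rewrite -[\sum_j _]/(dot _ _) !dot_row_mx.
  by rewrite /dot big_ord1 [const_mx 1 ord0 ord0]mxE mulr1 addrA.
split; first by rewrite /sharp_gamma Ea !row_mxKr.
rewrite /sharp_alpha /= Ea E0 row_mxKl -[RHS]hsubmxK; congr row_mx.
by apply/rowP => i; rewrite mxE (ord1 i).
Qed.

End Coefficients.

Section DDagger.
Context {b0 : dagger_type (core_bun A) -> R}
  {b : dagger_type (core_bun A) -> 'rV[R]_(1 + r)}.
Hypothesis Hb : @dagger_coef R (core_bun A) d (1 + r) (core_coord c) b0 b.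

(** Points of the dagger of the core are affine functions on core fibres: linearity kills the
    constant term [b0], and the value on [sigma] is the first coefficient. *)
Lemma ddagger_predP (f : dagger (core_bun A)) : cdom d (dpt f) ->
  core_linear (dpt f) (dfun f) /\ dfun f (sigma (dpt f)) = 1 <->
  b0 f = 0 /\ lsubmx (b f) = const_mx 1.
Proof.
move=> df.
have Ev (e : core A) : core_proj e = dpt f -> dfun f e = b0 f + dot (b f) (core_coord c e).
  by move=> Ee; rewrite (Hb df).
split=> [[Hl H1]|[E0 E1]].
  have [e [Ee Ec]] : exists e : core A, core_proj e = dpt f /\ core_coord c e = 0.
    have [D [cD Em Ec]] := core_mk hA had 0 df.
    by exists (exist _ D (mem_set cD)).
  have E0 : b0 f = 0.
    (* The zero vector satisfies e = 1 e + e, so linearity doubles its value. *)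
    have : dfun f e = 1 * dfun f e + dfun f e.
      apply: Hl => //; have ce := core_predE e.
      have de : cdom d (dhull_base (val e)) by rewrite -core_proj_dhull Ee.
      rewrite -[X in hadd _ X](@hscale1 R (hat A)).
      have [F1 F2 F3] := core_linear_comb hA had 1 1 ce ce de erefl.
      apply: (core_eq hA had ce F1 de F2); rewrite F3 -/(core_coord c e) Ec.
      by rewrite !scaler0 addr0.
    rewrite Ev// Ec dot0r addr0 mul1r => /eqP.
    by rewrite -subr_eq subrr => /eqP.
  split=> //; move: H1; rewrite Ev// E0 add0r dot_sigma// => E.
  by apply/rowP => j; rewrite (ord1 j) E mxE.
split; last by rewrite Ev// E0 add0r dot_sigma// E1 mxE.
move=> k e e' e'' Ee Ee' Ee'' H.
rewrite !Ev// E0 !add0r.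
have de : cdom d (dhull_base (val e)) by rewrite -core_proj_dhull Ee.
have EE : dhull_base (val e') = dhull_base (val e).
  by rewrite -!core_proj_dhull Ee Ee'.
have [F1 F2 F3] := core_linear_comb hA had k 1 (core_predE e) (core_predE e') de EE.
rewrite {1}/core_coord H -[X in hadd _ X](@hscale1 R (hat A)) F3.
by rewrite dotDr !dotZr mul1r.
Qed.

Definition ddagger_phi (f : dagger (core_bun A)) : 'rV[R]_((cdim d + r) + (1 + 1)) :=
  row_mx (row_mx (cmap d (dpt f)) (rsubmx (b f)))
    (row_mx (const_mx (b0 f)) (lsubmx (b f) - const_mx 1)).

Lemma ddagger_slice : @slice_chart R (dagger (core_bun A))
  [set f : dagger_type (core_bun A) |
    core_linear (dpt f) (dfun f) /\ dfun f (sigma (dpt f)) = 1] _ _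
  (fun f : dagger (core_bun A) => cdom d (dpt f)) ddagger_phi.
Proof.
have pC := core_pre_affine hA; have tC := core_triv hA had.
split; last first.
  move=> f df; apply: iff_trans (ddagger_predP df) _.
  rewrite /ddagger_phi row_mxKr; split=> [[-> ->]|].
    by rewrite subrr -[RHS]row_mx0; congr row_mx; apply/rowP => j; rewrite !mxE.
  rewrite -row_mx0 => /eq_row_mx[/matrixP/(_ ord0 ord0) + /eqP].
  by rewrite !mxE subr_eq0 => -> /eqP ->.
pose r1 (u : 'rV[R]_(cdim d + (1 + (1 + r)))) : 'rV[R]_((cdim d + r) + (1 + 1)) :=
  row_mx (row_mx (lsubmx u) (rsubmx (rsubmx (rsubmx u))))
    (row_mx (lsubmx (rsubmx u)) (lsubmx (rsubmx (rsubmx u)) - const_mx 1)).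
pose r2 (v : 'rV[R]_((cdim d + r) + (1 + 1))) : 'rV[R]_(cdim d + (1 + (1 + r))) :=
  row_mx (lsubmx (lsubmx v)) (row_mx (lsubmx (rsubmx v))
    (row_mx (rsubmx (rsubmx v) + const_mx 1) (rsubmx (lsubmx v)))).
have mc := dagger_mchart pC tC Hb; set c0 := fchart _ _ _ in mc.
apply: (@mchart_post R (dagger (core_bun A)) c0
  (Chart (fun f : dagger (core_bun A) => cdom d (dpt f)) ddagger_phi) r1 r2 (premfd_dagger pC) mc).
- by [].
- move=> g /= dg; rewrite /ddagger_phi /dcoord /r1.
  by rewrite !(row_mxKl, row_mxKr).
- by move=> u; rewrite /r1; smooth_coord.
- by move=> u; rewrite /r2; smooth_coord.
- by move=> u; rewrite /r1 /r2 !(row_mxKl, row_mxKr, subrK, hsubmxK).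
- by move=> u; rewrite /r1 /r2 !(row_mxKl, row_mxKr, addrK, hsubmxK).
Qed.

Definition ddagger_coord (f : core_ddagger sigma) : 'rV[R]_r := rsubmx (b (val f)).

Lemma ddagger_funE (f : core_ddagger sigma) e : cdom d (dd_pt f) ->
  core_proj e = dd_pt f ->
  dd_fun f e = dot (row_mx (const_mx 1) (ddagger_coord f)) (core_coord c e).
Proof.
move=> df Ee; have [E0 E1] := (ddagger_predP df).1 (sub_mfdP f).
by rewrite /dd_fun (Hb df Ee) E0 add0r -E1 hsubmxK.
Qed.

Lemma ddagger_surj m g : cdom d m ->
  exists f : core_ddagger sigma, dd_pt f = m /\ ddagger_coord f = g.
Proof.
move=> dm; have tC := core_triv hA had.
have [f [Ef E0 Ea]] := @dagger_surj R (core_bun A) _ _ _ tC _ _ Hb m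
  0 (row_mx (const_mx 1) g) dm.
have Sf : [set f : dagger_type (core_bun A) |
    core_linear (dpt f) (dfun f) /\ dfun f (sigma (dpt f)) = 1] f.
  by apply/ddagger_predP; rewrite ?Ef// Ea row_mxKl.
exists (exist _ f (mem_set Sf)); split=> //=.
by rewrite /ddagger_coord /= Ea row_mxKr.
Qed.

Lemma ddagger_coord_uniq (f : core_ddagger sigma) g : cdom d (dd_pt f) ->
  (forall e, core_proj e = dd_pt f ->
    dd_fun f e = dot (row_mx (const_mx 1) g) (core_coord c e)) ->
  ddagger_coord f = g.
Proof.
move=> df H; have tC := core_triv hA had.
have [_ Ea] : b0 (val f) = 0 /\ b (val f) = row_mx (const_mx 1) g.
  apply: (@dagger_coef_uniq R (core_bun A) _ _ _ tC _ _ Hb (val f) _ _ df) => e Ee.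
  by rewrite -[dfun _ _]/(dd_fun f e) H// add0r.
by rewrite /ddagger_coord Ea row_mxKr.
Qed.

End DDagger.

End SharpCharts.
Arguments sharp_eval {R A q r} z c w g x.
Arguments sharp_gamma {R A sigma q r} a f.
Arguments sharp_alpha {R A sigma q r} a0 a f.
Arguments ddagger_coord {R A sigma r} b f.

(** * Operations on the affine dual *)

Section DualStructure.
Context {R : realType} {A : dab R} (hA : adapted_dab A)
  {sigma : dM A -> core A} (hs : special_dab sigma).

(* Adapted coordinates with [sigma] the first core vector, together with the
   coefficients they induce on the affine duals. *)
Definition dual_frame (d : chart R (dM A)) p q r (y : dA1 A -> 'rV[R]_p)
    (z : dA2 A -> 'rV[R]_q) (c : dA A -> 'rV[R]_(1 + r))
    (a0 : dagger_type (bun1 A) -> R) (a : dagger_type (bun1 A) -> 'rV[R]_(q + (1 + r)))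
    (b0 : dagger_type (core_bun A) -> R)
    (b : dagger_type (core_bun A) -> 'rV[R]_(1 + r)) : Prop :=
  [/\ adapted d y z c, normalised sigma d c,
      @dagger_coef R (bun1 A) (fchart (@pi2' R A) d y) (q + (1 + r))
        (fun x => row_mx (z (pi2 x)) (c x)) a0 a &
      @dagger_coef R (core_bun A) d (1 + r) (core_coord c) b0 b].

Lemma dual_frame_at m : exists d p q r y z c a0 a b0 b,
  cdom d m /\ @dual_frame d p q r y z c a0 a b0 b.
Proof.
have [d [p [q [r [y [z [c [dm had hn]]]]]]]] := normalised_adapted_at hA m hs.
have [_ _ t1 _] := had.
have [a0 [a Ha]] := dagger_coef_ex t1.
have [b0 [b Hb]] := dagger_coef_ex (core_triv hA had).
by exists d, p, q, r, y, z, c, a0, a, b0, b.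
Qed.

Lemma sharp_cover (g : dagger (bun1 A)) :
  hext (E := bun1 A) (dfun g : tot (bun1 A) -> R^o) (sigma1 sigma (dpt g)) = 1 ->
  exists k l U (phi : dagger (bun1 A) -> 'rV[R]_(k + l)), slice_chart
    [set g : dagger (bun1 A) | hext (E := bun1 A)
      (dfun g : tot (bun1 A) -> R^o) (sigma1 sigma (dpt g)) = 1] U phi /\ U g.
Proof.
move=> _; have [d [p [q [r [y [z [c [a0 [a [b0 [b [dm [had hn Ha _]]]]]]]]]]]]] :=
  dual_frame_at (pi2' (dpt g)).
by do 4!eexists; split; first exact: (sharp_slice hA hs had hn Ha).
Qed.

Lemma premfd_sharp : premfd (Asharp sigma).
Proof.
have [p1 _ _ _] := adapted_pre_affine hA.
exact: (@premfd_sub R (dagger (bun1 A)) (premfd_dagger p1) _ sharp_cover).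
Qed.

Lemma ddagger_cover (f : dagger (core_bun A)) :
  core_linear (dpt f) (dfun f) /\ dfun f (sigma (dpt f)) = 1 ->
  exists k l U (phi : dagger (core_bun A) -> 'rV[R]_(k + l)),
    @slice_chart R (dagger (core_bun A)) [set f : dagger_type (core_bun A) |
      core_linear (dpt f) (dfun f) /\ dfun f (sigma (dpt f)) = 1] _ _ U phi /\ U f.
Proof.
move=> _; have [d [p [q [r [y [z [c [a0 [a [b0 [b [dm [had hn _ Hb]]]]]]]]]]]]] :=
  dual_frame_at (dpt f).
by do 4!eexists; split; first exact: (ddagger_slice hA hs had hn Hb).
Qed.

Lemma premfd_ddagger : premfd (core_ddagger sigma).
Proof.
exact: (@premfd_sub R (dagger (core_bun A)) (premfd_dagger (core_pre_affine hA)) _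
  ddagger_cover).
Qed.

Lemma ddagger_ext (f g : core_ddagger sigma) : dd_pt f = dd_pt g ->
  (forall e, core_proj e = dd_pt f -> dd_fun f e = dd_fun g e) -> f = g.
Proof. by move=> E H; apply: val_inj; exact: dagger_ext. Qed.

Lemma sharp_eval_comb q r (z : dA2 A -> 'rV[R]_q) (c : dA A -> 'rV[R]_(1 + r))
    l w w' g g' x :
  sharp_eval z c (l *: w + (1 - l) *: w') (l *: g + (1 - l) *: g') x =
  l * sharp_eval z c w g x + (1 - l) * sharp_eval z c w' g' x.
Proof.
rewrite /sharp_eval -(hsubmxK (c x)) !(dot_row_mx, dotDl, dotZl).
ring.
Qed.

Section Frame.
Context {d : chart R (dM A)} {p q r : nat} {y : dA1 A -> 'rV[R]_p}
  {z : dA2 A -> 'rV[R]_q} {c : dA A -> 'rV[R]_(1 + r)}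
  {a0 : dagger_type (bun1 A) -> R} {a : dagger_type (bun1 A) -> 'rV[R]_(q + (1 + r))}
  {b0 : dagger_type (core_bun A) -> R}
  {b : dagger_type (core_bun A) -> 'rV[R]_(1 + r)}.
Hypothesis F : dual_frame d y z c a0 a b0 b.

Let had : adapted d y z c. Proof. by case: F. Qed.
Let hn : normalised sigma d c. Proof. by case: F. Qed.
Let Ha := let: And4 _ _ Ha _ := F in Ha.
Let Hb := let: And4 _ _ _ Hb := F in Hb.

(** One factor of each pairing is common to both points: the equal [pi2] fixes (1, z) while [w]
    moves, and the equal [g] fixes (1, g) while c moves. Hence no mixed terms arise. *)
Lemma sharp_eval_aff2 l w w' g x x' : cdom d (pi2' (pi1 x)) -> pi2 x' = pi2 x ->
  sharp_eval z c (l *: w + (1 - l) *: w') g (aff2 l x x') =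
  l * sharp_eval z c w g x + (1 - l) * sharp_eval z c w' g x'.
Proof.
move=> dx Ex; have [E1 E2 E3] := adapted_aff2 hA had l dx Ex.
rewrite /sharp_eval E1 E3 Ex !(dotDr, dotZr, dotDl, dotZl); ring.
Qed.

Lemma hext_sharp (f : Asharp sigma) e : cdom d (pi2' (sh_pt f)) ->
  core_proj e = pi2' (sh_pt f) ->
  hext (E := bun1 A) (sh_fun f : tot (bun1 A) -> R^o) (core_incl (sh_pt f) e) =
  dot (row_mx (const_mx 1) (sharp_gamma a f)) (core_coord c e).
Proof.
move=> df Ee; rewrite [LHS](hext_core_incl hA had Ha)//.
have <- : lsubmx (rsubmx (a (val f))) = const_mx 1.
  exact: ((sharp_predP hA hs had hn Ha df).1 (sub_mfdP f)).
by rewrite hsubmxK.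
Qed.

Lemma ddagger_sharp (f : Asharp sigma) (g : core_ddagger sigma) :
  cdom d (pi2' (sh_pt f)) -> dd_pt g = pi2' (sh_pt f) ->
  (forall e, core_proj e = pi2' (sh_pt f) -> dd_fun g e =
    hext (E := bun1 A) (sh_fun f : tot (bun1 A) -> R^o) (core_incl (sh_pt f) e)) ->
  ddagger_coord b g = sharp_gamma a f.
Proof.
move=> df Eg H; apply: (ddagger_coord_uniq hA had Hb); rewrite ?Eg// => e Ee.
by rewrite H// hext_sharp.
Qed.

End Frame.

(** The record prescribes values of functions; [sharp_surj] and [ddagger_surj] realise them by
    coefficients in one frame at a time, and functional choice collects the results into
    operations. *)
Lemma dual_structure_exists : inhabited (dual_structure sigma).
Proof.
have [res Hres] : exists res : Asharp sigma -> core_ddagger sigma, forall f,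
    dd_pt (res f) = pi2' (sh_pt f) /\ forall e, core_proj e = pi2' (sh_pt f) ->
      dd_fun (res f) e = hext (E := bun1 A) (sh_fun f : tot (bun1 A) -> R^o)
        (core_incl (sh_pt f) e).
  suff K (f : Asharp sigma) : exists g : core_ddagger sigma, dd_pt g = pi2' (sh_pt f) /\
      forall e, core_proj e = pi2' (sh_pt f) -> dd_fun g e =
      hext (E := bun1 A) (sh_fun f : tot (bun1 A) -> R^o) (core_incl (sh_pt f) e).
    by have [res Hres] := choice K; exists res.
  have [d [p [q [r [y [z [c [a0 [a [b0 [b [dm F]]]]]]]]]]]] :=
    dual_frame_at (pi2' (sh_pt f)); have [had hn Ha Hb] := F.
  have [g [Eg Cg]] := ddagger_surj hA hs had hn Hb (sharp_gamma a f) dm.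
  exists g; split=> // e Ee.
  by rewrite (ddagger_funE hA hs had hn Hb) ?Eg// Cg (hext_sharp F).
have [af1 Haf1] : exists af : R * Asharp sigma * Asharp sigma -> Asharp sigma,
    forall t, sh_pt t.1.2 = sh_pt t.2 -> sh_pt (af t) = sh_pt t.1.2 /\
    forall x, sh_fun (af t) x = t.1.1 * sh_fun t.1.2 x + (1 - t.1.1) * sh_fun t.2 x.
  suff K (t : R * Asharp sigma * Asharp sigma) : exists h : Asharp sigma,
      sh_pt t.1.2 = sh_pt t.2 -> sh_pt h = sh_pt t.1.2 /\
      forall x, sh_fun h x = t.1.1 * sh_fun t.1.2 x + (1 - t.1.1) * sh_fun t.2 x.
    by have [af Haf] := choice K; exists af.
  case: t => -[l f] g /=.
  have [Efg|nE] := pselect (sh_pt f = sh_pt g); last by exists f.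
  have [d [p [q [r [y [z [c [a0 [a [b0 [b [dm [had hn Ha Hb]]]]]]]]]]]]] :=
    dual_frame_at (pi2' (sh_pt f)).
  have [h [Eh Gh Ah]] := sharp_surj hA hs had hn Ha
    (l *: sharp_alpha a0 a f + (1 - l) *: sharp_alpha a0 a g)
    (l *: sharp_gamma a f + (1 - l) *: sharp_gamma a g) dm.
  (* The identity is demanded off the fibre as well, where all three functions vanish. *)
  exists h => _; split=> // x; have [Ex|nx] := pselect (pi1 x = sh_pt f).
    rewrite !(sharp_funE hA hs had hn Ha) ?Eh -?Efg//.
    by rewrite Gh Ah sharp_eval_comb.
  rewrite /sh_fun [LHS](dfun0 (E := bun1 A)); last by rewrite -[dpt _]/(sh_pt h) Eh.
  rewrite (dfun0 (E := bun1 A))// (dfun0 (E := bun1 A)) ?mulr0 ?addr0//.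
  by rewrite -[dpt _]/(sh_pt g) -Efg.
have [af2 Haf2] : exists af : R * Asharp sigma * Asharp sigma -> Asharp sigma,
    forall t, res t.1.2 = res t.2 -> sh_pt (af t) = aff2' t.1.1 (sh_pt t.1.2) (sh_pt t.2) /\
    forall x y, pi1 x = sh_pt t.1.2 -> pi1 y = sh_pt t.2 -> pi2 x = pi2 y ->
    sh_fun (af t) (aff2 t.1.1 x y) = t.1.1 * sh_fun t.1.2 x + (1 - t.1.1) * sh_fun t.2 y.
  suff K (t : R * Asharp sigma * Asharp sigma) : exists h : Asharp sigma,
      res t.1.2 = res t.2 -> sh_pt h = aff2' t.1.1 (sh_pt t.1.2) (sh_pt t.2) /\
      forall x y, pi1 x = sh_pt t.1.2 -> pi1 y = sh_pt t.2 -> pi2 x = pi2 y ->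
      sh_fun h (aff2 t.1.1 x y) = t.1.1 * sh_fun t.1.2 x + (1 - t.1.1) * sh_fun t.2 y.
    by have [af Haf] := choice K; exists af.
  case: t => -[l f] g /=.
  have [Efg|nE] := pselect (res f = res g); last by exists f.
  have [d [p [q [r [y [z [c [a0 [a [b0 [b [dm F]]]]]]]]]]]] :=
    dual_frame_at (pi2' (sh_pt f)); have [had hn Ha Hb] := F.
  have [Rf Rf'] := Hres f; have [Rg Rg'] := Hres g.
  have Em : pi2' (sh_pt g) = pi2' (sh_pt f) by rewrite -Rf -Rg Efg.
  have dg : cdom d (pi2' (sh_pt g)) by rewrite Em.
  (* Equal restrictions to the core mean equal gamma, so the combination keeps this gamma and
     combines the other coefficients. *)
  have Eg : sharp_gamma a g = sharp_gamma a f.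
    by rewrite -(ddagger_sharp F dm Rf Rf') -(ddagger_sharp F dg Rg Rg') Efg.
  have [T1 T2] := adapted_aff2' had l dm Em.
  have dm' : cdom d (pi2' (aff2' l (sh_pt f) (sh_pt g))) by rewrite T1.
  have [h [Eh Gh Ah]] := sharp_surj hA hs had hn Ha
    (l *: sharp_alpha a0 a f + (1 - l) *: sharp_alpha a0 a g)
    (sharp_gamma a f) dm'.
  exists h => _; split=> // x x' Ex Ex' Exx.
  have dx : cdom d (pi2' (pi1 x)) by rewrite Ex.
  rewrite !(sharp_funE hA hs had hn Ha)//; last 2 first.
  - by rewrite Eh.
  - by rewrite (adapted_pi1_aff2 hA had)// Ex Ex' Eh.
  by rewrite Gh Ah Eg (sharp_eval_aff2 F).
have [afd Hafd] : exists af : R * core_ddagger sigma * core_ddagger sigma ->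
      core_ddagger sigma,
    forall t, dd_pt t.1.2 = dd_pt t.2 -> dd_pt (af t) = dd_pt t.1.2 /\
    forall x, dd_fun (af t) x = t.1.1 * dd_fun t.1.2 x + (1 - t.1.1) * dd_fun t.2 x.
  suff K (t : R * core_ddagger sigma * core_ddagger sigma) : exists h : core_ddagger sigma,
      dd_pt t.1.2 = dd_pt t.2 -> dd_pt h = dd_pt t.1.2 /\
      forall x, dd_fun h x = t.1.1 * dd_fun t.1.2 x + (1 - t.1.1) * dd_fun t.2 x.
    by have [af Haf] := choice K; exists af.
  case: t => -[l f] g /=.
  have [Efg|nE] := pselect (dd_pt f = dd_pt g); last by exists f.
  have [d [p [q [r [y [z [c [a0 [a [b0 [b [dm [had hn Ha Hb]]]]]]]]]]]]] :=
    dual_frame_at (dd_pt f).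
  have [h [Eh Ch]] := ddagger_surj hA hs had hn Hb
    (l *: ddagger_coord b f + (1 - l) *: ddagger_coord b g) dm.
  exists h => _; split=> // e; have [Ee|ne] := pselect (core_proj e = dd_pt f).
    rewrite !(ddagger_funE hA hs had hn Hb) ?Eh -?Efg// Ch.
    by rewrite -(hsubmxK (core_coord c e)) !(dot_row_mx, dotDl, dotZl); ring.
  rewrite /dd_fun [LHS](dfun0 (E := core_bun A)); last by rewrite -[dpt _]/(dd_pt h) Eh.
  rewrite (dfun0 (E := core_bun A))// (dfun0 (E := core_bun A)) ?mulr0 ?addr0//.
  by rewrite -[dpt _]/(dd_pt g) -Efg.
split; apply: (@DualStructure _ _ _ res (fun l f g => af1 (l, f, g))
  (fun l f g => af2 (l, f, g)) (fun l f g => afd (l, f, g))).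
- by move=> f; have [] := Hres f.
- by move=> f e Ee; have [_] := Hres f; exact.
- by move=> l f g Efg; have [] := Haf1 (l, f, g) Efg.
- by move=> l f g x Efg; have [_] := Haf1 (l, f, g) Efg; exact.
- by move=> l f g Efg; have [] := Haf2 (l, f, g) Efg.
- by move=> l f g x x' Efg; have [_] := Haf2 (l, f, g) Efg; exact.
- by move=> l f g Efg; have [] := Hafd (l, f, g) Efg.
- by move=> l f g x Efg; have [_] := Hafd (l, f, g) Efg; exact.
Qed.

End DualStructure.

(** * Adapted coordinates of the dual *)

Section DualAdapted.
Context {R : realType} {A : dab R} (hA : adapted_dab A)
  {sigma : dM A -> core A} (hs : special_dab sigma) (s : dual_structure sigma).

Section Frame.
Context {d : chart R (dM A)} {p q r : nat} {y : dA1 A -> 'rV[R]_p}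
  {z : dA2 A -> 'rV[R]_q} {c : dA A -> 'rV[R]_(1 + r)}
  {a0 : dagger_type (bun1 A) -> R} {a : dagger_type (bun1 A) -> 'rV[R]_(q + (1 + r))}
  {b0 : dagger_type (core_bun A) -> R}
  {b : dagger_type (core_bun A) -> 'rV[R]_(1 + r)}.
Hypothesis F : dual_frame (sigma := sigma) d y z c a0 a b0 b.

Let had : adapted d y z c. Proof. by case: F. Qed.
Let hn : normalised sigma d c. Proof. by case: F. Qed.
Let Ha := let: And4 _ _ Ha _ := F in Ha.
Let Hb := let: And4 _ _ _ Hb := F in Hb.
Let md := adapted_mchart had.

Lemma ddagger_coord_inj (f g : core_ddagger sigma) : cdom d (dd_pt f) ->
  dd_pt g = dd_pt f -> ddagger_coord b f = ddagger_coord b g -> f = g.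
Proof.
move=> df E Ec; apply: ddagger_ext => // e Ee.
by rewrite !(ddagger_funE hA hs had hn Hb) ?E// Ec.
Qed.

Lemma res_coord (f : Asharp sigma) : cdom d (pi2' (sh_pt f)) ->
  ddagger_coord b (sh_res s f) = sharp_gamma a f.
Proof.
move=> df; apply: (ddagger_sharp hA hs F df); first exact: sh_res_pt.
by move=> e; exact: sh_resE.
Qed.

Lemma sharp_mchart : @mchart R (Asharp sigma)
  (fchart (@sh_pt R A sigma) (fchart (@pi2' R A) d y)
    (fun f => row_mx (sharp_gamma a f) (sharp_alpha a0 a f))).
Proof.
have [p1 _ _ _] := adapted_pre_affine hA.
have := mchart_sub (premfd_dagger p1) (sharp_cover hA hs) (sharp_slice hA hs had hn Ha).
congr mchart; congr Chart; apply/funext => f.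
by rewrite /sharp_phi row_mxKl.
Qed.

Lemma ddagger_mchart : @mchart R (core_ddagger sigma)
  (fchart (@dd_pt R A sigma) d (ddagger_coord b)).
Proof.
have := mchart_sub (premfd_dagger (core_pre_affine hA)) (ddagger_cover hA hs)
  (ddagger_slice hA hs had hn Hb).
congr mchart; congr Chart; apply/funext => f.
by rewrite /ddagger_phi row_mxKl.
Qed.

Lemma dd_aff_coord l (f g : core_ddagger sigma) : cdom d (dd_pt f) ->
  dd_pt g = dd_pt f -> ddagger_coord b (dd_aff s l f g) =
  l *: ddagger_coord b f + (1 - l) *: ddagger_coord b g.
Proof.
move=> df E; have Ep := dd_aff_pt s l (esym E).
apply: (ddagger_coord_uniq hA had Hb); rewrite ?Ep// => e Ee.
rewrite dd_affE// !(ddagger_funE hA hs had hn Hb) ?E//.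
by rewrite -(hsubmxK (core_coord c e)) !(dot_row_mx, dotDl, dotZl); ring.
Qed.

Lemma sh_aff1_coord l (f g : Asharp sigma) : cdom d (pi2' (sh_pt f)) ->
  sh_pt g = sh_pt f ->
  sharp_gamma a (sh_aff1 s l f g) = l *: sharp_gamma a f + (1 - l) *: sharp_gamma a g /\
  sharp_alpha a0 a (sh_aff1 s l f g) =
  l *: sharp_alpha a0 a f + (1 - l) *: sharp_alpha a0 a g.
Proof.
move=> df E; have Ep := sh_aff1_pt s l (esym E).
apply: (sharp_coord_uniq had Ha); rewrite ?Ep// => x Ex.
rewrite sh_aff1E// !(sharp_funE hA hs had hn Ha) ?E//.
by rewrite sharp_eval_comb.
Qed.

(** The specification gives the combined function at points [aff2 l x x'] only. Every point [w] of
    the target fibre is of this form: take x and x' over the two base points with the same [pi2] and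
    the same c as [w]. *)
Lemma sh_aff2_coord l (f g : Asharp sigma) : cdom d (pi2' (sh_pt f)) ->
  sh_res s g = sh_res s f ->
  [/\ pi2' (sh_pt (sh_aff2 s l f g)) = pi2' (sh_pt f),
    y (sh_pt (sh_aff2 s l f g)) = l *: y (sh_pt f) + (1 - l) *: y (sh_pt g),
    sharp_gamma a (sh_aff2 s l f g) = sharp_gamma a f &
    sharp_alpha a0 a (sh_aff2 s l f g) =
    l *: sharp_alpha a0 a f + (1 - l) *: sharp_alpha a0 a g].
Proof.
move=> df E; have Ep := sh_aff2_pt l (esym E).
have Em : pi2' (sh_pt g) = pi2' (sh_pt f) by rewrite -!(sh_res_pt s) E.
have dg : cdom d (pi2' (sh_pt g)) by rewrite Em.
have Eg : sharp_gamma a g = sharp_gamma a f by rewrite -!res_coord// E.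
have [T1 T2] := adapted_aff2' had l df Em.
have [Gh Ah] : sharp_gamma a (sh_aff2 s l f g) = sharp_gamma a f /\
    sharp_alpha a0 a (sh_aff2 s l f g) =
    l *: sharp_alpha a0 a f + (1 - l) *: sharp_alpha a0 a g; last by rewrite Ep.
apply: (sharp_coord_uniq had Ha); rewrite Ep ?T1// => w Ew.
have dw : cdom d (pi2' (pi1 w)) by rewrite Ew T1.
have Ew2 : pi1' (pi2 w) = pi2' (sh_pt f) by rewrite -(adapted_comm hA) Ew T1.
have [x [Ex Ex2 Ec]] := adapted_surj hA had (c w) df (esym Ew2).
have [x' [Ex' Ex2' Ec']] := adapted_surj hA had (c w) dg (etrans Em (esym Ew2)).
have dx : cdom d (pi2' (pi1 x)) by rewrite Ex.
have Exx : pi2 x' = pi2 x by rewrite Ex2'.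
have -> : w = aff2 l x x'.
  have [E1 E2 E3] := adapted_aff2 hA had l dx Exx.
  have E4 : pi1 (aff2 l x x') = pi1 w.
    by rewrite (adapted_pi1_aff2 hA had)// Ex Ex' Ew.
  apply: (adapted_inj had) => //; rewrite ?E4 ?E1 ?Ex2//.
  by rewrite E3 Ec Ec' -scalerDl addrC subrK scale1r.
rewrite sh_aff2E// !(sharp_funE hA hs had hn Ha)// Eg.
by rewrite (sharp_eval_aff2 hA F).
Qed.

(** The blocks change roles: gamma coordinatises the dual of the core, now the second side, and (a0,
    alpha), of length 1 + q, becomes the core block. *)
Lemma dual_adapted : @adapted R (dual_dab s) d p r (1 + q) y
  (ddagger_coord b) (sharp_alpha a0 a).
Proof.
have [ty tz t1 t2] := had; have hS := premfd_sharp hA hs.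
split=> //.
- split=> //.
  + exact: ddagger_mchart.
  + by move=> m v dm; exact: (ddagger_surj hA hs had hn Hb).
  + move=> l f g df E; split; first exact: (dd_aff_pt s l (esym E)).
    exact: dd_aff_coord.
- split.
  + by case: t1.
  + apply: (@mchart_post R (Asharp sigma) (fchart (@sh_pt R A sigma)
      (fchart (@pi2' R A) d y)
      (fun f => row_mx (sharp_gamma a f) (sharp_alpha a0 a f)))
      (fchart (@sh_pt R A sigma) (fchart (@pi2' R A) d y)
      (fun f => row_mx (ddagger_coord b (sh_res s f)) (sharp_alpha a0 a f)))
      id id hS sharp_mchart) => //; try by move=> u; exact: sat_id.
    by move=> f /= df; rewrite res_coord.
  + move=> a1 v da.
    have [f [Ef Gf Af]] := sharp_surj hA hs had hn Ha (rsubmx v) (lsubmx v) da.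
    exists f; split; first exact: Ef.
    by rewrite /= res_coord ?Gf ?Af ?hsubmxK// Ef.
  + move=> l f g df E; have Ep := sh_aff1_pt s l (esym E).
    split; first exact: Ep.
    have [E1 E2] := sh_aff1_coord l df E.
    have dg : cdom d (pi2' (sh_pt g)) by rewrite (E : sh_pt g = sh_pt f).
    have dh : cdom d (pi2' (sh_pt (sh_aff1 s l f g))) by rewrite Ep.
    rewrite [LHS]/= (res_coord dh) E1 E2 (res_coord df) (res_coord dg).
    by rewrite !scale_row_mx !add_row_mx.
- split.
  + exact: ddagger_mchart.
  + pose r1 (u : 'rV[R]_((cdim d + p) + (r + (1 + q)))) :
        'rV[R]_((cdim d + r) + (p + (1 + q))) :=
      row_mx (row_mx (lsubmx (lsubmx u)) (lsubmx (rsubmx u)))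
             (row_mx (rsubmx (lsubmx u)) (rsubmx (rsubmx u))).
    pose r2 (u : 'rV[R]_((cdim d + r) + (p + (1 + q)))) :
        'rV[R]_((cdim d + p) + (r + (1 + q))) :=
      row_mx (row_mx (lsubmx (lsubmx u)) (lsubmx (rsubmx u)))
             (row_mx (rsubmx (lsubmx u)) (rsubmx (rsubmx u))).
    apply: (@mchart_post R (Asharp sigma) (fchart (@sh_pt R A sigma)
      (fchart (@pi2' R A) d y)
      (fun f => row_mx (sharp_gamma a f) (sharp_alpha a0 a f)))
      (fchart (sh_res s) (fchart (@dd_pt R A sigma) d (ddagger_coord b))
      (fun f => row_mx (y (sh_pt f)) (sharp_alpha a0 a f)))
      r1 r2 hS sharp_mchart).
    * by move=> f /=; rewrite sh_res_pt.
    * by move=> f /= df; rewrite res_coord// sh_res_pt /r1 !(row_mxKl, row_mxKr).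
    * by move=> u; rewrite /r1; smooth_coord.
    * by move=> u; rewrite /r2; smooth_coord.
    * by move=> u; rewrite /r1 /r2 !(row_mxKl, row_mxKr, hsubmxK).
    * by move=> u; rewrite /r1 /r2 !(row_mxKl, row_mxKr, hsubmxK).
  + move=> g v dg; have {}dg : cdom d (dd_pt g) := dg.
    have [_ _ /(_ _ (lsubmx v) dg)[a1 [Ea1 Ey]] _] := ty.
    have {}Ea1 : pi2' a1 = dd_pt g := Ea1.
    have da : cdom d (pi2' a1) by rewrite Ea1.
    have [f [Ef Gf Af]] := sharp_surj hA hs had hn Ha (rsubmx v) (ddagger_coord b g) da.
    exists f; split; last by rewrite /= Ef Ey Af hsubmxK.
    have Er : dd_pt (sh_res s f) = dd_pt g by rewrite sh_res_pt Ef.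
    apply: ddagger_coord_inj; rewrite ?Er//.
    by rewrite res_coord ?Gf// Ef.
  + move=> l f g df E; have {}df : cdom d (pi2' (sh_pt f)).
      by rewrite -(sh_res_pt s).
    have {}E : sh_res s g = sh_res s f := E.
    have [E1 E2 E3 E4] := sh_aff2_coord l df E; split; last first.
      by rewrite /= E2 E4 !scale_row_mx !add_row_mx.
    have Er : dd_pt (sh_res s (sh_aff2 s l f g)) = dd_pt (sh_res s f).
      by rewrite !sh_res_pt E1.
    apply: ddagger_coord_inj; rewrite ?Er ?sh_res_pt//.
    by rewrite !res_coord ?E3// E1.
Qed.

End Frame.

Lemma dual_adapted_dab : adapted_dab (dual_dab s).
Proof.
have [[h h1 h2 hM] _ _] := hA; split.
- by split=> //; [exact: premfd_sharp|exact: premfd_ddagger].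
- by move=> f; exact: esym (sh_res_pt s f).
- move=> m; have [d [p [q [r [y [z [c [a0 [a [b0 [b [dm F]]]]]]]]]]]] :=
    dual_frame_at hA hs m.
  exists d, p, r, (1 + q)%N, y, (ddagger_coord b), (sharp_alpha a0 a); split=> //.
  exact: dual_adapted F.
Qed.

End DualAdapted.

Lemma smap_dpt (R : realType) (E : abun R) (f : dagger E) : pre_affine E ->
  smap (@dpt R E : dagger E -> base E) f.
Proof.
move=> hE; have [hT hB tE] := hE; have hD := premfd_dagger hE.
have [d [k [phi [df tphi]]]] := tE (dpt f); have [md _ _ _] := tphi.
have [a0 [a Ha]] := dagger_coef_ex tphi.
have mc := dagger_mchart hE tphi Ha; set c := fchart _ _ _ in mc.
have cf : cdom c f by [].
exists d; split=> //; first exact: (mnear_cdom hD mc cf).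
apply: (msat_eq _ (msat_lsubmx hD (msat_cmap hD mc cf))) => g.
by rewrite /= row_mxKl.
Qed.

(** * The core of the dual *)

Section DualCore.
Context {R : realType} {A : dab R} (hA : adapted_dab A)
  {sigma : dM A -> core A} (hs : special_dab sigma) (s : dual_structure sigma).

Let hB := dual_adapted_dab hA hs s.

(* The core element of the dual which translates by [h \o pi2]. *)
Definition core_translation (h : dagger (bun1' A)) (e : core (dual_dab s)) : Prop :=
  core_proj e = @dpt R (bun1' A) h /\
  forall f g : Asharp sigma, sh_pt g = sh_pt f -> pi2' (sh_pt f) = dpt h ->
    (forall x : dA A, pi1 x = sh_pt f ->
      sh_fun g x = sh_fun f x + @dfun R (bun1' A) h (pi2 x)) ->
    val e = @core_diff R (dual_dab s) f g.

Section Frame.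
Context {d : chart R (dM A)} {p q r : nat} {y : dA1 A -> 'rV[R]_p}
  {z : dA2 A -> 'rV[R]_q} {c : dA A -> 'rV[R]_(1 + r)}
  {a0 : dagger_type (bun1 A) -> R} {a : dagger_type (bun1 A) -> 'rV[R]_(q + (1 + r))}
  {b0 : dagger_type (core_bun A) -> R}
  {b : dagger_type (core_bun A) -> 'rV[R]_(1 + r)}
  {h0 : dagger_type (bun1' A) -> R} {h1 : dagger_type (bun1' A) -> 'rV[R]_q}.
Hypothesis F : dual_frame (sigma := sigma) d y z c a0 a b0 b.
Hypothesis Hh : @dagger_coef R (bun1' A) d q z h0 h1.

Let had : adapted d y z c. Proof. by case: F. Qed.
Let hn : normalised sigma d c. Proof. by case: F. Qed.
Let Ha := let: And4 _ _ Ha _ := F in Ha.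
Let hadB := dual_adapted hA hs s F.

(** [dcoord] lists the constant term and z-coefficients of [h] in the order of [w], so adding it to
    [w] adds [h] evaluated at [pi2]. *)
Lemma sharp_evalD w g (h : dagger (bun1' A)) x : cdom d (dpt h) ->
  pi1' (pi2 x) = dpt h ->
  sharp_eval z c (w + dcoord h0 h1 h) g x =
  sharp_eval z c w g x + @dfun R (bun1' A) h (pi2 x).
Proof.
move=> dh Ex; rewrite (Hh dh Ex) /sharp_eval dotDl.
rewrite [dot (dcoord _ _ _) _]dot_row_mx dot_cst [const_mx 1 ord0 ord0]mxE mulr1.
rewrite -[\sum_j _]/(dot _ _); ring.
Qed.

(** Translation by a function of [pi2] leaves gamma unchanged, so [f] and [g] have the same
    projections on both sides and differ by a core vector. *)
Lemma core_diff_translation (h : dagger (bun1' A)) (f g : Asharp sigma) :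
  cdom d (dpt h) -> sh_pt g = sh_pt f -> pi2' (sh_pt f) = dpt h ->
  (forall x : dA A, pi1 x = sh_pt f ->
      sh_fun g x = sh_fun f x + @dfun R (bun1' A) h (pi2 x)) ->
  [/\ core_pred (@core_diff R (dual_dab s) f g),
      dhull_base (@core_diff R (dual_dab s) f g) = dpt h &
      core_c (A := dual_dab s) (sharp_alpha a0 a)
        (@core_diff R (dual_dab s) f g) = dcoord h0 h1 h].
Proof.
move=> dh Eg Em H.
have df : cdom d (pi2' (sh_pt f)) by rewrite Em.
have [Gg Ag] : sharp_gamma a g = sharp_gamma a f /\
    sharp_alpha a0 a g = sharp_alpha a0 a f + dcoord h0 h1 h.
  apply: (sharp_coord_uniq had Ha); rewrite Eg// => x Ex.
  rewrite H// sharp_evalD//; last by rewrite -(adapted_comm hA) Ex.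
  by rewrite (sharp_funE hA hs had hn Ha).
have Er : sh_res s g = sh_res s f.
  have Ep : dd_pt (sh_res s f) = dd_pt (sh_res s g) by rewrite !sh_res_pt Eg.
  apply: (ddagger_coord_inj hA hs F) => //; rewrite ?sh_res_pt ?Eg//.
  by rewrite !(res_coord hA hs s F) ?Eg// Gg.
have [C1 C2 C3] := core_diffP (A := dual_dab s) hB hadB (x := f) (x' := g) df Eg Er.
by split=> //; [rewrite C2 -Em|rewrite C3 Ag addrC addKr].
Qed.

(** The condition on [e] speaks of pairs f, g; one such pair has gamma = 0 and the coefficients 0
    and [dcoord h0 h1 h], over any point of [A1] above [dpt h]. *)
Lemma core_translation_coord (h : dagger (bun1' A)) e : cdom d (dpt h) -> core_translation h e ->
  core_coord (A := dual_dab s) (sharp_alpha a0 a) e = dcoord h0 h1 h.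
Proof.
move=> dh [_ H]; have [ty _ _ _] := had.
have [_ _ /(_ _ 0 dh)[a1 [Ea1 _]] _] := ty.
have {}Ea1 : pi2' a1 = dpt h := Ea1.
have da : cdom d (pi2' a1) by rewrite Ea1.
have [f [Ef Gf Af]] := sharp_surj hA hs had hn Ha 0 0 da.
have [g [Eg Gg Ag]] := sharp_surj hA hs had hn Ha (0 + dcoord h0 h1 h) 0 da.
have Efg : sh_pt g = sh_pt f by rewrite Ef Eg.
have Em : pi2' (sh_pt f) = dpt h by rewrite Ef Ea1.
have Hfg x : pi1 x = sh_pt f ->
    sh_fun g x = sh_fun f x + @dfun R (bun1' A) h (pi2 x).
  move=> Ex; have df : cdom d (pi2' (sh_pt f)) by rewrite Em.
  have dg : cdom d (pi2' (sh_pt g)) by rewrite Efg.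
  rewrite (sharp_funE hA hs had hn Ha df Ex).
  rewrite (sharp_funE hA hs had hn Ha dg (etrans Ex (esym Efg))).
  rewrite Gf Af Gg Ag sharp_evalD//.
  by rewrite -(adapted_comm hA) Ex.
have [_ _ E] := core_diff_translation dh Efg Em Hfg.
by rewrite /core_coord (H f g).
Qed.

Lemma core_translation_ex (h : dagger (bun1' A)) : cdom d (dpt h) ->
  exists e, core_translation h e.
Proof.
move=> dh; have [D [cD Em Ec]] := core_mk hB hadB (dcoord h0 h1 h) dh.
exists (exist _ D (mem_set cD)); split; first exact: Em.
move=> f g Efg Ef Hfg; have [C1 C2 C3] := core_diff_translation dh Efg Ef Hfg.
apply: (core_eq hB hadB cD C1).
- by rewrite Em.
- by rewrite C2 Em.
- by rewrite Ec C3.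
Qed.

End Frame.

Lemma dual_coords_at m : exists d p q r y z c a0 a b0 b h0 h1,
  [/\ cdom d m, @dual_frame R A sigma d p q r y z c a0 a b0 b &
      @dagger_coef R (bun1' A) d q z h0 h1].
Proof.
have [d [p [q [r [y [z [c [a0 [a [b0 [b [dm F]]]]]]]]]]]] := dual_frame_at hA hs m.
have [[_ tz _ _] _ _ _] := F; have [h0 [h1 Hh]] := dagger_coef_ex tz.
by exists d, p, q, r, y, z, c, a0, a, b0, b, h0, h1.
Qed.

Section Translation.
Variable Phi : dagger (bun1' A) -> core (dual_dab s).
Hypothesis HPhi : forall h, core_translation h (Phi h).

Lemma translation_proj h : core_proj (Phi h) = @dpt R (bun1' A) h.
Proof. by have [] := HPhi h. Qed.

Let p1' : pre_affine (bun1' A).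
Proof. by have [] := adapted_pre_affine hA. Qed.
Let pC := core_pre_affine hB.
Let hC := premfd_core hB.
Let hD := premfd_dagger p1'.

Lemma translation_inj : injective Phi.
Proof.
move=> h h' E.
have [d [p [q [r [y [z [c [a0 [a [b0 [b [h0 [h1 [dm F Hh]]]]]]]]]]]]]] :=
  dual_coords_at (dpt h).
have Ep : dpt h = dpt h' by rewrite -!translation_proj E.
have dm' : cdom d (dpt h') by rewrite -Ep.
have := core_translation_coord F Hh dm (HPhi h).
rewrite E (core_translation_coord F Hh dm' (HPhi h')).
move=> /eq_row_mx[/matrixP/(_ ord0 ord0) + E1]; rewrite !mxE => E0.
exact: (dagger_inj Hh dm Ep (esym E0) (esym E1)).
Qed.

Lemma translation_surj e : exists h, Phi h = e.
Proof.
have [d [p [q [r [y [z [c [a0 [a [b0 [b [h0 [h1 [dm F Hh]]]]]]]]]]]]]] :=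
  dual_coords_at (core_proj e).
have [[_ tz _ _] _ _ _] := F; have hadB := dual_adapted hA hs s F.
pose w := core_coord (A := dual_dab s) (sharp_alpha a0 a) e.
have [h [Eh E0 E1]] := dagger_surj tz Hh (lsubmx w ord0 ord0) (rsubmx w) dm.
have dh : cdom d (dpt h) by rewrite Eh.
exists h; apply: (core_coord_inj hB hadB).
- by rewrite translation_proj.
- by rewrite translation_proj.
rewrite (core_translation_coord F Hh dh (HPhi h)) /dcoord E0 E1 -[RHS]hsubmxK.
by congr row_mx; apply/rowP => i; rewrite mxE (ord1 i).
Qed.

(** With the coefficients of [h] on one side and (a0, alpha) on the other, [Phi] and its inverse are
    the identity in coordinates. *)
Lemma translation_diffeo : diffeo Phi.
Proof.
split.
  apply/(smooth_mapP _ hD hC) => h.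
  have [d [p [q [r [y [z [c [a0 [a [b0 [b [h0 [h1 [dm F Hh]]]]]]]]]]]]]] :=
    dual_coords_at (dpt h).
  have [[_ tz _ _] _ _ _] := F; have hadB := dual_adapted hA hs s F.
  have tC := core_triv hB hadB.
  have mc := dagger_mchart p1' tz Hh; set ch := fchart _ _ _ in mc.
  have ch_h : cdom ch h by [].
  have FD := mnear_filter hD h.
  apply: (triv_smap pC tC hD).
  - by rewrite [bproj _]translation_proj.
  - have -> : (fun h => @bproj R (core_bun (dual_dab s)) (Phi h)) =
        (@dpt R (bun1' A) : dagger (bun1' A) -> dM A).
      by apply/funext => h'; exact: translation_proj.
    exact: smap_dpt.
  - apply: (msat_ext hD (f := dcoord h0 h1)).
      apply: filterS (mnear_cdom hD mc ch_h) => h' dh' /=.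
      by rewrite (core_translation_coord F Hh dh' (HPhi h')).
    apply: (msat_eq _ (msat_rsubmx hD (msat_cmap hD mc ch_h))) => h'.
    by rewrite /= row_mxKr.
have [Psi HPsi] := choice translation_surj.
have PsiK : cancel Phi Psi by move=> h; apply: translation_inj.
exists Psi; split=> //.
apply/(smooth_mapP _ hC hD) => e.
have [d [p [q [r [y [z [c [a0 [a [b0 [b [h0 [h1 [dm F Hh]]]]]]]]]]]]]] :=
  dual_coords_at (core_proj e).
have [[_ tz _ _] _ _ _] := F; have hadB := dual_adapted hA hs s F.
have [_ mt _ _] := core_triv hB hadB; set ct := Chart _ _ in mt.
have mc := dagger_mchart p1' tz Hh; set ch := fchart _ _ _ in mc.
have Ep e' : dpt (Psi e') = core_proj e' by rewrite -translation_proj HPsi.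
have FC := mnear_filter hC e.
have ce : cdom ct e by [].
have nc := mnear_cdom hC mt ce.
exists ch; split=> //; first by rewrite /= Ep.
  by apply: filterS nc => e' de' /=; rewrite Ep.
apply: (msat_ext hC _ (msat_cmap hC mt ce)).
apply: filterS nc => e' de'.
have dh : cdom d (dpt (Psi e')) by rewrite Ep.
rewrite /= Ep; congr row_mx.
by rewrite -(core_translation_coord F Hh dh (HPhi _)) HPsi.
Qed.

Lemma translation_linear k (h h' h'' : dagger (bun1' A)) :
  dpt h = dpt h'' -> dpt h' = dpt h'' ->
  (forall b, dfun h'' b = k * dfun h b + dfun h' b) ->
  val (Phi h'') = @hadd R (hat (dual_dab s))
    (@hscale R (hat (dual_dab s)) k (val (Phi h))) (val (Phi h')).
Proof.
move=> Eh Eh' H.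
have [d [p [q [r [y [z [c [a0 [a [b0 [b [h0 [h1 [dm F Hh]]]]]]]]]]]]]] :=
  dual_coords_at (dpt h'').
have [[_ tz _ _] _ _ _] := F; have hadB := dual_adapted hA hs s F.
have dh : cdom d (dpt h) by rewrite Eh.
have dh' : cdom d (dpt h') by rewrite Eh'.
have [E0 E1] : h0 h'' = k * h0 h + h0 h' /\ h1 h'' = k *: h1 h + h1 h'.
  apply: (dagger_coef_uniq tz Hh dm) => e Ee.
  rewrite H (Hh h dh) ?Ee// (Hh h' dh') ?Ee//.
  rewrite -![\sum_j _]/(dot _ _) dotDl dotZl; ring.
rewrite -[X in hadd _ X](@hscale1 R (hat (dual_dab s))).
have cP g : core_pred (val (Phi g)) by exact: core_predE.
have dP : cdom d (dhull_base (val (Phi h))).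
  by rewrite -core_proj_dhull translation_proj.
have EP : dhull_base (val (Phi h')) = dhull_base (val (Phi h)).
  by rewrite -!core_proj_dhull !translation_proj Eh Eh'.
have [C1 C2 C3] := core_linear_comb hB hadB k 1 (cP h) (cP h') dP EP.
apply: (core_eq hB hadB (cP h'') C1).
- by rewrite -core_proj_dhull translation_proj.
- by rewrite C2 -!core_proj_dhull !translation_proj Eh.
rewrite C3 -!/(core_coord _ _) (core_translation_coord F Hh dm (HPhi h'')).
rewrite (core_translation_coord F Hh dh (HPhi h)).
rewrite (core_translation_coord F Hh dh' (HPhi h')).
rewrite /dcoord E0 E1 scale1r scale_row_mx add_row_mx; congr row_mx.
by apply/rowP => i; rewrite !mxE.
Qed.

End Translation.

End DualCore.

Theorem theorem4p1 (R : realType) (A : dab R) (sigma : dM A -> core A)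
    (hM : mconnected (dM A)) (hA : special_dab sigma) :
  exists (s : dual_structure sigma)
         (sigma' : dM (dual_dab s) -> core (dual_dab s)),
    special_dab sigma' /\
    exists Phi : dagger (bun1' A) -> core (dual_dab s),
      core_dual_iso sigma' Phi.
Proof.
have [hd _ _ _] := hA; have ad := double_affine_adapted hd.
have [s] := dual_structure_exists ad hA; exists s.
have hB := dual_adapted_dab ad hA s.
have [[_ _ [_ mM _ _] _] _ _ _ _] := hd.
have [_ _ p1' _] := adapted_pre_affine ad.
have premM := manifold_premfd mM.
have [Phi HPhi] : exists Phi, forall h, @core_translation R A sigma s h (Phi h).
  suff K (h : dagger (bun1' A)) : exists e, @core_translation R A sigma s h e.
    by have [Phi HPhi] := choice K; exists Phi.
  have [d [p [q [r [y [z [c [a0 [a [b0 [b [h0 [h1 [dm F Hh]]]]]]]]]]]]]] :=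
    dual_coords_at ad hA (dpt h).
  exact: (core_translation_ex ad hA s F Hh dm).
(* The distinguished section of the core of the dual will be the image under [Phi] of the constant
   functions 1. *)
have [one Hone] : exists one : dM A -> dagger (bun1' A), forall m,
    dpt (one m) = m /\ forall b, pi1' b = m -> dfun (one m) b = 1.
  suff K (m : dM A) : exists f : dagger (bun1' A),
      dpt f = m /\ forall b, pi1' b = m -> dfun f b = 1.
    by have [one Hone] := choice K; exists one.
  have [_ _ /(_ m)[d [k [phi [dm tphi]]]]] := p1'.
  have [cl _ _ _] := triv_aff_chart tphi dm.
  by have [f [Ef Hf]] := dagger_mk cl (@aff_on_cst R (bun1' A) R^o m 1); exists f.
have pone m : core_proj (Phi (one m)) = m.
  by rewrite (translation_proj HPhi); have [] := Hone m.
(* The function 1 has constant term 1 and no linear part, so its image is the constant row (1, 0) in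
   every frame: smooth and nowhere zero. *)
have cone d p q r y z c a0 a b0 b m : cdom d m ->
    @dual_frame R A sigma d p q r y z c a0 a b0 b ->
    core_coord (A := dual_dab s) (sharp_alpha a0 a) (Phi (one m)) = row_mx (const_mx 1) 0.
  move=> dm F; have [[_ tz _ _] _ _ _] := F.
  have [h0 [h1 Hh]] := dagger_coef_ex tz; have [E1 Hm] := Hone m.
  have dm' : cdom d (dpt (one m)) by rewrite E1.
  rewrite (core_translation_coord ad hA F Hh dm' (HPhi _)).
  have [E0 E] : h0 (one m) = 1 /\ h1 (one m) = 0.
    apply: (dagger_coef_uniq tz Hh dm') => e; rewrite E1 => Ee.
    by rewrite Hm// big1 ?addr0// => j _; rewrite mxE mul0r.
  by rewrite /dcoord E0 E.
exists (fun m => Phi (one m)); split; last first.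
  exists Phi; split.
  - exact: (translation_diffeo ad hA HPhi).
  - exact: (translation_proj HPhi).
  - exact: (translation_linear ad hA HPhi).
  - move=> h H; congr Phi; have [E1 Hm] := Hone (dpt h).
    by apply: dagger_ext => // b Eb; rewrite H// Hm.
  - by move=> h f g Eg Ef H; have [_] := HPhi h; exact.
split=> //.
- exact: adapted_double_affine_bundle.
- apply/(smooth_mapP _ premM (premfd_core hB)) => m.
  have [d [p [q [r [y [z [c [a0 [a [b0 [b [dm F]]]]]]]]]]]] := dual_frame_at ad hA m.
  have hadB := dual_adapted ad hA s F; have md := adapted_mchart hadB.
  have FM := mnear_filter premM m.
  apply: (triv_smap (core_pre_affine hB) (core_triv hB hadB) premM).
  + by rewrite [bproj _]pone.
  + have -> : (fun m => @bproj R (core_bun (dual_dab s)) (Phi (one m))) = id.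
      by apply/funext => m'; exact: pone.
    exact: smap_id.
  + apply: (msat_ext premM (f := fun=> row_mx (const_mx 1) 0)); last exact: msat_cst.
    by apply: filterS (mnear_cdom premM md dm) => m' dm' /=; rewrite (cone _ _ _ _ _ _ _ _ _ _ _ _ dm' F).
- move=> m E.
  have [d [p [q [r [y [z [c [a0 [a [b0 [b [dm F]]]]]]]]]]]] := dual_frame_at ad hA m.
  have hadB := dual_adapted ad hA s F; have [_ _ Z] := core_zeroP hB hadB dm.
  have := cone _ _ _ _ _ _ _ _ _ _ _ _ dm F.
  rewrite /core_coord E Z -row_mx0 => /eq_row_mx[/matrixP/(_ ord0 ord0)].
  by rewrite !mxE => /esym/eqP; rewrite oner_eq0.
Qed.
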